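(* Let $(\Sigma,h)$ be a compact Riemannian surface of genus at least $2$, with its induced Riemann surface structure, a fixed uniformisation $\mathcal D\to\Sigma$ by the Poincaré disc, and holomorphic coordinate $z$ on $\mathcal D$. Let $U$ be a globally holomorphic cubic differential on $\Sigma$ for which there exists a solution $u:\Sigma\to\mathbb R$ to $$\Delta_hu-16\|U\|_h^2e^{-2u}-2e^u-2\kappa_h=0. \qquad ( * )$$ On $\mathcal D$ write $e^uh=2s^2|dz|^2$ ($s>0$), $U=Q\,dz^3$, and let $\alpha=A\,dz+B\,d\bar z$ with $$A=\begin{pmatrix}s^{-1}s_z & 0 & s \\ -Qs^{-2} & -s^{-1}s_z & 0 \\ 0 & s & 0\end{pmatrix},\qquad B=\begin{pmatrix}-s^{-1}s_{\bar z} & \bar Qs^{-2} & 0 \\ 0 & s^{-1}s_{\bar z} & s \\ s & 0 & 0\end{pmatrix}.$$ Then we obtain a minimal Lagrangian immersion $\varphi:\mathcal D\to\mathbb{CH}^2$ by integration of the equations $F^{-1}dF=\alpha$, $F:\mathcal D\to SU(2,1)$ (namely $\varphi=\pi\circ f$, with $f$ the third column of $F$). The map $\varphi$ is uniquely determined, up to isometries of $\mathbb{CH}^2$, by the data $(\Sigma,e^uh,U)$, and is equivariant with respect to a holonomy representation $\rho:\pi_1\Sigma\to SU(2,1)$ lying in the conjugacy class corresponding to the flat $SU(2,1)$-bundle over $\Sigma$ determined by $\alpha$. Conversely, a conformal minimal Lagrangian immersion $\varphi:\mathcal D\to\mathbb{CH}^2$ which is equivariant with respect to a representation $\bar\rho:\pi_1\Sigma\to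 PSU(2,1)$ determines a metric $e^uh$ and a holomorphic cubic differential $U$ on $\Sigma$ which satisfy $( * )$. Up to conjugacy, the representation $\rho:\pi_1\Sigma\to SU(2,1)$ which this data determines lies over $\bar\rho$.
   Context: On $\mathbb C^3$ let $\langle u,v\rangle=u_1\bar v_1+u_2\bar v_2-u_3\bar v_3$, $W_-=\{u:\langle u,u\rangle<0\}$, $S_-=\{u:\langle u,u\rangle=-1\}$, and $\mathbb{CH}^2=\mathbb PW_-\subset\mathbb{CP}^2$ with projection $\pi:W_-\to\mathbb{CH}^2$. The Kähler structure on $\mathbb{CH}^2$ is obtained by identifying $T_{[u]}\mathbb{CH}^2$, $u\in S_-$, with $\mathcal H_u=\{v:\langle v,u\rangle=0\}$ with Riemannian metric $\mathrm{Re}\langle\,,\rangle$ and symplectic form $\mathrm{Im}\langle\,,\rangle$ (holomorphic sectional curvature $-4$). $\Delta_h$, $\kappa_h$ are the Laplacian and Gaussian curvature of $h$. If locally $h=\gamma|dz|^2$ and $U=Q\,dz^3$, then $\|U\|_h^2=|Q|^2/\gamma^3$ and $\Delta_h=\frac4\gamma\partial_z\partial_{\bar z}$. Flat bundle and holonomy: under a holomorphic change of coordinates $w(z)$ the local frame changes by $F\mapsto F\,\mathrm{diag}(z_w/|z_w|,\overline{z_w}/|z_w|,1)$, so $\alpha$ is the local expression of a flat connexion on a principal $SU(2,1)$-bundle over $\Sigma$. Concretely its holonomy $\rho$ satisfies $F(\gamma z)=\rho(\gamma)F(z)c_\gamma(z)^{-1}$ with $c_\gamma=\mathrm{diag}(\gamma'/|\gamma'|,\overline{\gamma'}/|\gamma'|,1)$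 for deck transformations $\gamma\in\pi_1\Sigma$, so that $f\circ\gamma=\rho(\gamma)f$. In the converse, the data are: $e^uh$ is the metric induced by $\varphi$ (descended to $\Sigma$); and if $f:\mathcal D\to S_-$ is a horizontal lift of $\varphi$ (i.e. $\pi\circ f=\varphi$ and $\langle f_z,f\rangle=0=\langle f_{\bar z},f\rangle$), then $U=\langle f_{zzz},f\rangle dz^3$. ''Lies over'' refers to the projection $SU(2,1)\to PSU(2,1)$. *)

(* Defs.v *)
From HB Require Import structures.
From mathcomp Require Import all_boot all_order all_algebra complex.
From mathcomp Require Import all_classical all_reals all_analysis.

Set Implicit Arguments.
Unset Strict Implicit.
Unset Printing Implicit Defensive.
Import Order.TTheory GRing.Theory Num.Theory numFieldNormedType.Exports.
Local Open Scope classical_set_scope.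
Local Open Scope ring_scope.
Local Open Scope complex_scope.

(** * Calculus on the unit disc

    Functions, metrics, differentials and maps on the disc are total functions
    on [R[i]]; only their values on [disc] matter.  Derivatives at points of
    the open set [disc] depend only on these values. *)

Definition disc {R : realType} : set R[i] := [set z | `|z| < 1].

(* Real directional derivative d/dt f (z + t v) at t = 0. *)
Definition pder {R : realType} (v : R[i]) (f : R[i] -> R[i]) (z : R[i]) : R[i] :=
  derive1 (fun t : R => complex.Re (f (z + t%:C * v))) 0
  +i* derive1 (fun t : R => complex.Im (f (z + t%:C * v))) 0.

Definition has_pder {R : realType} (v : R[i]) (f : R[i] -> R[i]) (z : R[i]) : Prop :=
  derivable (fun t : R => complex.Re (f (z + t%:C * v))) 0 1 /\
  derivable (fun t : R => complex.Im (f (z + t%:C * v))) 0 1.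

Fixpoint Ck {R : realType} (n : nat) (f : R[i] -> R[i]) : Prop :=
  (forall z, disc z -> {for z, continuous (f : R[i]^o -> R[i]^o)}) /\
  match n with
  | 0 => True
  | m.+1 => [/\ forall z, disc z -> has_pder 1 f z /\ has_pder 'i%C f z,
                Ck m (pder 1 f) & Ck m (pder 'i%C f)]
  end.

Definition smooth {R : realType} (f : R[i] -> R[i]) : Prop := forall n, Ck n f.

Definition dz {R : realType} (f : R[i] -> R[i]) (z : R[i]) : R[i] :=
  (pder 1 f z - 'i%C * pder 'i%C f z) / 2%:R.
Definition dzbar {R : realType} (f : R[i] -> R[i]) (z : R[i]) : R[i] :=
  (pder 1 f z + 'i%C * pder 'i%C f z) / 2%:R.

Definition holomorphic {R : realType} (f : R[i] -> R[i]) : Prop :=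
  smooth f /\ forall z, disc z -> dzbar f z = 0.

(* An operator on functions, applied to each entry of a matrix or vector
   valued function. *)
Definition entrywise {R : realType} {m n : nat}
    (L : (R[i] -> R[i]) -> R[i] -> R[i]) (F : R[i] -> 'M[R[i]]_(m, n))
    (z : R[i]) : 'M[R[i]]_(m, n) :=
  \matrix_(i, j) L (fun w => F w i j) z.

Definition smooth_mx {R : realType} {m n : nat} (F : R[i] -> 'M[R[i]]_(m, n)) : Prop :=
  forall i j, smooth (fun w => F w i j).

(** * The surface

    The surface is the quotient of the disc by its group [G] of deck
    transformations, which is the fundamental group: a group of holomorphic
    automorphisms of the disc acting freely, properly discontinuously and
    cocompactly.  A compact surface is of this form exactly when its genus is
    at least 2. *)

Record deck_group {R : realType} {G : groupType} (act : G -> R[i] -> R[i]) : Prop := {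
  deck_disc : forall g z, disc z -> disc (act g z);
  deck_one : forall z, disc z -> act 1%g z = z;
  deck_mul : forall g h z, disc z -> act (g * h)%g z = act g (act h z);
  deck_holomorphic : forall g, holomorphic (act g);
  deck_free : forall g z, disc z -> act g z = z -> g = 1%g;
  deck_proper : forall K : set R[i], compact (K : set R[i]^o) -> K `<=` disc ->
    finite_set [set g | exists2 z, K z & K (act g z)];
  deck_cocompact : exists K : set R[i],
    [/\ compact (K : set R[i]^o), K `<=` disc
      & forall z, disc z -> exists g, K (act g z)] }.

(* Smooth functions, conformal metrics [h |dz|^2] and holomorphic cubic
   differentials [Q dz^3] on the surface, given by their pull-backs to the
   disc. *)
Definition function_on {R : realType} {G : groupType} (act : G -> R[i] -> R[i])
    (u : R[i] -> R) : Prop :=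
  smooth (fun z => (u z)%:C) /\
  forall g z, disc z -> u (act g z) = u z.

Definition metric_on {R : realType} {G : groupType} (act : G -> R[i] -> R[i])
    (h : R[i] -> R) : Prop :=
  [/\ smooth (fun z => (h z)%:C),
      forall z, disc z -> 0 < h z
    & forall g z, disc z ->
        (h (act g z))%:C * `|dz (act g) z| ^+ 2 = (h z)%:C].

Definition cubic_on {R : realType} {G : groupType} (act : G -> R[i] -> R[i])
    (Q : R[i] -> R[i]) : Prop :=
  holomorphic Q /\
  forall g z, disc z -> Q (act g z) * dz (act g) z ^+ 3 = Q z.

Definition laplacian {R : realType} (h : R[i] -> R) (u : R[i] -> R) (z : R[i]) : R[i] :=
  4%:R / (h z)%:C * dz (dzbar (fun w => (u w)%:C)) z.

(* Gaussian curvature of [h |dz|^2] in the isothermal coordinate [z]. *)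
Definition gauss_curvature {R : realType} (h : R[i] -> R) (z : R[i]) : R[i] :=
  - (laplacian h (fun w => ln (h w)) z / 2%:R).

Definition cubic_norm2 {R : realType} (h : R[i] -> R) (Q : R[i] -> R[i]) (z : R[i]) : R[i] :=
  `|Q z| ^+ 2 / (h z)%:C ^+ 3.

Definition gauss_equation {R : realType} (h : R[i] -> R) (Q : R[i] -> R[i])
    (u : R[i] -> R) : Prop :=
  forall z, disc z ->
    laplacian h u z - 16%:R * cubic_norm2 h Q z * (expR (- 2%:R * u z))%:C
    - 2%:R * (expR (u z))%:C - 2%:R * gauss_curvature h z = 0.

(** * Complex hyperbolic plane and SU(2,1) *)

Definition herm {R : realType} (u v : 'cV[R[i]]_3) : R[i] :=
  u 0 0 * (v 0 0)^* + u 1 0 * (v 1 0)^* - u 2%:R 0 * (v 2%:R 0)^*.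

(* A point of the projective plane is the set of its homogeneous coordinate
   vectors. *)
Definition proj_pt {R : realType} (u : 'cV[R[i]]_3) : set 'cV[R[i]]_3 :=
  [set l *: u | l in [set l : R[i] | l != 0]].

Definition CH2 {R : realType} : set (set 'cV[R[i]]_3) :=
  [set proj_pt u | u in [set u : 'cV[R[i]]_3 | herm u u < 0]].

Definition SU21 {R : realType} (A : 'M[R[i]]_3) : Prop :=
  (forall u v : 'cV_3, herm (A *m u) (A *m v) = herm u v) /\ \det A = 1.

Definition mact {R : realType} (A : 'M[R[i]]_3) (p : set 'cV[R[i]]_3) : set 'cV[R[i]]_3 :=
  [set A *m u | u in p].

(* PSU(2,1) as the set of cosets of the centre of SU(2,1), which consists of
   the scalar matrices whose entry is a cube root of 1. *)
Definition PSU_class {R : realType} (A : 'M[R[i]]_3) : set 'M[R[i]]_3 :=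
  [set l *: A | l in [set l : R[i] | l ^+ 3 = 1]].

Definition PSU21 {R : realType} : set (set 'M[R[i]]_3) :=
  [set PSU_class A | A in SU21].

Definition SU_rep {R : realType} {G : groupType} (rho : G -> 'M[R[i]]_3) : Prop :=
  (forall g, SU21 (rho g)) /\
  forall g h, rho (g * h)%g = rho g *m rho h.

Definition PSU_rep {R : realType} {G : groupType} (rho : G -> set 'M[R[i]]_3) : Prop :=
  (forall g, PSU21 (rho g)) /\
  forall g h, rho (g * h)%g = [set A *m B | A in rho g & B in rho h].

(* [f] is a smooth lift of [phi] to the hyperquadric S_-.  Since the third
   coordinate does not vanish on W_-, the projection from W_- to CH2 has a
   global section, so the smooth maps from the disc to CH2 are those which
   have a smooth lift. *)
Definition S_lift {R : realType} (phi : R[i] -> set 'cV[R[i]]_3)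
    (f : R[i] -> 'cV[R[i]]_3) : Prop :=
  smooth_mx f /\
  forall z, disc z -> herm (f z) (f z) = -1 /\ proj_pt (f z) = phi z.

Definition horizontal_lift {R : realType} (phi : R[i] -> set 'cV[R[i]]_3)
    (f : R[i] -> 'cV[R[i]]_3) : Prop :=
  S_lift phi f /\
  forall z, disc z -> herm (entrywise dz f z) (f z) = 0 /\
                      herm (entrywise dzbar f z) (f z) = 0.

(* Projection of C^3 onto the orthogonal complement H_(f z) of f z in S_-. *)
Definition hor {R : realType} (f : R[i] -> 'cV[R[i]]_3) (z : R[i])
    (w : 'cV[R[i]]_3) : 'cV[R[i]]_3 :=
  w + herm w (f z) *: f z.

(* The differential of phi at z applied to v, as an element of H_(f z).
   Another lift [c f], |c| = 1, multiplies it by [c]; the notions below do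
   not depend on the lift. *)
Definition dphi {R : realType} (f : R[i] -> 'cV[R[i]]_3) (v z : R[i]) : 'cV[R[i]]_3 :=
  hor f z (entrywise (pder v) f z).

Definition pull_metric {R : realType} (f : R[i] -> 'cV[R[i]]_3) (z v w : R[i]) : R :=
  complex.Re (herm (dphi f v z) (dphi f w z)).
Definition pull_symplectic {R : realType} (f : R[i] -> 'cV[R[i]]_3) (z v w : R[i]) : R :=
  complex.Im (herm (dphi f v z) (dphi f w z)).

(* Levi-Civita derivative in the direction v of a vector field along phi; the
   field is given by V z in H_(f z).  When f is horizontal it is the horizontal
   part of the derivative of V, because S_- -> CH2 is a Riemannian submersion;
   the second term makes the formula independent of the phase of f. *)
Definition cov {R : realType} (f : R[i] -> 'cV[R[i]]_3) (v : R[i])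
    (V : R[i] -> 'cV[R[i]]_3) (z : R[i]) : 'cV[R[i]]_3 :=
  hor f z (entrywise (pder v) V z + herm (entrywise (pder v) f z) (f z) *: V z).

(* det(g) g^{ij} cov_i (d phi_j) for the induced metric g; the component normal
   to phi is a positive multiple of the mean curvature vector. *)
Definition trace_hessian {R : realType} (f : R[i] -> 'cV[R[i]]_3) (z : R[i]) :
    'cV[R[i]]_3 :=
  (pull_metric f z 'i%C 'i%C)%:C *: cov f 1 (dphi f 1) z
  - (2%:R * pull_metric f z 1 'i%C)%:C *: cov f 1 (dphi f 'i%C) z
  + (pull_metric f z 1 1)%:C *: cov f 'i%C (dphi f 'i%C) z.

Definition immersion {R : realType} (phi : R[i] -> set 'cV[R[i]]_3) : Prop :=
  exists2 f, S_lift phi f &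
    forall z v, disc z -> dphi f v z = 0 -> v = 0.

Definition lagrangian {R : realType} (phi : R[i] -> set 'cV[R[i]]_3) : Prop :=
  exists2 f, S_lift phi f &
    forall z v w, disc z -> pull_symplectic f z v w = 0.

(* The mean curvature vector vanishes: it is orthogonal to every normal n. *)
Definition minimal {R : realType} (phi : R[i] -> set 'cV[R[i]]_3) : Prop :=
  exists2 f, S_lift phi f &
    forall z (n : 'cV[R[i]]_3), disc z -> herm n (f z) = 0 ->
      (forall v, complex.Re (herm n (dphi f v z)) = 0) ->
      complex.Re (herm (trace_hessian f z) n) = 0.

Definition minimal_lagrangian_immersion {R : realType}
    (phi : R[i] -> set 'cV[R[i]]_3) : Prop :=
  [/\ immersion phi, lagrangian phi & minimal phi].

(* The metric induced by phi is [lam |dz|^2]. *)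
Definition induced_metric {R : realType} (phi : R[i] -> set 'cV[R[i]]_3)
    (lam : R[i] -> R) : Prop :=
  exists2 f, S_lift phi f &
    forall z v w, disc z -> pull_metric f z v w = lam z * complex.Re (v * w^*).

Definition conformal {R : realType} (phi : R[i] -> set 'cV[R[i]]_3) : Prop :=
  exists lam, induced_metric phi lam.

(* The cubic differential of phi is [Q dz^3]. *)
Definition induced_cubic {R : realType} (phi : R[i] -> set 'cV[R[i]]_3)
    (Q : R[i] -> R[i]) : Prop :=
  (exists f, horizontal_lift phi f) /\
  forall f, horizontal_lift phi f -> forall z, disc z ->
    Q z = herm (entrywise (fun k => dz (dz (dz k))) f z) (f z).

(* Riemannian isometries of CH2: smoothness of T and preservation of the
   metric are tested on smooth maps from the disc to CH2. *)
Definition CH2_isometry {R : realType} (T : set 'cV[R[i]]_3 -> set 'cV[R[i]]_3) : Prop :=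
  set_bij CH2 CH2 T /\
  forall psi f, S_lift psi f ->
    exists2 f', S_lift (T \o psi) f' &
      forall z v w, disc z -> pull_metric f' z v w = pull_metric f z v w.

(** * The flat connexion *)

Definition mx3 {R : realType} (rows : seq (seq R[i])) : 'M[R[i]]_3 :=
  \matrix_(i, j) (nth [::] rows i)`_j.

(* [s > 0] with [e^u h |dz|^2 = 2 s^2 |dz|^2]. *)
Definition s_of {R : realType} (h u : R[i] -> R) (z : R[i]) : R :=
  Num.sqrt (expR (u z) * h z / 2%:R).

Definition alphaA {R : realType} (s : R[i] -> R) (Q : R[i] -> R[i]) (z : R[i]) :
    'M[R[i]]_3 :=
  let sz := dz (fun w => (s w)%:C) z in
  let s := (s z)%:C in
  mx3 [:: [:: s^-1 * sz;           0;               s];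
          [:: - (Q z * s ^- 2);    - (s^-1 * sz);   0];
          [:: 0;                   s;               0]].

Definition alphaB {R : realType} (s : R[i] -> R) (Q : R[i] -> R[i]) (z : R[i]) :
    'M[R[i]]_3 :=
  let sz := dzbar (fun w => (s w)%:C) z in
  let s := (s z)%:C in
  mx3 [:: [:: - (s^-1 * sz);   (Q z)^* * s ^- 2;   0];
          [:: 0;               s^-1 * sz;          s];
          [:: s;               0;                  0]].

(* F : disc -> SU(2,1) with F^{-1} dF = alpha = A dz + B dzbar. *)
Definition frame {R : realType} (s : R[i] -> R) (Q : R[i] -> R[i])
    (F : R[i] -> 'M[R[i]]_3) : Prop :=
  [/\ smooth_mx F,
      forall z, disc z -> SU21 (F z)
    & forall z, disc z ->
        invmx (F z) *m entrywise dz F z = alphaA s Q z /\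
        invmx (F z) *m entrywise dzbar F z = alphaB s Q z].

Definition frame_map {R : realType} (F : R[i] -> 'M[R[i]]_3) (z : R[i]) :
    set 'cV[R[i]]_3 :=
  proj_pt (col ord_max (F z)).

Definition cocycle {R : realType} {G : groupType} (act : G -> R[i] -> R[i])
    (g : G) (z : R[i]) : 'M[R[i]]_3 :=
  let g' := dz (act g) z in
  mx3 [:: [:: g' / `|g'|;   0;               0];
          [:: 0;            g'^* / `|g'|;    0];
          [:: 0;            0;               1]].

Definition monodromy {R : realType} {G : groupType} (act : G -> R[i] -> R[i])
    (F : R[i] -> 'M[R[i]]_3) (rho : G -> 'M[R[i]]_3) : Prop :=
  forall g z, disc z -> F (act g z) = rho g *m F z *m invmx (cocycle act g z).

(* [rho] is a holonomy representation of the flat SU(2,1)-bundle determined by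
   alpha. *)
Definition holonomy {R : realType} {G : groupType} (act : G -> R[i] -> R[i])
    (s : R[i] -> R) (Q : R[i] -> R[i]) (rho : G -> 'M[R[i]]_3) : Prop :=
  SU_rep rho /\ exists2 F, frame s Q F & monodromy act F rho.

(* Main.v *)
(** The structure equations of a horizontal lift [f] of a conformal minimal
    Lagrangian map say that [(f_z / s, f_zbar / s, f)] is, up to a constant
    phase, a solution of [F^-1 dF = alpha] in SU(2,1); the integrability
    condition of this system, flatness of [alpha], amounts to holomorphy of [Q]
    together with the Gauss equation.  A flat system is integrated by parallel
    transport along the radii of the disc: flatness makes the first variation
    of the transport in its end point equal to [alpha] up to an error which
    solves a linear equation with a source of second order.

    Two solutions differ by a constant left factor, because [F J F'^*] is
    constant.  Applied to a frame [F] and to its pull-backs [F (g z) c_g z] by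
    deck transformations, which are again frames, this gives the uniqueness and
    the holonomy.  In the converse, two horizontal lifts differ by a constant
    phase, so [f (g z) = c A f z] with [A] over [rhobar g] and [|c| = 1]; the
    holonomy of [g] is then [c A], and its determinant forces [c^3 = 1]. *)
Require Import Defs.
From HB Require Import structures.
From mathcomp Require Import all_boot all_order all_algebra complex.
From mathcomp Require Import all_classical all_reals all_analysis.
From mathcomp Require Import ring lra.

Set Implicit Arguments.
Unset Strict Implicit.
Unset Printing Implicit Defensive.
Import Order.TTheory GRing.Theory Num.Theory numFieldNormedType.Exports.
Local Open Scope classical_set_scope.
Local Open Scope complex_scope.
Local Open Scope ring_scope.

(** * Wirtinger calculus *)

(** Radial integration must produce a function of two real variables out of one-variable problems,
    without knowing beforehand that the transport is differentiable in its end point. The derivative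
    is therefore guessed and the error bounded, which calls for Taylor remainders uniform on closed
    discs and for linear equations with explicit constants. Total derivatives in the sense of
    Caratheodory supply the chain rule along rays and under deck transformations, which directional
    derivatives alone do not give.

    The integration theorem is proved for matrices of any size and serves twice: with size 3 for the
    frame, with size 1 for the phase that makes a Lagrangian lift horizontal. The flatness
    computation also serves in both directions: holomorphy and the Gauss equation give a frame,
    while in the converse the moving frame of a horizontal lift already solves the system, so that
    equality of its mixed derivatives returns both equations. In the converse minimality enters at a
    single point: the mixed derivative of the lift is [s^2] times the lift. *)

Section Norm.
Context {R : realType}.
Implicit Types (z w : R[i]).

(** The norm of [R[i]] takes values in [R[i]] itself. This l1 norm is real-valued, so order
    reasoning over [R] applies, and bounds on real and imaginary parts simply add up. *)
Definition N z : R := `|complex.Re z| + `|complex.Im z|.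

Lemma ReD z w : complex.Re (z + w) = complex.Re z + complex.Re w.
Proof. by case: z => a b; case: w. Qed.
Lemma ImD z w : complex.Im (z + w) = complex.Im z + complex.Im w.
Proof. by case: z => a b; case: w. Qed.
Lemma ReN z : complex.Re (- z) = - complex.Re z.
Proof. by case: z. Qed.
Lemma ImN z : complex.Im (- z) = - complex.Im z.
Proof. by case: z. Qed.
Lemma ReM z w : complex.Re (z * w) =
  complex.Re z * complex.Re w - complex.Im z * complex.Im w.
Proof. by case: z => a b; case: w. Qed.
Lemma ImM z w : complex.Im (z * w) =
  complex.Re z * complex.Im w + complex.Im z * complex.Re w.
Proof. by case: z => a b; case: w. Qed.
Lemma conjcE z : z^* = conjc z. Proof. by []. Qed.
Lemma ReJ z : complex.Re z^* = complex.Re z.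
Proof. by case: z. Qed.
Lemma ImJ z : complex.Im z^* = - complex.Im z.
Proof. by case: z. Qed.
Lemma cJD z w : (z + w)^* = z^* + w^*. Proof. exact: rmorphD. Qed.
Lemma cJN z : (- z)^* = - z^*. Proof. exact: rmorphN. Qed.
Lemma cJM z w : (z * w)^* = z^* * w^*. Proof. exact: rmorphM. Qed.
Lemma cJV z : (z^-1)^* = (z^*)^-1. Proof. exact: fmorphV. Qed.
Lemma cJX z n : (z ^+ n)^* = z^* ^+ n. Proof. exact: rmorphXn. Qed.
Lemma cJR (x : R) : (x%:C)^* = x%:C. Proof. exact: conjc_real. Qed.
Lemma cJK z : z^*^* = z. Proof. exact: conjCK. Qed.
Lemma cJ0 : 0^* = 0 :> R[i]. Proof. exact: rmorph0. Qed.
Lemma cJ1 : 1^* = 1 :> R[i]. Proof. exact: rmorph1. Qed.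
Lemma cJn n : (n%:R)^* = n%:R :> R[i]. Proof. exact: rmorph_nat. Qed.
Definition cJE := (cJD, cJN, cJM, cJV, cJX, cJ0, cJ1, cJn, cJR, cJK).
Definition ReImE := (ReD, ImD, ReN, ImN, ReM, ImM, ReJ, ImJ).

Lemma complex_ext z w :
  complex.Re z = complex.Re w -> complex.Im z = complex.Im w -> z = w.
Proof. by case: z => a b; case: w => c d /= -> ->. Qed.

Lemma N_ge0 z : 0 <= N z. Proof. exact: addr_ge0. Qed.
Lemma ND z w : N (z + w) <= N z + N w.
Proof. by rewrite /N !ReImE addrACA lerD ?ler_normD. Qed.
Lemma NN z : N (- z) = N z.
Proof. by rewrite /N !ReImE !normrN. Qed.
Lemma NB z w : N (z - w) <= N z + N w.
Proof. by rewrite -(NN w) ND. Qed.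
Lemma NBC z w : N (z - w) = N (w - z).
Proof. by rewrite -NN opprB. Qed.
Lemma NJ z : N z^* = N z.
Proof. by rewrite /N !ReImE normrN. Qed.
Lemma NM z w : N (z * w) <= N z * N w.
Proof.
rewrite /N !ReImE mulrDl !mulrDr -!normrM.
rewrite [X in _ <= X](_ : _ = (`|complex.Re z * complex.Re w| + `|complex.Im z * complex.Im w|)
   + (`|complex.Re z * complex.Im w| + `|complex.Im z * complex.Re w|)); last by ring.
by rewrite lerD ?ler_normB ?ler_normD.
Qed.
Lemma N0 : N 0 = 0. Proof. by rewrite /N /= !normr0 addr0. Qed.
Lemma N_eq0 z : N z = 0 -> z = 0.
Proof.
move/eqP; rewrite /N paddr_eq0 // !normr_eq0 => /andP[/eqP h1 /eqP h2].
exact: complex_ext.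
Qed.
Lemma N_real (x : R) : N x%:C = `|x|.
Proof. by rewrite /N /= normr0 addr0. Qed.
Lemma N1 : N 1 = 1. Proof. by rewrite (N_real 1) normr1. Qed.
Lemma NMr (x : R) z : N (x%:C * z) = `|x| * N z.
Proof. by rewrite /N !ReImE /= !mul0r subr0 addr0 !normrM mulrDr. Qed.
Lemma N_le_Re z : `|complex.Re z| <= N z.
Proof. by rewrite /N lerDl. Qed.
Lemma N_le_Im z : `|complex.Im z| <= N z.
Proof. by rewrite /N lerDr. Qed.
Lemma NsumM (I : Type) (r : seq I) (P : pred I) (F : I -> R[i]) :
  N (\sum_(i <- r | P i) F i) <= \sum_(i <- r | P i) N (F i).
Proof.
elim/big_rec2: _ => [|i y x _ le]; first by rewrite N0.
by rewrite (le_trans (ND _ _)) ?lerD2l.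
Qed.

(** The modulus read in [R]. It defines the disc and is multiplicative, where [N] is only
    submultiplicative; passing between the two costs at most a factor 2. *)
Definition cabs z : R := complex.Re `|z|.
Lemma cabsE z : `|z| = (cabs z)%:C.
Proof. by rewrite /cabs normc_def. Qed.
Lemma cabs_sqr z : cabs z ^+ 2 = complex.Re z ^+ 2 + complex.Im z ^+ 2.
Proof. by rewrite /cabs normc_def sqr_sqrtr // addr_ge0 ?sqr_ge0. Qed.
Lemma cabs_ge0 z : 0 <= cabs z.
Proof. by rewrite /cabs normc_def sqrtr_ge0. Qed.
Lemma cabs0 : cabs 0 = 0. Proof. by rewrite /cabs normr0. Qed.
Lemma cabsM z w : cabs (z * w) = cabs z * cabs w.
Proof. by apply: complexI; rewrite rmorphM -!cabsE normrM. Qed.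
Lemma cabsBC z w : cabs (z - w) = cabs (w - z).
Proof. by apply: complexI; rewrite -!cabsE distrC. Qed.
Lemma cabsR (x : R) : 0 <= x -> cabs x%:C = x.
Proof. by move=> x0; apply: complexI; rewrite -cabsE ger0_norm ?ler0c. Qed.
Lemma cabsD z w : cabs (z + w) <= cabs z + cabs w.
Proof. by rewrite -lecR rmorphD -!cabsE ler_normD. Qed.
Lemma cabs_le_N z : cabs z <= N z.
Proof.
rewrite -(@ler_pXn2r _ 2) ?nnegrE ?cabs_ge0 ?N_ge0 // cabs_sqr /N.
have h1 : `|complex.Re z| ^+ 2 = complex.Re z ^+ 2 by rewrite real_normK ?num_real.
have h2 : `|complex.Im z| ^+ 2 = complex.Im z ^+ 2 by rewrite real_normK ?num_real.
rewrite -h1 -h2 -subr_ge0; set a := `|complex.Re z|; set b := `|complex.Im z|.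
have -> : (a + b) ^+ 2 - (a ^+ 2 + b ^+ 2) = 2 * (a * b) by ring.
by apply: mulr_ge0 => //; apply: mulr_ge0; rewrite normr_ge0.
Qed.
Lemma N_le_cabs z : N z <= 2 * cabs z.
Proof.
rewrite -(@ler_pXn2r _ 2) ?nnegrE ?mulr_ge0 ?cabs_ge0 ?N_ge0 // exprMn cabs_sqr.
rewrite /N.
have h1 : `|complex.Re z| ^+ 2 = complex.Re z ^+ 2 by rewrite real_normK ?num_real.
have h2 : `|complex.Im z| ^+ 2 = complex.Im z ^+ 2 by rewrite real_normK ?num_real.
rewrite -h1 -h2; set a := `|complex.Re z|; set b := `|complex.Im z|.
rewrite -subr_ge0.
have -> : 2 ^+ 2 * (a ^+ 2 + b ^+ 2) - (a + b) ^+ 2 = (a - b) ^+ 2 + 2 * a^+2 + 2 * b^+2 by ring.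
by rewrite addr_ge0 ?addr_ge0 ?sqr_ge0 // mulr_ge0 // sqr_ge0.
Qed.
Lemma cabs_le_ReIm z (x : R) : 0 <= x -> (cabs z <= x) = (complex.Re z ^+ 2 + complex.Im z ^+ 2 <= x ^+ 2).
Proof. by move=> x0; rewrite -cabs_sqr ler_pXn2r ?nnegrE ?cabs_ge0. Qed.

Record cont (f : R[i] -> R[i]) z : Prop :=
  Cont { cont_for : {for z, continuous (f : R[i]^o -> R[i]^o)} }.

Lemma nbhs_N z (P : R[i] -> Prop) :
  (\forall w \near (z : R[i]^o), P w) <->
  exists2 d : R, 0 < d & forall w, N (w - z) < d -> P w.
Proof.
split.
  case/nbhs_ballP => e e0 h.
  (* A positive element of [R[i]] is real, so complex radii reduce to real ones. *)
  have /complex_realP[d ed] : (e : R[i]) \is Num.real by exact: gtr0_real.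
  have d0 : 0 < d by move: e0; rewrite /= ed ltcR.
  exists d => // w wd; apply: h; rewrite /ball /= ed cabsE ltcR.
  by apply: le_lt_trans (cabs_le_N _) _; rewrite NBC.
case=> d d0 h; apply/nbhs_ballP; exists (d / 2)%:C; first by rewrite /= ltcR divr_gt0.
move=> w; rewrite /ball /= cabsE ltcR => wd; apply: h.
by rewrite NBC (le_lt_trans (N_le_cabs _)) // mulrC -ltr_pdivlMr.
Qed.

Lemma contP f z : cont f z <->
  forall e : R, 0 < e -> exists2 d : R, 0 < d & forall w, N (w - z) < d -> N (f w - f z) < e.
Proof.
split=> [[h] e e0|h].
  have e0' : (0 : R) < e / 2 by rewrite divr_gt0.
  have /cvgrPdist_lt/(_ (e/2)%:C) := h.
  rewrite ltcR => /(_ e0')/nbhs_N[d d0 hd]; exists d => // w /hd.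
  rewrite distrC cabsE ltcR => H; apply: le_lt_trans (N_le_cabs _) _.
  by rewrite mulrC -ltr_pdivlMr.
apply: Cont; apply/(@cvgrPdist_lt R[i] R[i]^o R[i] (nbhs (z:R[i]^o)) _ f (f z)) => e e0.
have /complex_realP[d ed] : (e : R[i]) \is Num.real by exact: gtr0_real.
have d0 : 0 < d by move: e0; rewrite /= ed ltcR.
have [d' d'0 hd] := h _ d0; apply/nbhs_N; exists d' => // w /hd H.
by rewrite distrC ed cabsE ltcR (le_lt_trans (cabs_le_N _)).
Qed.

Lemma cont_cst c z : cont (fun=> c) z.
Proof. exact: Cont (@cst_continuous R[i]^o R[i]^o c z). Qed.
Lemma cont_id z : cont id z. Proof. by apply: Cont. Qed.
Lemma contD f g z : cont f z -> cont g z -> cont (fun w => f w + g w) z.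
Proof. by move=> [hf] [hg]; exact: Cont (@continuousD R[i] R[i]^o R[i]^o f g z hf hg). Qed.
Lemma contN f z : cont f z -> cont (fun w => - f w) z.
Proof. by move=> [hf]; exact: Cont (@continuousN R[i] R[i]^o R[i]^o f z hf). Qed.
Lemma contB f g z : cont f z -> cont g z -> cont (fun w => f w - g w) z.
Proof. by move=> hf hg; exact: contD hf (contN hg). Qed.
Lemma contM f g z : cont f z -> cont g z -> cont (fun w => f w * g w) z.
Proof. by move=> [hf] [hg]; exact: Cont (@continuousM R[i] R[i]^o f g z hf hg). Qed.
Lemma contV f z : f z != 0 -> cont f z -> cont (fun w => (f w)^-1) z.
Proof. by move=> h [hf]; exact: Cont (@continuousV R[i] R[i]^o f z h hf). Qed.
Lemma cont_comp f g z : cont g z -> cont f (g z) -> cont (fun w => f (g w)) z.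
Proof.
by move=> [hg] [hf]; exact: Cont (@continuous_comp R[i]^o R[i]^o R[i]^o g f z hg hf).
Qed.
Lemma contJ f z : cont f z -> cont (fun w => (f w)^*) z.
Proof.
move/contP => h; apply/contP => e /h[d d0 hd]; exists d => // w /hd.
by rewrite -rmorphB NJ.
Qed.
Lemma cont_sum (I : Type) (r : seq I) (f : I -> R[i] -> R[i]) z :
  (forall i, cont (f i) z) -> cont (fun w => \sum_(i <- r) f i w) z.
Proof.
move=> h; elim: r => [|i r IH].
  have -> : (fun w => \sum_(j <- [::]) f j w) = fun=> 0.
    by apply/funext => w; rewrite big_nil.
  exact: cont_cst.
have -> : (fun w => \sum_(j <- i :: r) f j w) = fun w => f i w + \sum_(j <- r) f j w.
  by apply/funext => w; rewrite big_cons.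
exact: contD (h i) IH.
Qed.

(** A function of a real variable is read as one of a complex variable through [complex.Re], so that
    every rule for [cont] also serves for curves. *)
Definition rcont (g : R -> R[i]) (t : R) := cont (fun w => g (complex.Re w)) t%:C.

Lemma rcontP g t : rcont g t <->
  forall e : R, 0 < e -> exists2 d : R, 0 < d & forall s, `|s - t| < d -> N (g s - g t) < e.
Proof.
split=> [/contP h e /h[d d0 hd]|h].
  exists d => // s st; have := hd s%:C; rewrite -rmorphB N_real; exact.
apply/contP => e /h[d d0 hd]; exists d => // w wt /=; apply: hd.
by apply: le_lt_trans wt; apply: le_trans (N_le_Re _); rewrite !ReImE.
Qed.

Lemma contRe f z : cont f z -> cont (fun w => (complex.Re (f w))%:C) z.
Proof.
move/contP => h; apply/contP => e /h[d d0 hd]; exists d => // w /hd.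
apply: le_lt_trans; rewrite -rmorphB N_real; apply: le_trans (N_le_Re _).
by rewrite !ReImE.
Qed.

Lemma rcont_comp f g t : rcont g t -> cont f (g t) -> rcont (fun s => f (g s)) t.
Proof. exact: cont_comp. Qed.

Lemma cont_line z v (t : R) : rcont (fun s => z + s%:C * v) t.
Proof.
apply: contD; first exact: cont_cst.
by apply: contM; [apply: contRe; exact: cont_id|exact: cont_cst].
Qed.

Lemma rcont_Re g t : rcont g t -> {for t, continuous (fun s => complex.Re (g s))}.
Proof.
move/rcontP => h; apply/cvgrPdist_lt => e /h[d d0 hd].
apply/nbhs_ballP; exists d => // s; rewrite /ball /= distrC => /hd H.
by rewrite distrC; apply: le_lt_trans H; apply: le_trans (N_le_Re _); rewrite !ReImE.
Qed.
Lemma rcont_Im g t : rcont g t -> {for t, continuous (fun s => complex.Im (g s))}.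
Proof.
move/rcontP => h; apply/cvgrPdist_lt => e /h[d d0 hd].
apply/nbhs_ballP; exists d => // s; rewrite /ball /= distrC => /hd H.
by rewrite distrC; apply: le_lt_trans H; apply: le_trans (N_le_Im _); rewrite !ReImE.
Qed.
End Norm.

Section Wirtinger.
Context {R : realType}.
Implicit Types (z w : R[i]) (f g : R[i] -> R[i]).

(* Differentiability over the reals, after Caratheodory; [a] and [b] are the
   derivatives with respect to [z] and its conjugate. *)
Definition wd f z a b := exists p q : R[i] -> R[i],
  [/\ cont p z, cont q z, p z = a, q z = b &
      forall w, f w - f z = p w * (w - z) + q w * (w - z)^*].

Lemma wd_eq f z a b a' b' : wd f z a b -> a = a' -> b = b' -> wd f z a' b'.
Proof. by move=> h <- <-. Qed.

Lemma wd_ext f g z a b : f =1 g -> wd f z a b -> wd g z a b.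
Proof. by move/funext ->. Qed.

Lemma wd_cont f z a b : wd f z a b -> cont f z.
Proof.
case=> p [q [hp hq _ _ e]].
have -> : f = fun w => f z + (p w * (w - z) + q w * (w - z)^*).
  by apply/funext => w; rewrite -e addrC subrK.
have h : cont (fun w => w - z) z by exact: contB (cont_id z) (cont_cst z z).
exact: contD (cont_cst _ _) (contD (contM hp h) (contM hq (contJ h))).
Qed.

Lemma wd_cst c z : wd (fun=> c) z 0 0.
Proof.
exists (fun=> 0), (fun=> 0); split=> //; try by exact: cont_cst.
by move=> w; rewrite !mul0r subrr addr0.
Qed.
Lemma wd_id z : wd id z 1 0.
Proof.
exists (fun=> 1), (fun=> 0); split=> //; try by exact: cont_cst.
by move=> w; rewrite mul0r mul1r addr0.
Qed.
Lemma wdJ f z a b : wd f z a b -> wd (fun w => (f w)^*) z b^* a^*.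
Proof.
case=> p [q [hp hq <- <- e]]; exists (fun w => (q w)^*), (fun w => (p w)^*).
split; [exact: contJ hq|exact: contJ hp|by []|by []|].
by move=> w; rewrite -cJN -cJD e !cJE; ring.
Qed.
Lemma wdD f g z a b c d : wd f z a b -> wd g z c d ->
  wd (fun w => f w + g w) z (a + c) (b + d).
Proof.
case=> p [q [hp hq <- <- e]] [r [s [hr hs <- <- e']]].
exists (fun w => p w + r w), (fun w => q w + s w).
split; [exact: contD hp hr|exact: contD hq hs|by []|by []|].
by move=> w; rewrite opprD addrACA e e'; ring.
Qed.
Lemma wdM f g z a b c d : wd f z a b -> wd g z c d ->
  wd (fun w => f w * g w) z (a * g z + f z * c) (b * g z + f z * d).
Proof.
move=> hf hg; have cf := wd_cont hf; have cg := wd_cont hg.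
case: hf => p [q [hp hq <- <- e]]; case: hg => [r [s [hr hs <- <- e']]].
exists (fun w => p w * g z + f w * r w), (fun w => q w * g z + f w * s w).
have cz k : cont (fun=> k : R[i]) z by exact: cont_cst.
split; [| |by []|by []|].
- exact: contD (contM hp (cz _)) (contM cf hr).
- exact: contD (contM hq (cz _)) (contM cf hs).
move=> w; have -> : f w * g w - f z * g z = (f w - f z) * g z + f w * (g w - g z) by ring.
by rewrite e e'; ring.
Qed.
Lemma wdN f z a b : wd f z a b -> wd (fun w => - f w) z (- a) (- b).
Proof.
move=> h; have := wdM (wd_cst (-1) z) h.
by rewrite !mul0r !add0r !mulN1r; apply: wd_ext => w; rewrite mulN1r.
Qed.
Lemma wdB f g z a b c d : wd f z a b -> wd g z c d ->
  wd (fun w => f w - g w) z (a - c) (b - d).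
Proof. by move=> hf hg; exact: wdD hf (wdN hg). Qed.
Lemma wdZ k f z a b : wd f z a b -> wd (fun w => k * f w) z (k * a) (k * b).
Proof.
by move=> h; have := wdM (wd_cst k z) h; rewrite !mul0r !add0r.
Qed.
Lemma wd_comp f g z a b c d : wd f (g z) a b -> wd g z c d ->
  wd (fun w => f (g w)) z (a * c + b * d^*) (a * d + b * c^*).
Proof.
move=> hf hg; have cg := wd_cont hg.
case: hf => p [q [hp hq <- <- e]]; case: hg => [r [s [hr hs <- <- e']]].
exists (fun w => p (g w) * r w + q (g w) * (s w)^*), (fun w => p (g w) * s w + q (g w) * (r w)^*).
split; [| |by []|by []|].
- exact: contD (contM (cont_comp cg hp) hr) (contM (cont_comp cg hq) (contJ hs)).
- exact: contD (contM (cont_comp cg hp) hs) (contM (cont_comp cg hq) (contJ hr)).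
- move=> w; rewrite e e' !cJE; ring.
Qed.

(** The whole remainder is charged to the coefficient of [w - z]: divided by [w - z] it tends to 0
    at [z], while the conjugate coefficient stays constant. At [w = z] the quotient is 0 because the
    inverse of 0 is 0, so [p z = a]. *)
Lemma wd_of_littleo f z a b :
  (forall e : R, 0 < e -> exists2 d : R, 0 < d & forall w, N (w - z) < d ->
     N (f w - f z - (a * (w - z) + b * (w - z)^*)) <= e * N (w - z)) ->
  wd f z a b.
Proof.
move=> h.
pose p w := a + (f w - f z - (a * (w - z) + b * (w - z)^*)) / (w - z).
exists p, (fun=> b); split=> //; last first.
- move=> w; rewrite /p; have [->|wz] := eqVneq w z.
    by rewrite !subrr cJ0 !mulr0 addr0.
  by field; rewrite subr_eq0.
- by rewrite /p !subrr invr0 mulr0 addr0.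
- exact: cont_cst.
(* Going from [N] to [cabs] and back costs a factor 2 each way, which leaves [e / 2 < e]. *)
apply/contP => e e0; have e4 : 0 < e / 8 by rewrite divr_gt0.
have [d d0 hd] := h _ e4; exists d => // w /hd H.
rewrite /p !subrr invr0 mulr0 addr0 addrAC subrr add0r.
have [->|wz] := eqVneq w z; first by rewrite !subrr invr0 mulr0 N0.
set x := f w - f z - _ in H *.
have nz : 0 < cabs (w - z).
  by rewrite -ltcR -cabsE normr_gt0 subr_eq0.
have H1 : cabs x <= e / 8 * (2 * cabs (w - z)).
  apply: le_trans (cabs_le_N _) _; apply: le_trans H _.
  by rewrite ler_pM2l // N_le_cabs.
have H2 : cabs (x / (w - z)) = cabs x / cabs (w - z).
  by apply: complexI; rewrite -cabsE normrM normfV !cabsE rmorphM fmorphV.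
apply: le_lt_trans (N_le_cabs _) _; rewrite H2.
rewrite mulrA ltr_pdivrMr //; nra.
Qed.

Lemma littleo_of_wd f z a b : wd f z a b ->
  forall e : R, 0 < e -> exists2 d : R, 0 < d & forall w, N (w - z) < d ->
     N (f w - f z - (a * (w - z) + b * (w - z)^*)) <= e * N (w - z).
Proof.
case=> p [q [/contP hp /contP hq <- <- h]] e e0.
have e2 : 0 < e / 2 by rewrite divr_gt0.
have [d1 d10 h1] := hp _ e2; have [d2 d20 h2] := hq _ e2.
exists (Num.min d1 d2); first by rewrite lt_min d10.
move=> w; rewrite lt_min => /andP[/h1 H1 /h2 H2]; rewrite h.
have -> : p w * (w - z) + q w * (w - z)^* - (p z * (w - z) + q z * (w - z)^*)
 = (p w - p z) * (w - z) + (q w - q z) * (w - z)^* by ring.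
apply: le_trans (ND _ _) _; apply: le_trans (lerD (NM _ _) (NM _ _)) _.
rewrite NJ -mulrDl ler_wpM2r ?N_ge0 //; lra.
Qed.

(** The factorisation in [wd] is required at every [w], although differentiability is a local
    matter; passing through the little-o form and back restores locality. *)
Lemma wd_local f g z a b : (exists2 d : R, 0 < d & forall w, N (w - z) < d -> f w = g w) ->
  wd f z a b -> wd g z a b.
Proof.
case=> d d0 h /littleo_of_wd H; apply: wd_of_littleo => e /H[d' d'0 h'].
exists (Num.min d d'); first by rewrite lt_min d0.
move=> w; rewrite lt_min => /andP[/h <- /h' H']; rewrite -h //.
by rewrite subrr N0.
Qed.

Lemma wdV f z a b : f z != 0 -> wd f z a b ->
  wd (fun w => (f w)^-1) z (- (a / f z ^+ 2)) (- (b / f z ^+ 2)).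
Proof.
move=> f0 hf; have cf := wd_cont hf.
case: hf => p [q [hp hq <- <- e]].
have [] := cf.
move/(@cvgrPdist_lt R[i] R[i]^o R[i] (nbhs (z:R[i]^o)) _ f (f z))/(_ `|f z|).
rewrite normr_gt0 => /(_ f0)/nbhs_N[d d0 hd].
(* [f] may vanish far from [z], where no slope of the inverse could be written down. [h] agrees with
   [f] near [z] and vanishes nowhere. *)
pose h w := if f w == 0 then f z else f w.
have hE w : N (w - z) < d -> f w = h w.
  by move/hd; rewrite /h; case: eqP => // ->; rewrite subr0 ltxx.
have hz : h z = f z by rewrite /h (negbTE f0).
have ch : cont h z.
  move/contP: cf => cf; apply/contP => e' /cf[d' d'0 hd'].
  exists (Num.min d d'); first by rewrite lt_min d0.
  by move=> w; rewrite lt_min => /andP[/hE H /hd']; rewrite hz -H.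
have h0 w : h w != 0 by rewrite /h; case: ifPn.
have whz : wd h z (p z) (q z).
  by apply: wd_local (_ : wd f z _ _); [exists d|exists p, q].
apply: (@wd_local (fun w => (h w)^-1)); first by exists d => // w /hE ->.
case: whz => p' [q' [hp' hq' <- <- e']]; rewrite -hz.
exists (fun w => - (p' w / (h w * h z))), (fun w => - (q' w / (h w * h z))).
have cc : cont (fun w => (h w * h z)^-1) z.
  apply: contV; first by rewrite mulf_neq0.
  by apply: contM => //; exact: cont_cst.
split; [exact: contN (contM hp' cc)|exact: contN (contM hq' cc)|by []|by []|].
move=> w; have -> : (h w)^-1 - (h z)^-1 = - ((h w - h z) / (h w * h z)).
  by field; rewrite !h0.
by rewrite e'; ring.
Qed.

Lemma wd_sum (I : Type) (r : seq I) (f : I -> R[i] -> R[i]) z a b :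
  (forall i, wd (f i) z (a i) (b i)) ->
  wd (fun w => \sum_(i <- r) f i w) z (\sum_(i <- r) a i) (\sum_(i <- r) b i).
Proof.
move=> h; elim: r => [|i r IH].
  by apply: (wd_ext (f := fun=> 0)) => [w|]; rewrite !big_nil //; exact: wd_cst.
rewrite !big_cons; apply: (wd_ext (f := fun w => f i w + \sum_(j <- r) f j w)).
  by move=> w; rewrite big_cons.
exact: wdD.
Qed.

Lemma is_derive_of_lim (f : R -> R) (t c : R) (k : R -> R) :
  {for 0, continuous k} -> k 0 = c ->
  (forall s, f (t + s) - f t = s * k s) -> is_derive t 1 f c.
Proof.
move=> ck k0 hk.
have H : (fun s : R => s^-1 *: ((f \o shift t) (s *: (1:R)) - f t)) @ 0^' --> c.
  rewrite -k0; apply: cvg_trans; last exact: cvg_trans (cvg_app k (@nbhs_dnbhs R 0)) ck.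
  apply: near_eq_cvg; near=> s => /=.
  have -> : s *: (1:R) + t = t + s by rewrite [s *: _]mulr1 addrC.
  rewrite hk [s^-1 *: _]mulrA mulVf ?mul1r //.
  near: s; exact: nbhs_dnbhs_neq.
by split; [apply/cvg_ex; exists c|apply/cvg_lim].
Unshelve. all: by end_near. Qed.

Lemma is_derive_slope (g : R -> R[i]) (k : R -> R[i]) t c : rcont k 0 -> k 0 = c ->
  (forall s, g (t + s) - g t = s%:C * k s) ->
  is_derive t 1 (fun s => complex.Re (g s)) (complex.Re c) /\
  is_derive t 1 (fun s => complex.Im (g s)) (complex.Im c).
Proof.
move=> ck k0 ek.
split; [apply: (@is_derive_of_lim _ _ _ (fun s => complex.Re (k s)))
       |apply: (@is_derive_of_lim _ _ _ (fun s => complex.Im (k s)))].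
- exact: rcont_Re.
- by rewrite k0.
- by move=> s; have := congr1 (@complex.Re _) (ek s); rewrite !ReImE /= mul0r subr0.
- exact: rcont_Im.
- by rewrite k0.
- by move=> s; have := congr1 (@complex.Im _) (ek s); rewrite !ReImE /= mul0r addr0.
Qed.

Lemma wd_slope f z a b v : wd f z a b -> exists k : R -> R[i],
  [/\ rcont k 0, k 0 = a * v + b * v^* &
    forall s : R, f (z + s%:C * v) - f z = s%:C * k s].
Proof.
case=> p [q [hp hq <- <- e]].
exists (fun s => p (z + s%:C * v) * v + q (z + s%:C * v) * v^*).
split.
- have hl := cont_line z v 0.
  have cz m : cont (fun=> m : R[i]) (0:R)%:C by exact: cont_cst.
  have hp0 : rcont (fun s : R => p (z + s%:C * v)) 0.
    by apply: (rcont_comp hl); rewrite mul0r addr0.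
  have hq0 : rcont (fun s : R => q (z + s%:C * v)) 0.
    by apply: (rcont_comp hl); rewrite mul0r addr0.
  exact: contD (contM hp0 (cz _)) (contM hq0 (cz _)).
- by rewrite mul0r addr0.
- by move=> s; rewrite e addrAC subrr add0r !cJE; ring.
Qed.

Lemma wd_is_derive f z a b v : wd f z a b ->
  is_derive (0:R) 1 (fun t : R => complex.Re (f (z + t%:C * v))) (complex.Re (a * v + b * v^*)) /\
  is_derive (0:R) 1 (fun t : R => complex.Im (f (z + t%:C * v))) (complex.Im (a * v + b * v^*)).
Proof.
case/(wd_slope v) => k [ck k0 ek].
apply: (@is_derive_slope (fun t : R => f (z + t%:C * v)) k) => // s.
by rewrite add0r mul0r addr0.
Qed.

Lemma wd_has_pder f z a b v : wd f z a b -> has_pder v f z.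
Proof. by case/(wd_is_derive v) => h1 h2; split; exact: ex_derive. Qed.

Lemma wd_pder f z a b v : wd f z a b -> pder v f z = a * v + b * v^*.
Proof.
case/(wd_is_derive v) => h1 h2; rewrite /pder !derive1E.
by apply: complex_ext => /=; apply: derive_val.
Qed.

Lemma mul_ii : 'i%C * 'i%C = -1 :> R[i]. Proof. by rewrite -expr2 sqr_i. Qed.
Lemma conj_i : ('i%C : R[i])^* = - 'i%C.
Proof. by apply: complex_ext => //=; rewrite oppr0. Qed.
Lemma two_neq0 : 2%:R != 0 :> R[i]. Proof. by rewrite pnatr_eq0. Qed.

Lemma wd_dz f z a b : wd f z a b -> dz f z = a.
Proof.
move=> h; rewrite /dz (wd_pder 1 h) (wd_pder 'i%C h) cJ1 conj_i.
apply: (mulIf two_neq0); rewrite divfK ?two_neq0 //.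
have -> : a * 1 + b * 1 - 'i%C * (a * 'i%C + b * - 'i%C) = a + b - ('i%C * 'i%C) * (a - b) by ring.
by rewrite mul_ii; ring.
Qed.
Lemma wd_dzbar f z a b : wd f z a b -> dzbar f z = b.
Proof.
move=> h; rewrite /dzbar (wd_pder 1 h) (wd_pder 'i%C h) cJ1 conj_i.
apply: (mulIf two_neq0); rewrite divfK ?two_neq0 //.
have -> : a * 1 + b * 1 + 'i%C * (a * 'i%C + b * - 'i%C) = a + b + ('i%C * 'i%C) * (a - b) by ring.
by rewrite mul_ii; ring.
Qed.

Lemma wd_dE f z a b : wd f z a b -> wd f z (dz f z) (dzbar f z).
Proof. by move=> h; rewrite (wd_dz h) (wd_dzbar h). Qed.

Lemma wd_unique f z a b a' b' : wd f z a b -> wd f z a' b' -> a = a' /\ b = b'.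
Proof.
by move=> h h'; rewrite -(wd_dz h) -(wd_dz h') -(wd_dzbar h) -(wd_dzbar h').
Qed.

End Wirtinger.

(** * Derivatives of curves, mean value estimates, and total differentiability from continuous
    partials *)

Section Curves.
Context {R : realType}.
Implicit Types (z w : R[i]) (f : R[i] -> R[i]) (g : R -> R[i]).

(* A curve is read as a function of a complex variable that depends only on
   its real part, so that the rules for [wd] apply to it. *)
Definition cder g (t : R) (c : R[i]) :=
  wd (fun w => g (complex.Re w)) t%:C (c / 2) (c / 2).

Lemma cder_eq g t c c' : cder g t c -> c = c' -> cder g t c'.
Proof. by move=> h <-. Qed.

Lemma cder_ext g g' t c : g =1 g' -> cder g t c -> cder g' t c.
Proof. by move/funext ->. Qed.

Lemma cder_rcont g t c : cder g t c -> rcont g t.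
Proof. exact: wd_cont. Qed.

Lemma cder_cst k t : cder (fun=> k) t 0.
Proof. by apply: wd_eq (wd_cst _ _) _ _; rewrite mul0r. Qed.

(** The real part is half the sum of [w] and its conjugate; this is why both Wirtinger coefficients
    of a curve are half its velocity. *)
Lemma cder_id t : cder (fun s => s%:C) t 1.
Proof.
have h := wdZ (2^-1) (wdD (wd_id t%:C) (wdJ (wd_id t%:C))).
apply: wd_eq (wd_ext _ h) _ _; rewrite ?cJE; try by ring.
move=> w; apply: (mulfI (two_neq0 (R := R))); rewrite mulVKf ?two_neq0 //.
by case: w => x y; apply: complex_ext; rewrite /= ?ReImE /=; ring.
Qed.

Lemma cderD g g' t c c' : cder g t c -> cder g' t c' ->
  cder (fun s => g s + g' s) t (c + c').
Proof. by move=> h h'; apply: wd_eq (wdD h h') _ _; ring. Qed.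
Lemma cderN g t c : cder g t c -> cder (fun s => - g s) t (- c).
Proof. by move=> h; apply: wd_eq (wdN h) _ _; ring. Qed.
Lemma cderB g g' t c c' : cder g t c -> cder g' t c' ->
  cder (fun s => g s - g' s) t (c - c').
Proof. by move=> h h'; exact: cderD h (cderN h'). Qed.
Lemma cderM g g' t c c' : cder g t c -> cder g' t c' ->
  cder (fun s => g s * g' s) t (c * g' t + g t * c').
Proof. by move=> h h'; apply: wd_eq (wdM h h') _ _; rewrite /=; ring. Qed.
Lemma cder_sum (I : Type) (r : seq I) (F : I -> R -> R[i]) t (c : I -> R[i]) :
  (forall i, cder (F i) t (c i)) ->
  cder (fun s => \sum_(i <- r) F i s) t (\sum_(i <- r) c i).
Proof.
by move=> h; apply: wd_eq (wd_sum r h) _ _; rewrite mulr_suml.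
Qed.
Lemma wd_cder f g t a b c : wd f (g t) a b -> cder g t c ->
  cder (fun s => f (g s)) t (a * c + b * c^*).
Proof.
move=> h h'.
have H := @wd_comp _ f (fun w => g (complex.Re w)) t%:C a b _ _ h h'.
by apply: wd_eq H _ _; rewrite !cJE; ring.
Qed.
Lemma cder_line z v t : cder (fun s => z + s%:C * v) t v.
Proof.
by apply: cder_eq (cderD (cder_cst z t) (cderM (cder_id t) (cder_cst v t))) _; ring.
Qed.

Lemma cder_is_derive g (t : R) (c : R[i]) : cder g t c ->
  is_derive t 1 (fun s : R => complex.Re (g s)) (complex.Re c) /\
  is_derive t 1 (fun s : R => complex.Im (g s)) (complex.Im c).
Proof.
case/(wd_slope 1) => k [ck k0 ek].
apply: (is_derive_slope ck); first by rewrite k0 cJ1; field.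
by move=> s; rewrite -ek !ReImE /= mulr1 mul0r subr0.
Qed.

Lemma is_derive_slope_cvg (f : R -> R) (t c : R) : is_derive t 1 f c ->
  forall e : R, 0 < e -> exists2 d : R, 0 < d & forall s, `|s| < d ->
    `|f (t + s) - f t - s * c| <= e * `|s|.
Proof.
case=> /cvg_ex[l hl] lc e e0.
have {}lc : l = c by rewrite -lc; apply/esym/cvg_lim.
move: hl; rewrite lc => /cvgrPdist_le/(_ e e0); rewrite near_withinE.
case/nbhs_ballP => d d0 h; exists d => // s sd.
have [->|s0] := eqVneq s 0; first by rewrite addr0 subrr mul0r subrr normr0 mulr0.
have := h s; rewrite /ball /= sub0r normrN => /(_ sd s0).
have -> : s *: (1:R) + t = t + s by rewrite [s *: _]mulr1 addrC.
rewrite -(ler_pM2r (x := `|s|)) ?normr_gt0 // -normrM mulrBl.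
by rewrite [s^-1 *: _]mulrC divfK // distrC [c * s]mulrC.
Qed.

Lemma cder_of_is_derive g (t : R) (c : R[i]) :
  is_derive t 1 (fun s : R => complex.Re (g s)) (complex.Re c) ->
  is_derive t 1 (fun s : R => complex.Im (g s)) (complex.Im c) -> cder g t c.
Proof.
move=> /is_derive_slope_cvg h1 /is_derive_slope_cvg h2.
apply: wd_of_littleo => e e0; have e2 : 0 < e / 2 by rewrite divr_gt0.
have [d1 d10 hd1] := h1 _ e2; have [d2 d20 hd2] := h2 _ e2.
exists (Num.min d1 d2); first by rewrite lt_min d10.
move=> w; rewrite lt_min => /andP[w1 w2].
set s := complex.Re w - t.
have hs : `|s| <= N (w - t%:C) by have := N_le_Re (w - t%:C); rewrite !ReImE.
have H1 := hd1 s (le_lt_trans hs w1); have H2 := hd2 s (le_lt_trans hs w2).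
have -> : c / 2 * (w - t%:C) + c / 2 * (w - t%:C)^* = s%:C * c.
  rewrite -mulrDr.
  have -> : (w - t%:C) + (w - t%:C)^* = 2 * s%:C.
    by rewrite /s; case: (w) => x y; apply: complex_ext; rewrite ?ReImE /=; ring.
  by field.
have ws : complex.Re w = t + s by rewrite /s addrC subrK.
apply: (@le_trans _ _ (e * `|s|)); last by rewrite ler_pM2l.
rewrite ws /= /N !ReImE /= mul0r subr0 mul0r addr0.
by apply: le_trans (lerD H1 H2) _; rewrite -mulrDl -splitr.
Qed.

(** Both [h + f] and [h - f] start out nonnegative and have nonnegative derivatives. An inequality
    is all that is wanted, since the mean value equality fails for complex-valued curves. *)
Lemma mean_value_bound (f h f' h' : R -> R) :
  (forall t : R, 0 <= t <= 1 -> is_derive t 1 f (f' t)) ->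
  (forall t : R, 0 <= t <= 1 -> is_derive t 1 h (h' t)) ->
  (forall t : R, 0 <= t <= 1 -> `|f' t| <= h' t) -> `|f 0| <= h 0 ->
  forall t : R, 0 <= t <= 1 -> `|f t| <= h t.
Proof.
move=> df dh fh' fh0 t t01.
have aux (k k' : R -> R) :
    (forall t : R, 0 <= t <= 1 -> is_derive t 1 k (k' t)) ->
    (forall t : R, 0 <= t <= 1 -> 0 <= k' t) -> 0 <= k 0 -> 0 <= k t.
  move=> dk k'0 k0.
  have t0 : 0 <= t by case/andP: t01.
  have sub s : s \in `[0, t] -> 0 <= s <= 1.
    by rewrite in_itv /= => /andP[s0 st]; rewrite s0 (le_trans st) //; case/andP: t01.
  have [||c ct] := @MVT_segment _ k k' 0 t t0.
  - by move=> s st; apply/dk/sub; apply: subset_itv_oo_cc st.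
  - by apply: derivable_within_continuous => s /sub/dk[].
  move=> e; rewrite -(subrK (k 0) (k t)) e subr0 addr_ge0 // mulr_ge0 //.
  exact/k'0/sub.
rewrite ler_norml -subr_ge0 opprK; apply/andP; split.
  rewrite addrC; apply: (aux (h + f) (fun s => h' s + f' s)) => [s hs|s hs|].
  - by apply: is_deriveD; [exact: dh|exact: df].
  - by have := fh' s hs; rewrite ler_norml => /andP[? _]; lra.
  - by move: fh0; rewrite ler_norml -[(h + f) 0]/(h 0 + f 0) => /andP[? _]; lra.
rewrite -subr_ge0; apply: (aux (h - f) (fun s => h' s - f' s)) => [s hs|s hs|].
- by apply: is_deriveB; [exact: dh|exact: df].
- by have := fh' s hs; rewrite ler_norml => /andP[_ ?]; lra.
- by move: fh0; rewrite ler_norml -[(h - f) 0]/(h 0 - f 0) => /andP[_ ?]; lra.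
Qed.

(** Real and imaginary parts are bounded separately by [h], whence the factor 2. *)
Lemma cder_mean_value_bound g g' (h h' : R -> R) :
  (forall t : R, 0 <= t <= 1 -> cder g t (g' t)) ->
  (forall t : R, 0 <= t <= 1 -> is_derive t 1 h (h' t)) ->
  (forall t : R, 0 <= t <= 1 -> N (g' t) <= h' t) -> N (g 0) <= h 0 ->
  forall t : R, 0 <= t <= 1 -> N (g t) <= 2 * h t.
Proof.
move=> dg dh gh' gh0 t t01; rewrite /N mulr2n mulrDl !mul1r lerD //.
- apply: (@mean_value_bound (fun s => complex.Re (g s)) h (fun s => complex.Re (g' s)) h' _ dh _ _ _ t01).
  + by move=> s /dg/cder_is_derive[].
  + by move=> s /gh'; apply: le_trans; exact: N_le_Re.
  + exact: le_trans (N_le_Re _) gh0.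
- apply: (@mean_value_bound (fun s => complex.Im (g s)) h (fun s => complex.Im (g' s)) h' _ dh _ _ _ t01).
  + by move=> s /dg/cder_is_derive[].
  + by move=> s /gh'; apply: le_trans; exact: N_le_Im.
  + exact: le_trans (N_le_Im _) gh0.
Qed.

Lemma is_derive_linear (e t : R) : is_derive t 1 (fun s => e * s) e.
Proof.
apply: (@is_derive_of_lim _ _ _ _ (fun=> e)) => //; first exact: cst_continuous.
by move=> s; ring.
Qed.

(** Subtracting the uniform motion [g 0 + t c] leaves a curve of speed at most [e], which is
    compared with the linear function [e t]. *)
Lemma cder_mvi g g' c (e : R) :
  (forall t : R, 0 <= t <= 1 -> cder g t (g' t)) ->
  (forall t : R, 0 <= t <= 1 -> N (g' t - c) <= e) -> N (g 1 - g 0 - c) <= 2 * e.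
Proof.
move=> dg ge.
have := @cder_mean_value_bound (fun t => g t - g 0 - t%:C * c) (fun t => g' t - c)
  (fun s => e * s) (fun=> e).
move=> /(_ _ _ ge _ 1); rewrite mul1r mulr1; apply.
- move=> t /dg h; apply: cder_eq (cderB (cderB h (cder_cst (g 0) t))
    (cderM (cder_id t) (cder_cst c t))) _; ring.
- by move=> t _; exact: is_derive_linear.
- by rewrite mul0r subrr subr0 N0 mulr0.
- by rewrite ler01 lexx.
Qed.

(** [pder] is a derivative at time 0 with moving base point; the affine substitution [s x - t x]
    carries it to time [t] of a line traversed at speed [x]. *)
Lemma cder_pder f z v (x t : R) : has_pder v f (z + (t * x)%:C * v) ->
  cder (fun s => f (z + (s * x)%:C * v)) t (x%:C * pder v f (z + (t * x)%:C * v)).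
Proof.
set p := z + _ => -[h1 h2].
have hG : cder (fun s => f (p + s%:C * v)) 0 (pder v f p).
  by apply: cder_of_is_derive => /=; rewrite derive1E; exact: derivableP.
have hg : cder (fun s => s%:C * x%:C - (t * x)%:C) t x%:C.
  apply: cder_eq (cderB (cderM (cder_id t) (cder_cst x%:C t)) (cder_cst (t * x)%:C t)) _.
  by ring.
have g0 : (fun s => s%:C * x%:C - (t * x)%:C) t = (0:R)%:C.
  by rewrite -rmorphM subrr.
rewrite /cder -g0 in hG.
apply: cder_eq (cder_ext _ (wd_cder hG hg)) _; last by rewrite cJR; field.
move=> s /=; congr f; rewrite /p -addrA; congr (_ + _); rewrite -mulrDl; congr (_ * _).
by rewrite -rmorphD /=; congr (_%:C); ring.
Qed.

(** The way from [z] to [w] is split into a horizontal and a vertical step, along which only the two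
    partial derivatives occur. Each step is controlled by [cder_mvi], since the partials stay close
    to their values at [z]. *)
Lemma wd_of_C1 f z (r : R) : 0 < r ->
  (forall w, N (w - z) < r -> has_pder 1 f w /\ has_pder 'i%C f w) ->
  cont (pder 1 f) z -> cont (pder 'i%C f) z -> wd f z (dz f z) (dzbar f z).
Proof.
move=> r0 hf /contP c1 /contP c2; apply: wd_of_littleo => e e0.
have e2 : 0 < e / 2 by rewrite divr_gt0.
have [d1 d10 h1] := c1 _ e2; have [d2 d20 h2] := c2 _ e2.
exists (Num.min r (Num.min d1 d2)); first by rewrite !lt_min r0 d10.
move=> w; rewrite !lt_min => /and3P[wr w1 w2].
set x := complex.Re (w - z); set y := complex.Im (w - z).
have Nw : N (w - z) = `|x| + `|y| by [].
have wE : w = z + x%:C + y%:C * 'i%C.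
  by rewrite -addrA [_ * 'i%C]mulrC -complexE addrC subrK.
have E : dz f z * (w - z) + dzbar f z * (w - z)^* = x%:C * pder 1 f z + y%:C * pder 'i%C f z.
  have -> : w - z = x%:C + y%:C * 'i%C by rewrite [RHS]addrC [_ * 'i%C]mulrC addrC -complexE.
  rewrite /dz /dzbar !cJE (_ : ('i%C : R[i])^* = - 'i%C); last exact: conj_i.
  apply: (mulIf (two_neq0 (R := R))).
  have ii : 'i%C * 'i%C = -1 :> R[i] by exact: mul_ii.
  transitivity (2 * (x%:C * pder 1 f z - ('i%C * 'i%C) * y%:C * pder 'i%C f z)); first by field.
  by rewrite ii; ring.
have I1 : N (f (z + x%:C) - f z - x%:C * pder 1 f z) <= 2 * (`|x| * (e / 2)).
  have := @cder_mvi (fun s => f (z + (s * x)%:C * 1))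
    (fun s => x%:C * pder 1 f (z + (s * x)%:C * 1)) (x%:C * pder 1 f z) (`|x| * (e / 2)).
  rewrite mul1r mul0r mulr1 mul0r addr0; apply=> t /andP[t0 t1].
    apply: cder_pder; apply: (hf _ _).1; apply: le_lt_trans wr.
    rewrite mulr1 addrAC subrr add0r N_real Nw normrM ger0_norm //.
    by rewrite (le_trans (ler_piMl _ t1)) // lerDl.
  rewrite -mulrBr NMr ler_wpM2l //; apply/ltW/h1; apply: le_lt_trans w1.
  rewrite mulr1 addrAC subrr add0r N_real Nw normrM ger0_norm //.
  by rewrite (le_trans (ler_piMl _ t1)) // lerDl.
have I2 : N (f w - f (z + x%:C) - y%:C * pder 'i%C f z) <= 2 * (`|y| * (e / 2)).
  have nz t : 0 <= t <= 1 -> N (z + x%:C + (t * y)%:C * 'i%C - z) <= N (w - z).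
    case/andP => t0 t1.
    have -> : z + x%:C + (t * y)%:C * 'i%C - z = x%:C + (t * y)%:C * 'i%C by ring.
    rewrite Nw (le_trans (ND _ _)) // N_real NMr.
    rewrite /N /= normr0 normr1 add0r mulr1 lerD2l normrM ger0_norm //.
    by rewrite ler_piMl.
  have := @cder_mvi (fun s => f (z + x%:C + (s * y)%:C * 'i%C))
    (fun s => y%:C * pder 'i%C f (z + x%:C + (s * y)%:C * 'i%C))
    (y%:C * pder 'i%C f z) (`|y| * (e / 2)).
  rewrite mul1r mul0r mul0r addr0 -wE; apply=> t t01.
    by apply: cder_pder; apply: (hf _ _).2; apply: le_lt_trans wr; exact: nz.
  rewrite -mulrBr NMr ler_wpM2l //; apply/ltW/h2; apply: le_lt_trans w2; exact: nz.
rewrite E.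
have -> : f w - f z - (x%:C * pder 1 f z + y%:C * pder 'i%C f z) =
  (f w - f (z + x%:C) - y%:C * pder 'i%C f z) + (f (z + x%:C) - f z - x%:C * pder 1 f z) by ring.
apply: le_trans (ND _ _) _; apply: le_trans (lerD I2 I1) _.
by rewrite Nw le_eqVlt; apply/orP; left; apply/eqP; field.
Qed.
End Curves.

(** * Smooth functions on the disc through total derivatives *)

Section Smooth.
Context {R : realType}.
Implicit Types (z w : R[i]) (f g : R[i] -> R[i]).

Lemma disc_cabs z : disc z <-> cabs z < 1.
Proof. by rewrite /disc /= cabsE -(ltcR _ 1). Qed.

Lemma disc_open z : disc z -> exists2 d : R, 0 < d & forall w, N (w - z) < d -> disc w.
Proof.
move/disc_cabs => h; exists (1 - cabs z); first by rewrite subr_gt0.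
move=> w hw; apply/disc_cabs.
have := cabsD (w - z) z; rewrite subrK => H.
by have := cabs_le_N (w - z); lra.
Qed.

Lemma wd_disc f g z a b : (forall w, disc w -> f w = g w) -> disc z ->
  wd f z a b -> wd g z a b.
Proof.
move=> h /disc_open[d d0 hd]; apply: wd_local; exists d => // w /hd; exact: h.
Qed.

Lemma cont_disc f g z : (forall w, disc w -> f w = g w) -> disc z ->
  cont f z -> cont g z.
Proof.
move=> h dz' /contP hf; have [d d0 hd] := disc_open dz'.
apply/contP => e /hf[d' d'0 hd']; exists (Num.min d d'); first by rewrite lt_min d0.
by move=> w; rewrite lt_min => /andP[/hd/h <- /hd']; rewrite -(h z dz').
Qed.

(* [Ck] phrased with total derivatives, for which the chain rule is available. *)
Fixpoint Wk n f : Prop :=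
  (forall z, disc z -> cont f z) /\
  match n with
  | 0 => True
  | m.+1 => exists a b, [/\ forall z, disc z -> wd f z (a z) (b z), Wk m a & Wk m b]
  end.

Lemma Wk_cont n f z : Wk n f -> disc z -> cont f z.
Proof. by case: n => [|n] [h _]; exact: h. Qed.

Lemma Wk_eq n f g : (forall z, disc z -> f z = g z) -> Wk n f -> Wk n g.
Proof.
case: n => [|n] h [cf].
  by move=> _; split=> // z dz'; exact: cont_disc h dz' (cf z dz').
case=> a [b [hf ha hb]]; split=> [z dz'|]; first exact: cont_disc h dz' (cf z dz').
by exists a, b; split=> // z dz'; exact: wd_disc h dz' (hf z dz').
Qed.

Lemma Wk_intro n f a b : (forall z, disc z -> wd f z (a z) (b z)) ->
  Wk n a -> Wk n b -> Wk n.+1 f.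
Proof.
move=> h ha hb; split; first by move=> z /h; exact: wd_cont.
by exists a, b.
Qed.

Lemma WkS n f : Wk n.+1 f -> Wk n f.
Proof.
elim: n f => [|n IH] f [hc [a [b [h ha hb]]]]; first by split.
by apply: Wk_intro h _ _; exact: IH.
Qed.

Lemma Wk_cst n c : Wk n (fun=> c).
Proof.
elim: n c => [|n IH] c; first by split=> // z _; exact: cont_cst.
by apply: (@Wk_intro n _ (fun=> 0) (fun=> 0)) => // z _; exact: wd_cst.
Qed.
Lemma WkD n f g : Wk n f -> Wk n g -> Wk n (fun z => f z + g z).
Proof.
elim: n f g => [|n IH] f g.
  by move=> [hf _] [hg _]; split=> // z dz'; exact: contD (hf z dz') (hg z dz').
move=> [_ [a [b [hf ha hb]]]] [_ [c [d [hg hc hd]]]].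
apply: (@Wk_intro n _ (fun z => a z + c z) (fun z => b z + d z)); try exact: IH.
by move=> z dz'; exact: wdD (hf z dz') (hg z dz').
Qed.
Lemma WkM n f g : Wk n f -> Wk n g -> Wk n (fun z => f z * g z).
Proof.
elim: n f g => [|n IH] f g.
  by move=> [hf _] [hg _]; split=> // z dz'; exact: contM (hf z dz') (hg z dz').
move=> hf1 hg1; have hf0 := WkS hf1; have hg0 := WkS hg1.
case: hf1 => _ [a [b [hf ha hb]]]; case: hg1 => _ [c [d [hg hc hd]]].
apply: (@Wk_intro n _ (fun z => a z * g z + f z * c z) (fun z => b z * g z + f z * d z)).
- by move=> z dz'; exact: wdM (hf z dz') (hg z dz').
- exact: WkD (IH _ _ ha hg0) (IH _ _ hf0 hc).
- exact: WkD (IH _ _ hb hg0) (IH _ _ hf0 hd).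
Qed.
Lemma WkJ n f : Wk n f -> Wk n (fun z => (f z)^*).
Proof.
elim: n f => [|n IH] f.
  by move=> [hf _]; split=> // z dz'; exact: contJ (hf z dz').
case=> _ [a [b [hf ha hb]]].
apply: (@Wk_intro n _ (fun z => (b z)^*) (fun z => (a z)^*)); try exact: IH.
by move=> z dz'; exact: wdJ (hf z dz').
Qed.
Lemma WkV n f : (forall z, disc z -> f z != 0) -> Wk n f -> Wk n (fun z => (f z)^-1).
Proof.
move=> f0; elim: n => [|n IH].
  by move=> [hf _]; split=> // z dz'; exact: contV (f0 z dz') (hf z dz').
move=> hf1; have hf0 := IH (WkS hf1).
case: hf1 => _ [a [b [hf ha hb]]].
have h2 := WkM hf0 hf0; have hN := Wk_cst n (-1).
apply: (@Wk_intro n _ (fun z => -1 * (a z * ((f z)^-1 * (f z)^-1)))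
                      (fun z => -1 * (b z * ((f z)^-1 * (f z)^-1)))).
- move=> z dz'; apply: wd_eq (wdV (f0 z dz') (hf z dz')) _ _; field; exact: f0.
- exact: WkM hN (WkM ha h2).
- exact: WkM hN (WkM hb h2).
Qed.
Lemma Wk_comp n f g : (forall z, disc z -> disc (g z)) -> Wk n f -> Wk n g ->
  Wk n (fun z => f (g z)).
Proof.
move=> dg; elim: n f => [|n IH] f.
  by move=> [hf _] [hg _]; split=> // z dz'; exact: cont_comp (hg z dz') (hf _ (dg z dz')).
move=> hf1 hg1; have hg0 := WkS hg1.
case: hf1 => _ [a [b [hf ha hb]]]; case: hg1 => _ [c [d [hg hc hd]]].
apply: (@Wk_intro n _ (fun z => a (g z) * c z + b (g z) * (d z)^*)
   (fun z => a (g z) * d z + b (g z) * (c z)^*)).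
- by move=> z dz'; exact: wd_comp (hf _ (dg z dz')) (hg z dz').
- exact: WkD (WkM (IH _ ha hg0) hc) (WkM (IH _ hb hg0) (WkJ hd)).
- exact: WkD (WkM (IH _ ha hg0) hd) (WkM (IH _ hb hg0) (WkJ hc)).
Qed.

(** Here partial derivatives turn into total ones: continuity of the first partials gives [wd], and
    the Wirtinger derivatives, being linear combinations of the partials, inherit the remaining
    order. *)
Lemma Ck_Wk n f : Ck n f -> Wk n f.
Proof.
elim: n f => [|n IH] f.
  by case=> hc _; split=> // z /hc h; apply: Cont.
case=> hc [hp h1 h2].
have {h1}w1 := IH _ h1; have {h2}w2 := IH _ h2.
have w2i := WkM (Wk_cst n 'i%C) w2.
apply: (@Wk_intro n _ (dz f) (dzbar f)).
- move=> z dz'; have [d d0 hd] := disc_open dz'.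
  apply: (wd_of_C1 d0); first by move=> w /hd/hp.
  + exact: Wk_cont w1 dz'.
  + exact: Wk_cont w2 dz'.
- by apply: Wk_eq (WkM (WkD w1 (WkM (Wk_cst n (-1)) w2i)) (Wk_cst n 2^-1)) => z _; rewrite mulN1r.
- by apply: Wk_eq (WkM (WkD w1 w2i) (Wk_cst n 2^-1)).
Qed.

Lemma Wk_Ck n f : Wk n f -> Ck n f.
Proof.
elim: n f => [|n IH] f; first by case=> hc _; split=> // z /hc[].
case=> hc [a [b [h ha hb]]]; split; first by move=> z /hc[].
have hv v : Ck n (pder v f).
  apply: IH; apply: Wk_eq (WkD (WkM ha (Wk_cst n v)) (WkM hb (Wk_cst n v^*))).
  by move=> z /h/wd_pder ->.
split=> // z /h H; split; exact: wd_has_pder H.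
Qed.

Lemma smoothP f : smooth f <-> forall n, Wk n f.
Proof. by split=> h n; [exact: Ck_Wk|exact: Wk_Ck]. Qed.

Lemma smooth_wd f z : smooth f -> disc z -> wd f z (dz f z) (dzbar f z).
Proof.
by move/smoothP/(_ 1%N) => [_ [a [b [h _ _]]]] /h; exact: wd_dE.
Qed.

Lemma smooth_Wk n f : smooth f -> Wk n f.
Proof. by move/smoothP. Qed.

Lemma smooth_dz f : smooth f -> smooth (dz f).
Proof.
move=> hf; apply/smoothP => n; have [_ [a [b [h ha _]]]] := smooth_Wk n.+1 hf.
by apply: Wk_eq ha => z /h/wd_dz ->.
Qed.
Lemma smooth_dzbar f : smooth f -> smooth (dzbar f).
Proof.
move=> hf; apply/smoothP => n; have [_ [a [b [h _ hb]]]] := smooth_Wk n.+1 hf.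
by apply: Wk_eq hb => z /h/wd_dzbar ->.
Qed.
Lemma smooth_intro f a b : (forall z, disc z -> wd f z (a z) (b z)) ->
  smooth a -> smooth b -> smooth f.
Proof.
move=> h ha hb; apply/smoothP => n; apply/WkS/(Wk_intro h); exact: smooth_Wk.
Qed.
Lemma smooth_eq f g : (forall z, disc z -> f z = g z) -> smooth f -> smooth g.
Proof. by move=> h hf; apply/smoothP => n; apply: Wk_eq h _; exact: smooth_Wk. Qed.
Lemma smooth_cst c : smooth (fun=> c : R[i]).
Proof. by apply/smoothP => n; exact: Wk_cst. Qed.
Lemma smoothD f g : smooth f -> smooth g -> smooth (fun z => f z + g z).
Proof. by move=> hf hg; apply/smoothP => n; apply: WkD; exact: smooth_Wk. Qed.
Lemma smoothM f g : smooth f -> smooth g -> smooth (fun z => f z * g z).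
Proof. by move=> hf hg; apply/smoothP => n; apply: WkM; exact: smooth_Wk. Qed.
Lemma smoothZ k f : smooth f -> smooth (fun z => k * f z).
Proof. by move=> hf; exact: smoothM (smooth_cst k) hf. Qed.
Lemma smoothN f : smooth f -> smooth (fun z => - f z).
Proof. by move=> hf; apply: smooth_eq (smoothZ (-1) hf) => z _; rewrite mulN1r. Qed.
Lemma smoothB f g : smooth f -> smooth g -> smooth (fun z => f z - g z).
Proof. by move=> hf hg; exact: smoothD hf (smoothN hg). Qed.
Lemma smoothJ f : smooth f -> smooth (fun z => (f z)^*).
Proof. by move=> hf; apply/smoothP => n; apply: WkJ; exact: smooth_Wk. Qed.
Lemma smoothV f : (forall z, disc z -> f z != 0) -> smooth f -> smooth (fun z => (f z)^-1).
Proof. by move=> f0 hf; apply/smoothP => n; apply: WkV => //; exact: smooth_Wk. Qed.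
Lemma smooth_comp f g : (forall z, disc z -> disc (g z)) -> smooth f -> smooth g ->
  smooth (fun z => f (g z)).
Proof. by move=> dg hf hg; apply/smoothP => n; apply: Wk_comp => //; exact: smooth_Wk. Qed.
Lemma smooth_sum (I : Type) (r : seq I) (F : I -> R[i] -> R[i]) :
  (forall i, smooth (F i)) -> smooth (fun z => \sum_(i <- r) F i z).
Proof.
move=> h; elim: r => [|i r IH].
  by apply: smooth_eq (smooth_cst 0) => z _; rewrite big_nil.
by apply: smooth_eq (smoothD (h i) IH) => z _; rewrite big_cons.
Qed.
Lemma smooth_cont f z : smooth f -> disc z -> cont f z.
Proof. by move=> /(smooth_Wk 0); exact: Wk_cont. Qed.

Lemma dz_eq f g z : (forall w, disc w -> f w = g w) -> smooth f -> disc z -> dz f z = dz g z.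
Proof. by move=> h hf dz'; apply/esym/wd_dz/(wd_disc h dz')/(smooth_wd hf dz'). Qed.
Lemma dzbar_eq f g z : (forall w, disc w -> f w = g w) -> smooth f -> disc z ->
  dzbar f z = dzbar g z.
Proof. by move=> h hf dz'; apply/esym/wd_dzbar/(wd_disc h dz')/(smooth_wd hf dz'). Qed.

(** A real function equals its conjugate, and conjugation exchanges the two Wirtinger
    derivatives. *)
Lemma wd_real (u : R[i] -> R) z a b : wd (fun w => (u w)%:C) z a b -> b = a^*.
Proof.
move=> h; have := wdJ h; under eq_fun do rewrite cJR.
by case/(wd_unique h) => _ ->.
Qed.

Lemma is_derive_wd (f : R -> R) (c : R) (u : R[i] -> R) z a b :
  is_derive (u z) 1 f c -> wd (fun w => (u w)%:C) z a b ->
  wd (fun w => (f (u w))%:C) z (c%:C * a) (c%:C * b).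
Proof.
move=> df du.
have hf : cder (fun s => (f s)%:C) (u z) c%:C.
  by apply: cder_of_is_derive => /=; last exact: is_derive_cst.
have H := @wd_comp _ (fun w => (f (complex.Re w))%:C) (fun w => (u w)%:C) z _ _ _ _ hf du.
have ba := wd_real du.
by apply: wd_eq H _ _; rewrite -/(u z) ba ?cJE; field.
Qed.

(** The derivatives of [expR u] are [expR u] times those of [u], so the induction on the order needs
    no other function. *)
Lemma smooth_expR (u : R[i] -> R) : smooth (fun w => (u w)%:C) ->
  smooth (fun w => (expR (u w))%:C).
Proof.
move=> hu; apply/smoothP; elim=> [|n IH].
  split=> // z dz'; apply: wd_cont; exact: is_derive_wd (is_derive_expR _) (smooth_wd hu dz').
have a := smooth_Wk n (smooth_dz hu); have b := smooth_Wk n (smooth_dzbar hu).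
apply: Wk_intro (WkM IH a) (WkM IH b) => z dz'.
exact: is_derive_wd (is_derive_expR _) (smooth_wd hu dz').
Qed.

Lemma smooth_ln (u : R[i] -> R) : (forall z, disc z -> 0 < u z) ->
  smooth (fun w => (u w)%:C) -> smooth (fun w => (ln (u w))%:C).
Proof.
move=> u0 hu.
have hV : smooth (fun w => ((u w)%:C)^-1).
  by apply: smoothV => // z /u0 h; rewrite -(rmorph0 (real_complex R)) eq_complex /= eqxx andbT gt_eqF.
apply: smooth_intro (smoothM hV (smooth_dz hu)) (smoothM hV (smooth_dzbar hu)) => z dz'.
rewrite -fmorphV; exact: is_derive_wd (is_derive1_ln (u0 z dz')) (smooth_wd hu dz').
Qed.

(** The square root is the exponential of half the logarithm, which reduces the claim to the two
    preceding lemmas. *)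
Lemma smooth_sqrt (u : R[i] -> R) : (forall z, disc z -> 0 < u z) ->
  smooth (fun w => (u w)%:C) -> smooth (fun w => (Num.sqrt (u w))%:C).
Proof.
move=> u0 hu.
have h : smooth (fun w => (2^-1 * ln (u w))%:C).
  by apply: smooth_eq (smoothZ 2^-1 (smooth_ln u0 hu)) => z _; rewrite rmorphM fmorphV rmorph_nat.
apply: smooth_eq (smooth_expR h) => z dz'; congr (_%:C).
have e0 : 0 <= expR (2^-1 * ln (u z)) by exact: expR_ge0.
rewrite -[LHS]ger0_norm // -sqrtr_sqr expr2 -expRD -mulrDl.
by rewrite (_ : 2^-1 + 2^-1 = 1 :> R) ?mul1r ?lnK ?posrE ?u0 //; field.
Qed.
End Smooth.

(** * Estimates on closed discs *)
Section Quantitative.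
Context {R : realType}.
Implicit Types (z w v : R[i]) (f g : R[i] -> R[i]).

Lemma cdisc_sub (r : R) z : r < 1 -> cabs z <= r -> disc z.
Proof. by move=> r1 zr; apply/disc_cabs; exact: le_lt_trans r1. Qed.

(** A complex number is unfolded into a pair of reals: the closed disc becomes a closed part of the
    compact square with sides [[-1, 1]], and the extreme value theorem applies to [N (f z)]. *)
Lemma bounded_cdisc f (r : R) : (forall z, disc z -> cont f z) -> r < 1 ->
  exists2 K : R, 0 <= K & forall z, cabs z <= r -> N (f z) <= K.
Proof.
(* A disc of negative radius is empty, and the extreme value theorem needs a point. *)
move=> cf r1; have [r0|r0] := ltP r 0.
  exists 0 => // z zr; have := cabs_ge0 z.
  by rewrite leNgt (le_lt_trans zr).
pose c (p : R * R) : R[i] := p.1 +i* p.2.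
pose A := [set p : R * R | cabs (c p) <= r].
have ccont (p : R * R) (e : R) : 0 < e -> \forall q \near p, N (c q - c p) < e.
  move=> e0; apply/nbhs_ballP; exists (e / 2); first by rewrite /= divr_gt0.
  move=> q [/= h1 h2]; move: h1 h2; rewrite /ball /= => h1 h2.
  by rewrite /N /c !ReImE /= distrC [`|q.2 - _|]distrC (splitr e) ltrD.
have clA : closed A.
  apply: (preimage_closed _ (@closed_le _ r)) => p _.
  apply/cvgrPdist_lt => e /(ccont p); apply: filterS => q.
  apply: le_lt_trans; apply: le_trans (cabs_le_N _).
  rewrite ler_distl; apply/andP; split.
    by rewrite lerBlDr; apply: le_trans (cabsD _ _); rewrite addrC subrK.
  have := cabsD (c p - c q) (c q); rewrite subrK addrC => h; apply: le_trans h _.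
  by rewrite lerD2l cabsBC.
have coA : compact A.
  have sq := compact_setX (@segment_compact R (-1) 1) (@segment_compact R (-1) 1).
  apply: (subclosed_compact clA sq) => p; rewrite /A /= => h.
  have h2 : cabs (c p) <= 1 by rewrite (le_trans h) // ltW.
  move: h2; rewrite cabs_le_ReIm // expr1n /c /= => h2.
  have aux (x y : R) : x ^+ 2 + y ^+ 2 <= 1 -> -1 <= x <= 1 by move=> ?; apply/andP; split; nra.
  by rewrite !in_itv /= (aux _ _ h2) (aux p.2 p.1) // addrC.
have A0 : A !=set0.
  exists (0, 0); by rewrite /A /= (_ : c _ = 0) // cabs0.
have [|p pA hp] := @compact_EVT_max _ R (fun p => N (f (c p))) A A0 coA.
  apply: continuous_in_subspaceT => p; rewrite inE => pA.
  have /contP cfp := cf _ (cdisc_sub r1 pA).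
  apply/cvgrPdist_lt => e /cfp[d d0 hd].
  apply: filterS (ccont p d d0) => q /hd; apply: le_lt_trans.
  rewrite ler_distl; apply/andP; split.
    by rewrite lerBlDr; apply: le_trans (ND _ _); rewrite addrC subrK.
  have := ND (f (c p) - f (c q)) (f (c q)); rewrite subrK addrC => h.
  by apply: le_trans h _; rewrite lerD2l NBC.
exists (N (f (c p))) => [|z zr]; first exact: N_ge0.
have zc : z = c (complex.Re z, complex.Im z) by case: z {zr}.
by rewrite zc; apply: hp; rewrite inE /A /= -zc.
Qed.

Lemma cdisc_seg (r t : R) z w : 0 <= t <= 1 -> cabs z <= r -> cabs w <= r ->
  cabs (z + t%:C * (w - z)) <= r.
Proof.
case/andP=> t0 t1 zr wr.
have -> : z + t%:C * (w - z) = (1 - t)%:C * z + t%:C * w by rewrite rmorphB /=; ring.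
apply: le_trans (cabsD _ _) _.
rewrite !cabsM !cabsR ?subr_ge0 //; nra.
Qed.

(** The real differential of [f] at [z], applied to [v]. *)
Definition D f v z := dz f z * v + dzbar f z * v^*.

Lemma seg_cder f z v t : smooth f -> disc (z + t%:C * v) ->
  cder (fun s => f (z + s%:C * v)) t (D f v (z + t%:C * v)).
Proof.
move=> hf dz'.
exact: (@wd_cder _ f (fun s => z + s%:C * v) t _ _ _ (smooth_wd hf dz') (cder_line z v t)).
Qed.

Lemma lipschitz_cdisc f (r : R) : smooth f -> r < 1 ->
  exists2 K : R, 0 <= K & forall z w, cabs z <= r -> cabs w <= r ->
    N (f w - f z) <= K * N (w - z).
Proof.
move=> hf r1.
have [K1 K10 h1] := bounded_cdisc (fun z => smooth_cont (smooth_dz hf) (z := z)) r1.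
have [K2 K20 h2] := bounded_cdisc (fun z => smooth_cont (smooth_dzbar hf) (z := z)) r1.
exists (2 * (K1 + K2)) => [|z w zr wr]; first by rewrite mulr_ge0 ?addr_ge0.
have := @cder_mvi _ (fun s => f (z + s%:C * (w - z))) (fun s => D f (w - z) (z + s%:C * (w - z))) 0
  ((K1 + K2) * N (w - z)).
have e1 : z + (w - z) = w by ring.
rewrite mul0r addr0 mul1r e1 subr0 mulrA; apply => t t01.
  by apply: seg_cder => //; apply: (cdisc_sub r1); exact: cdisc_seg.
have hr := cdisc_seg t01 zr wr.
rewrite subr0 /D mulrDl; apply: le_trans (ND _ _) _; apply: lerD.
  by apply: le_trans (NM _ _) _; rewrite ler_wpM2r ?N_ge0 // h1.
by apply: le_trans (NM _ _) _; rewrite NJ ler_wpM2r ?N_ge0 // h2.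
Qed.

(** Since the first derivatives are Lipschitz, the velocity along a segment stays within a
    first-order error of its initial value. What matters later is that [K] depends on [f] and [r]
    but not on the centre [z]. *)
Lemma taylor_cdisc f (r : R) : smooth f -> r < 1 ->
  exists2 K : R, 0 <= K & forall z w, cabs z <= r -> cabs w <= r ->
    N (f w - f z - D f (w - z) z) <= K * N (w - z) ^+ 2.
Proof.
move=> hf r1.
have [K1 K10 h1] := lipschitz_cdisc (smooth_dz hf) r1.
have [K2 K20 h2] := lipschitz_cdisc (smooth_dzbar hf) r1.
exists (2 * (K1 + K2)) => [|z w zr wr]; first by rewrite mulr_ge0 ?addr_ge0.
have := @cder_mvi _ (fun s => f (z + s%:C * (w - z))) (fun s => D f (w - z) (z + s%:C * (w - z)))
  (D f (w - z) z) ((K1 + K2) * N (w - z) ^+ 2).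
have e1 : z + (w - z) = w by ring.
rewrite mul0r addr0 mul1r e1 mulrA; apply => t t01.
  by apply: seg_cder => //; apply: (cdisc_sub r1); exact: cdisc_seg.
have hr := cdisc_seg t01 zr wr.
have tN : N (z + t%:C * (w - z) - z) <= N (w - z).
  rewrite addrAC subrr add0r NMr; case/andP: t01 => t0 t1.
  by rewrite ger0_norm // ler_piMl ?N_ge0.
have -> : D f (w - z) (z + t%:C * (w - z)) - D f (w - z) z =
  (dz f (z + t%:C * (w - z)) - dz f z) * (w - z) +
  (dzbar f (z + t%:C * (w - z)) - dzbar f z) * (w - z)^* by rewrite /D; ring.
have -> : (K1 + K2) * N (w - z) ^+ 2 =
  K1 * N (w - z) * N (w - z) + K2 * N (w - z) * N (w - z) by ring.
apply: le_trans (ND _ _) _; apply: lerD.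
  apply: le_trans (NM _ _) _; rewrite ler_wpM2r ?N_ge0 //.
  by apply: le_trans (h1 _ _ zr hr) _; rewrite ler_wpM2l.
apply: le_trans (NM _ _) _; rewrite NJ ler_wpM2r ?N_ge0 //.
by apply: le_trans (h2 _ _ zr hr) _; rewrite ler_wpM2l.
Qed.

(** Along the radius to [z] the function has velocity 0, and the disc is star-shaped about 0. *)
Lemma cst_disc f : (forall z, disc z -> wd f z 0 0) -> forall z, disc z -> f z = f 0.
Proof.
move=> hf z dz'; apply/eqP; rewrite -subr_eq0; apply/eqP/N_eq0/le_anti.
rewrite N_ge0 andbT.
suff H : N (f (0 + 1%:C * z) - f (0 + 0%:C * z) - 0) <= 2 * 0.
  by move: H; rewrite !add0r mul1r mul0r subr0 mulr0.
apply: (@cder_mvi _ (fun s => f (0 + s%:C * z)) (fun s => 0) 0 0) => t t01; last first.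
  by rewrite subr0 N0.
have dt : disc (0 + t%:C * z).
  move/disc_cabs: dz' => h; apply: (cdisc_sub h).
  rewrite -[X in _ + _ * X]subr0; apply: cdisc_seg => //.
  by rewrite cabs0 cabs_ge0.
apply: cder_eq (@wd_cder _ f (fun s => 0 + s%:C * z) t _ _ _ (hf _ dt) (cder_line 0 z t)) _.
by rewrite !mul0r addr0.
Qed.

Lemma N_i : N ('i%C : R[i]) = 1.
Proof. by rewrite /N /= normr0 normr1 add0r. Qed.

(* The second difference of [f] over a square of side [x], divided by [x ^+ 2],
   tends to both iterated derivatives. *)
Lemma D_comm f u v z : smooth f -> disc z -> N u <= 1 -> N v <= 1 ->
  D (D f v) u z = D (D f u) v z.
Proof.
move=> hf dz' u1 v1.
have smD v' : smooth (D f v').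
  exact: smoothD (smoothM (smooth_dz hf) (smooth_cst _)) (smoothM (smooth_dzbar hf) (smooth_cst _)).
(* Halfway to the boundary: small squares at [z] stay in the closed disc of radius [r], where the
   Taylor bounds are uniform. *)
move/disc_cabs: dz' => z1; pose r := (1 + cabs z) / 2.
have r1 : r < 1 by rewrite /r; lra.
have [K1 K10 h1] := taylor_cdisc (smD v) r1.
have [K2 K20 h2] := taylor_cdisc (smD u) r1.
pose r0 := r - cabs z; have r00 : 0 < r0 by rewrite /r0 /r; lra.
have step (u' v' : R[i]) (K : R) : N u' <= 1 -> N v' <= 1 -> 0 <= K ->
    (forall z w, cabs z <= r -> cabs w <= r ->
      N (D f v' w - D f v' z - D (D f v') (w - z) z) <= K * N (w - z) ^+ 2) ->
    forall x : R, 0 < x -> 2 * x < r0 ->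
    N (f (z + x%:C * u' + x%:C * v') - f (z + x%:C * v') - (f (z + x%:C * u') - f z)
       - x%:C * (x%:C * D (D f v') u' z)) <= 10 * K * x ^+ 3.
  move=> u1' v1' K0 hK x x0 xr.
  have Nx (a : R[i]) : N a <= 1 -> N (x%:C * a) <= x.
    by move=> a1; rewrite NMr gtr0_norm // ler_piMr // ltW.
  have inr a : N (a - z) <= 2 * x -> cabs a <= r.
    move=> ha; have := cabsD (a - z) z; rewrite subrK; have := cabs_le_N (a - z).
    rewrite /r0 in xr; lra.
  have Ntx (a : R[i]) t : 0 <= t <= 1 -> N a <= 1 -> N (t%:C * (x%:C * a)) <= x.
    move=> /andP[t0 t1] a1; rewrite NMr ger0_norm //; apply: le_trans (Nx a a1).
    by rewrite ler_piMl ?N_ge0.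
  (* The second difference is the increment of [g] over [[0, 1]], and the velocity of [g] is a
     difference of two values of [D f v'], both expanded at [z]. Remainders at distances [2 x] and
     [x] give 4 + 1 = 5, and [cder_mvi] doubles this. *)
  pose g s := f (z + x%:C * u' + s%:C * (x%:C * v')) - f (z + s%:C * (x%:C * v')).
  pose g' s := x%:C * D f v' (z + x%:C * u' + s%:C * (x%:C * v'))
     - x%:C * D f v' (z + s%:C * (x%:C * v')).
  have := @cder_mvi _ g g' (x%:C * (x%:C * D (D f v') u' z)) (5 * K * x ^+ 3).
  rewrite /g !mul1r !mul0r !addr0.
  have -> : 2 * (5 * K * x ^+ 3) = 10 * K * x ^+ 3 by ring.
  have DR (y : R[i]) : D f (x%:C * v') y = x%:C * D f v' y by rewrite /D !cJE; ring.
  have bnd t : 0 <= t <= 1 -> cabs (z + x%:C * u' + t%:C * (x%:C * v')) <= r /\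
      cabs (z + t%:C * (x%:C * v')) <= r.
    move=> t01; split; apply: inr.
      have -> : z + x%:C * u' + t%:C * (x%:C * v') - z = x%:C * u' + t%:C * (x%:C * v') by ring.
      by apply: le_trans (ND _ _) _; have := Nx _ u1'; have := Ntx _ _ t01 v1'; lra.
    rewrite addrAC subrr add0r; have := Ntx _ _ t01 v1'; lra.
  apply=> t t01; have [b1 b2] := bnd t t01.
    by rewrite /g' -!DR; apply: cderB; apply: seg_cder => //; exact: cdisc_sub r1 _.
  have zr : cabs z <= r by rewrite /r0 in r00; lra.
  have := hK z _ zr b1; have := hK z _ zr b2.
  set P := z + x%:C * u' + _; set Q := z + t%:C * _.
  set E1 := D f v' Q - _ - _; set E2 := D f v' P - _ - _ => hE1 hE2.
  have -> : g' t - x%:C * (x%:C * D (D f v') u' z) = x%:C * (E2 - E1).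
    have eL : D (D f v') (P - z) z - D (D f v') (Q - z) z = x%:C * D (D f v') u' z.
      by rewrite /P /Q /D !cJE; move: (dz _ z) (dzbar _ z) => p q; ring.
    rewrite /g' /E1 /E2 -/P -/Q -eL.
    move: (D f v' P) (D f v' Q) (D f v' z) (D _ (P - z) z) (D _ (Q - z) z).
    by move=> a b c d e; ring.
  rewrite NMr gtr0_norm //.
  have nP : N (P - z) <= 2 * x.
    have -> : P - z = x%:C * u' + t%:C * (x%:C * v') by rewrite /P; ring.
    by apply: le_trans (ND _ _) _; have := Nx _ u1'; have := Ntx _ _ t01 v1'; lra.
  have nQ : N (Q - z) <= x by rewrite /Q addrAC subrr add0r Ntx.
  have sP : N (P - z) ^+ 2 <= 4 * x ^+ 2.
    rewrite (_ : 4 * x ^+ 2 = (2 * x) ^+ 2); last by ring.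
    by rewrite ler_pXn2r ?nnegrE ?N_ge0 // mulr_ge0 // ltW.
  have sQ : N (Q - z) ^+ 2 <= x ^+ 2 by rewrite ler_pXn2r ?nnegrE ?N_ge0 // ltW.
  have -> : 5 * K * x ^+ 3 = x * (K * (4 * x ^+ 2) + K * x ^+ 2) by ring.
  rewrite ler_pM2l //; apply: le_trans (NB _ _) _; apply: lerD.
    by apply: le_trans hE2 _; rewrite ler_wpM2l.
  by apply: le_trans hE1 _; rewrite ler_wpM2l.
apply/eqP; rewrite -subr_eq0; apply/eqP/N_eq0/le_anti; rewrite N_ge0 andbT.
apply/ler_addgt0Pr => e e0; rewrite add0r.
pose L := 10 * (K1 + K2) + 1; have L0 : 0 < L by rewrite /L; lra.
pose x := Num.min (e / L) (r0 / 4).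
have x0 : 0 < x by rewrite lt_min !divr_gt0.
have xr : 2 * x < r0.
  by have : x <= r0 / 4 by [rewrite ge_min lexx orbT]; lra.
have H1 := step u v K1 u1 v1 K10 h1 x x0 xr.
have H2 := step v u K2 v1 u1 K20 h2 x x0 xr.
have x2 : 0 < x ^+ 2 by rewrite exprn_gt0.
have H3 : x ^+ 2 * N (D (D f v) u z - D (D f u) v z) <= x ^+ 2 * (L * x).
  rewrite -[X in X * N _ <= _]gtr0_norm // -NMr.
  (* The second difference is symmetric in [u] and [v], so it drops out of [A2 - A1]. *)
  set A1 := (X in N X) in H1; set A2 := (X in N X) in H2.
  have -> : (x ^+ 2)%:C * (D (D f v) u z - D (D f u) v z) = A2 - A1.
    rewrite /A1 /A2 rmorphXn (addrAC z (x%:C * v)); ring.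
  apply: le_trans (NB _ _) _; apply: le_trans (lerD H2 H1) _.
  have -> : 10 * K2 * x ^+ 3 + 10 * K1 * x ^+ 3 = x ^+ 2 * ((10 * (K1 + K2)) * x) by ring.
  by rewrite ler_pM2l // ler_wpM2r ?ltW // /L ltrDl.
move: H3; rewrite ler_pM2l // => /le_trans; apply.
by rewrite mulrC -ler_pdivlMr // ge_min lexx.
Qed.

Lemma dz_dzbar f z : smooth f -> disc z -> dz (dzbar f) z = dzbar (dz f) z.
Proof.
move=> hf dz'.
have hD v w : D (D f v) w z = dz (dz f) z * v * w + dz (dzbar f) z * v^* * w
   + (dzbar (dz f) z * v * w^* + dzbar (dzbar f) z * v^* * w^*).
  have h1 := smooth_wd (smooth_dz hf) dz'; have h2 := smooth_wd (smooth_dzbar hf) dz'.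
  have H := wdD (wdM h1 (wd_cst v z)) (wdM h2 (wd_cst v^* z)).
  rewrite {1}/D (wd_dz H) (wd_dzbar H).
  by move: (dz _ z) (dz _ z) (dzbar _ z) (dzbar _ z) (dz f z) (dzbar f z) => *; ring.
have := D_comm (u := 1) (v := 'i%C) hf dz'; rewrite N1 N_i => /(_ (lexx _) (lexx _)).
rewrite !hD !cJE (_ : ('i%C : R[i])^* = - 'i%C); last exact: conj_i.
set i := 'i%C; set A := dz (dz f) z; set B := dz _ z; set C := dzbar (dz f) z; set E := dzbar _ z.
(* For the directions 1 and ['i] the pure second derivatives cancel, and only the difference of the
   mixed ones survives. *)
move=> H; have : 2 * i * (B - C) = 0.
  by move/eqP: H; rewrite -subr_eq0 => /eqP H; rewrite -[RHS](mulr0 (-1)) -H; ring.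
move/eqP; rewrite !mulf_eq0 (negbTE (two_neq0 (R := R))) /= subr_eq0.
have /negbTE -> : i != 0 by rewrite eq_complex /= eqxx oner_eq0.
by move/eqP.
Qed.

End Quantitative.

(** * Linear differential equations *)
Section MatrixCurves.
Context {R : realType}.

Definition NMx {m n} (M : 'M[R[i]]_(m, n)) : R := \sum_i \sum_j N (M i j).

Lemma mxBE m n (A B : 'M[R[i]]_(m, n)) i j : (A - B) i j = A i j - B i j.
Proof. by rewrite !mxE. Qed.

Definition mcder {m n} (Y : R -> 'M[R[i]]_(m, n)) (t : R) (C : 'M[R[i]]_(m, n)) :=
  forall i j, cder (fun s => Y s i j) t (C i j).

Lemma NMx_ge0 m n (M : 'M[R[i]]_(m, n)) : 0 <= NMx M.
Proof. by apply: sumr_ge0 => i _; apply: sumr_ge0 => j _; exact: N_ge0. Qed.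
Lemma N_le_NMx m n (M : 'M[R[i]]_(m, n)) i j : N (M i j) <= NMx M.
Proof.
rewrite /NMx (bigD1 i) //= (bigD1 j) //= -addrA lerDl.
by apply: addr_ge0; apply: sumr_ge0 => *; [exact: N_ge0|apply: sumr_ge0 => *; exact: N_ge0].
Qed.
Lemma NMxD m n (A B : 'M[R[i]]_(m, n)) : NMx (A + B) <= NMx A + NMx B.
Proof.
rewrite /NMx -big_split /=; apply: ler_sum => i _.
by rewrite -big_split /=; apply: ler_sum => j _; rewrite mxE ND.
Qed.
Lemma NMx_le m n (M : 'M[R[i]]_(m, n)) (c : R) :
  (forall i j, N (M i j) <= c) -> NMx M <= (m * n)%:R * c.
Proof.
move=> h; apply: (@le_trans _ _ (\sum_(i < m) \sum_(j < n) c)).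
  by apply: ler_sum => i _; apply: ler_sum => j _.
by rewrite sumr_const card_ord sumr_const card_ord -mulrnA mulnC mulr_natl.
Qed.
Lemma NMxM m n p (A : 'M[R[i]]_(m, n)) (B : 'M[R[i]]_(n, p)) :
  NMx (A *m B) <= NMx A * NMx B.
Proof.
rewrite {1 2}/NMx mulr_suml; apply: ler_sum => i _.
apply: (@le_trans _ _ (\sum_k \sum_j N (A i j) * N (B j k))).
  apply: ler_sum => k _; rewrite mxE; apply: le_trans (NsumM _ _ _) _.
  by apply: ler_sum => j _; exact: NM.
rewrite exchange_big /= mulr_suml; apply: ler_sum => j _.
rewrite -mulr_sumr ler_wpM2l ?N_ge0 // /NMx [leRHS](bigD1 j) //= lerDl.
by apply: sumr_ge0 => *; apply: sumr_ge0 => *; exact: N_ge0.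
Qed.

Lemma mcder_eq m n (Y : R -> 'M[R[i]]_(m, n)) t C C' :
  mcder Y t C -> C = C' -> mcder Y t C'.
Proof. by move=> h <-. Qed.
Lemma mcder_cst m n (C : 'M[R[i]]_(m, n)) t : mcder (fun=> C) t 0.
Proof. by move=> i j; rewrite mxE; exact: cder_cst. Qed.
Lemma mcderD m n (Y Z : R -> 'M[R[i]]_(m, n)) t C E :
  mcder Y t C -> mcder Z t E -> mcder (fun s => Y s + Z s) t (C + E).
Proof.
move=> h h' i j; rewrite mxE.
by apply: cder_ext (cderD (h i j) (h' i j)) => s; rewrite mxE.
Qed.
Lemma mcderB m n (Y Z : R -> 'M[R[i]]_(m, n)) t C E :
  mcder Y t C -> mcder Z t E -> mcder (fun s => Y s - Z s) t (C - E).
Proof.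
move=> h h' i j; rewrite !mxE.
by apply: cder_ext (cderB (h i j) (h' i j)) => s; rewrite !mxE.
Qed.
Lemma mcderM m n p (Y : R -> 'M[R[i]]_(m, n)) (Z : R -> 'M[R[i]]_(n, p)) t C E :
  mcder Y t C -> mcder Z t E -> mcder (fun s => Y s *m Z s) t (C *m Z t + Y t *m E).
Proof.
move=> h h' i j; rewrite !mxE -big_split /=.
apply: cder_ext (cder_sum _ (fun k => cderM (h i k) (h' k j))) => s.
by rewrite mxE.
Qed.
Lemma mcderZ m n (g : R -> R[i]) (Z : R -> 'M[R[i]]_(m, n)) t c E :
  cder g t c -> mcder Z t E -> mcder (fun s => g s *: Z s) t (c *: Z t + g t *: E).
Proof.
move=> h h' i j; rewrite !mxE.
by apply: cder_ext (cderM h (h' i j)) => s; rewrite mxE.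
Qed.

Lemma mcder_bound m n (X X' : R -> 'M[R[i]]_(m, n)) (h h' : R -> R) :
  (forall t : R, 0 <= t <= 1 -> mcder X t (X' t)) ->
  (forall t : R, 0 <= t <= 1 -> is_derive t 1 h (h' t)) ->
  (forall t : R, 0 <= t <= 1 -> NMx (X' t) <= h' t) -> NMx (X 0) <= h 0 ->
  forall t : R, 0 <= t <= 1 -> NMx (X t) <= (m * n)%:R * (2 * h t).
Proof.
move=> dX dh hX h0 t t01; apply: NMx_le => i j.
apply: (cder_mean_value_bound (fun s hs => dX s hs i j) dh _ _ t01) => [s hs|].
  exact: le_trans (N_le_NMx _ _ _) (hX s hs).
exact: le_trans (N_le_NMx _ _ _) h0.
Qed.

(** The retraction of the line onto [[0, 1]]. Coefficients controlled only on [[0, 1]] become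
    continuous on the whole line after composition with it, as the fundamental theorem of calculus
    asks. *)
Definition clamp (t : R) : R := Num.max 0 (Num.min t 1).

Lemma clamp01 t : 0 <= clamp t <= 1.
Proof. by rewrite /clamp le_max lexx /= ge_max ler01 ge_min lexx orbT. Qed.
Lemma clamp_id t : 0 <= t <= 1 -> clamp t = t.
Proof. by case/andP => t0 t1; rewrite /clamp (min_idPl t1) (max_idPr t0). Qed.
Lemma clamp_lip s t : `|clamp s - clamp t| <= `|s - t|.
Proof.
rewrite /clamp ler_norml.
have h1 := ler_norm (s - t); have h2 := ler_norm (t - s); rewrite distrC in h2.
by case: (leP s 1) => ?; case: (leP t 1) => ?; rewrite ?(max_idPr (@ler01 R));
  case: (leP 0 s) => ?; case: (leP 0 t) => ?; apply/andP; split; lra.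
Qed.
Lemma rcont_clamp (g : R -> R[i]) t : rcont g (clamp t) -> rcont (fun s => g (clamp s)) t.
Proof.
move/rcontP => h; apply/rcontP => e /h[d d0 hd]; exists d => // s st.
by apply: hd; apply: le_lt_trans (clamp_lip _ _) st.
Qed.

(** Integration starts at -1 so that 0 is an interior point, where a two-sided derivative exists;
    the second integral normalises the primitive to vanish at 0. *)
Definition rprim (f : R -> R) (x : R) : R :=
  (\int[lebesgue_measure]_(t in [set` `[(-1)%R, x]]) f t)%R -
  (\int[lebesgue_measure]_(t in [set` `[(-1)%R, 0%R]]) f t)%R.

Lemma is_derive_rprim (f : R -> R) (t : R) : continuous f -> -1 < t ->
  is_derive t 1 (rprim f) (f t).
Proof.
move=> cf t1.
have [] := @continuous_FTC1_closed R f (-1) t (t + 1) _ _ t1 (cf t).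
- by rewrite ltrDl.
- apply: continuous_compact_integrable; first exact: segment_compact.
  exact: continuous_subspaceT.
move=> d e; have h : is_derive t 1 (fun x : R =>
    (\int[lebesgue_measure]_(t in [set` `[(-1)%R, x]]) f t)%R) (f t).
  split; [exact: d|by rewrite -derive1E; exact: e].
rewrite -[f t]subr0; exact: is_deriveB.
Qed.

Definition cprim (g : R -> R[i]) (x : R) : R[i] :=
  rprim (fun s => complex.Re (g s)) x +i* rprim (fun s => complex.Im (g s)) x.

Lemma cprim0 g : cprim g 0 = 0.
Proof. by rewrite /cprim /rprim !subrr. Qed.

Lemma cder_cprim g t : (forall s, rcont g s) -> -1 < t -> cder (cprim g) t (g t).
Proof.
move=> cg t1; apply: cder_of_is_derive => /=.
  by apply: is_derive_rprim => // s; exact: rcont_Re.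
by apply: is_derive_rprim => // s; exact: rcont_Im.
Qed.

Lemma geometric_le0 (x C : R) : 0 <= C -> (forall k, x <= C / 2 ^+ k) -> x <= 0.
Proof.
move=> C0 h; rewrite leNgt; apply/negP => x0.
have [k hk] : exists k : nat, C / x < k%:R.
  exists (Num.bound (C / x)); apply: archi_boundP; exact: divr_ge0 C0 (ltW x0).
have k2 : (k%:R : R) <= 2 ^+ k by rewrite -natrX ler_nat ltnW // ltn_expl.
have := h k; rewrite ler_pdivlMr ?exprn_gt0 // leNgt => /negP; apply.
rewrite ltr_pdivrMr // in hk; apply: lt_le_trans hk _.
by rewrite mulrC ler_pM2l.
Qed.

(** The limit of a sequence whose increments are bounded by [B / 2 ^+ k.+1]. The lower bounds
    [u k - B / 2 ^+ k] increase and the upper bounds [u k + B / 2 ^+ k] decrease, so the supremum of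
    the former lies between all of them. *)
Definition glim (u : nat -> R) (B : R) : R := sup [set u k - B / 2 ^+ k | k in [set: nat]].

Lemma glim_dist u B : 0 <= B -> (forall k, `|u k.+1 - u k| <= B / 2 ^+ k.+1) ->
  forall k, `|u k - glim u B| <= B / 2 ^+ k.
Proof.
move=> B0 h.
have half k : B / 2 ^+ k = B / 2 ^+ k.+1 + B / 2 ^+ k.+1.
  by rewrite exprS; field; rewrite expf_neq0.
have mono k l : u k - B / 2 ^+ k <= u (k + l)%N - B / 2 ^+ (k + l).
  elim: l => [|l IH]; first by rewrite addn0.
  apply: le_trans IH _; rewrite addnS.
  have := h (k + l)%N; rewrite ler_norml => /andP[H _]; have := half (k + l)%N; lra.
have anti k l : u (k + l)%N + B / 2 ^+ (k + l) <= u k + B / 2 ^+ k.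
  elim: l => [|l IH]; first by rewrite addn0.
  apply: le_trans _ IH; rewrite addnS.
  have := h (k + l)%N; rewrite ler_norml => /andP[_ H]; have := half (k + l)%N; lra.
have pos k : 0 <= B / 2 ^+ k by rewrite divr_ge0 // exprn_ge0.
have cross k l : u k - B / 2 ^+ k <= u l + B / 2 ^+ l.
  have := mono k l; have := anti l k; rewrite addnC; have := pos (k + l)%N; lra.
move=> k; rewrite distrC ler_distl; apply/andP; split.
- apply: ub_le_sup; last by exists k.
  by exists (u 0%N + B / 2 ^+ 0) => _ [l _ <-]; exact: cross.
- apply: ge_sup; first by exists (u 0%N - B / 2 ^+ 0); exists 0%N.
  by move=> _ [l _ <-]; exact: cross.
Qed.

Lemma is_derive_expM (L c t : R) :
  is_derive t 1 (fun s : R => c * expR (L * s)) (c * (L * expR (L * t))).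
Proof.
have h1 := is_derive_linear L t.
have h2 := @is_derive1_comp R expR (fun s => L * s) t _ _ (is_derive_expR _) h1.
by apply: is_derive_eq (is_deriveZ c h2) _; rewrite /GRing.scale /=; ring.
Qed.

Lemma one_le_expR (x : R) : 0 <= x -> 1 <= expR x.
Proof. by move=> x0; apply: le_trans (expR_ge1Dx x); rewrite lerDl. Qed.

Section LinearODE.
Variables (n : nat) (M : R -> 'M[R[i]]_n) (m : R).
Hypothesis M_cont : forall t : R, 0 <= t <= 1 -> forall i j, rcont (fun s => M s i j) t.
Hypothesis M_bound : forall t : R, 0 <= t <= 1 -> NMx (M t) <= m.

(** [c] is the factor lost in [mcder_bound] by working entry by entry and on real and imaginary
    parts. The rate [L] of the exponential weight is chosen so that [c m / L] is at most 1/2, which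
    makes integration against [M] a contraction by 1/2; the summand 1 keeps [L] positive when
    [m = 0]. *)
Let c : R := (n * n)%:R * 2.
Let L : R := 2 * (c * m) + 1.

Lemma ode_m_ge0 : 0 <= m.
Proof. by apply: le_trans (NMx_ge0 (M 0)) (M_bound _); rewrite lexx ler01. Qed.
Lemma ode_c_ge0 : 0 <= c. Proof. by rewrite mulr_ge0. Qed.
Lemma ode_L_gt0 : 0 < L.
Proof. by rewrite ltr_pwDr // !mulr_ge0 // ?ode_c_ge0 ?ode_m_ge0. Qed.
Lemma ode_half : c * m / L <= 1 / 2.
Proof.
rewrite ler_pdivrMr ?ode_L_gt0 // /L; have := mulr_ge0 ode_c_ge0 ode_m_ge0; lra.
Qed.

(** The bound on [X'] is dominated by the derivative of a multiple of [expR (L * t)]. Taking [r = 0]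
    gives geometric decay of the Picard terms, taking [K = 0] identifies the limit, and iterating
    with both gives the Gronwall estimate [ode_bound]. *)
Lemma mcder_exp_bound (X X' : R -> 'M[R[i]]_n) (K r : R) : 0 <= K -> 0 <= r ->
  (forall t : R, 0 <= t <= 1 -> mcder X t (X' t)) ->
  (forall t : R, 0 <= t <= 1 -> NMx (X' t) <= m * (K * expR (L * t)) + r) -> X 0 = 0 ->
  forall t : R, 0 <= t <= 1 -> NMx (X t) <= (K / 2 + c * r) * expR (L * t).
Proof.
move=> K0 r0 dX bX X0 t t01.
have L0 := ode_L_gt0; have m0 := ode_m_ge0; have c0 := ode_c_ge0.
have b s : 0 <= s <= 1 -> NMx (X' s) <= (m * K + r) / L * (L * expR (L * s)).
  move=> s01; apply: le_trans (bX s s01) _.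
  have -> : (m * K + r) / L * (L * expR (L * s)) =
    m * (K * expR (L * s)) + r * expR (L * s) by field; rewrite gt_eqF.
  rewrite lerD2l ler_peMr //.
  by rewrite one_le_expR // mulr_ge0 ?(ltW L0) //; case/andP: s01.
have h0 : NMx (X 0) <= (m * K + r) / L * expR (L * 0).
  rewrite X0 mulr0 expR0 mulr1 (_ : NMx 0 = 0).
    by rewrite divr_ge0 ?(ltW L0) // addr_ge0 ?mulr_ge0.
  by rewrite /NMx big1 // => i _; rewrite big1 // => j _; rewrite mxE N0.
have := mcder_bound dX (fun s _ => is_derive_expM L ((m * K + r) / L) s) b h0 t01.
rewrite mulrA -/c mulrA => /le_trans; apply.
rewrite ler_wpM2r ?expR_ge0 //.
have -> : c * ((m * K + r) / L) = K * (c * m / L) + c * r * L^-1 by ring.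
apply: lerD; first by rewrite ler_wpM2l //; have := ode_half; rewrite mul1r.
rewrite ler_piMr ?mulr_ge0 // invf_le1 // /L lerDr !mulr_ge0 //.
Qed.

Definition mprim (Y : R -> 'M[R[i]]_n) (x : R) : 'M[R[i]]_n :=
  \matrix_(i, j) cprim (fun s => (Y (clamp s) *m M (clamp s)) i j) x.

Definition mrcont (Y : R -> 'M[R[i]]_n) :=
  forall t : R, 0 <= t <= 1 -> forall i j, rcont (fun s => Y (clamp s) i j) t.

Lemma clamp_idem t : clamp (clamp t) = clamp t.
Proof. exact/clamp_id/clamp01. Qed.

Lemma mprim0 Y : mprim Y 0 = 0.
Proof. by apply/matrixP => i j; rewrite !mxE cprim0. Qed.

Lemma mcder_mprim Y t : mrcont Y -> 0 <= t <= 1 -> mcder (mprim Y) t (Y t *m M t).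
Proof.
move=> cY t01 i j.
apply: (cder_ext (g := cprim (fun s => (Y (clamp s) *m M (clamp s)) i j))).
  by move=> s; rewrite mxE.
have := @cder_cprim (fun s => (Y (clamp s) *m M (clamp s)) i j) t.
rewrite (clamp_id t01); apply; last first.
  by case/andP: t01 => t0 _; rewrite (lt_le_trans _ t0) // ltrN10.
move=> s; have -> : (fun s => (Y (clamp s) *m M (clamp s)) i j) =
    fun s => \sum_k Y (clamp s) i k * M (clamp s) k j.
  by apply/funext => s'; rewrite mxE.
have h1 k : rcont (fun s => Y (clamp s) i k) s.
  have := @rcont_clamp (fun s => Y (clamp s) i k) s (cY _ (clamp01 s) i k).
  by congr (rcont _ _); apply/funext => s' /=; rewrite clamp_idem.
have h2 k : rcont (fun s => M (clamp s) k j) s.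
  exact: (@rcont_clamp (fun s => M s k j) s (M_cont (clamp01 s) k j)).
apply: cont_sum => k; exact: contM (h1 k) (h2 k).
Qed.

Lemma mcder_mrcont (Y C : R -> 'M[R[i]]_n) :
  (forall t : R, 0 <= t <= 1 -> mcder Y t (C t)) -> mrcont Y.
Proof.
move=> dY t t01 i j; apply: (@rcont_clamp (fun s => Y s i j)).
by apply: cder_rcont (dY _ _ i j); exact: clamp01.
Qed.

(** The terms of the Peano-Baker series; the partial sums [psum] are the Picard iterates. *)
Fixpoint picard k : R -> 'M[R[i]]_n :=
  if k is k'.+1 then mprim (picard k') else fun=> 1%:M.

Fixpoint psum k : R -> 'M[R[i]]_n :=
  if k is k'.+1 then fun t => psum k' t + picard k t else fun=> 1%:M.

Lemma picard_mrcont k : mrcont (picard k).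
Proof.
elim: k => [|k IH]; first by move=> t t01 i j; exact: cont_cst.
apply: (@mcder_mrcont _ (fun t => picard k t *m M t)) => t; exact: mcder_mprim.
Qed.

Lemma picard_mcder k t : 0 <= t <= 1 -> mcder (picard k.+1) t (picard k t *m M t).
Proof. by move=> t01; apply: mcder_mprim => //; exact: picard_mrcont. Qed.

Lemma psum_mcder k t : 0 <= t <= 1 -> mcder (psum k.+1) t (psum k t *m M t).
Proof.
move=> t01; elim: k => [|k IH].
  apply: mcder_eq (mcderD (mcder_cst _ t) (picard_mcder 0 t01)) _.
  by rewrite add0r.
apply: mcder_eq (mcderD IH (picard_mcder k.+1 t01)) _.
by rewrite [psum k.+1]/= mulmxDl.
Qed.

Lemma picard_bound k t : 0 <= t <= 1 ->
  NMx (picard k t) <= NMx (1%:M : 'M[R[i]]_n) / 2 ^+ k * expR (L * t).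
Proof.
elim: k t => [|k IH] t t01.
  rewrite expr0 divr1 /= ler_peMr ?NMx_ge0 // one_le_expR // mulr_ge0 ?(ltW ode_L_gt0) //.
  by case/andP: t01.
have K0 : 0 <= NMx (1%:M : 'M[R[i]]_n) / 2 ^+ k by rewrite divr_ge0 ?NMx_ge0 ?exprn_ge0.
have := mcder_exp_bound K0 (lexx 0) (fun s hs => picard_mcder k hs) _ (mprim0 _) t01.
rewrite mulr0 addr0 exprSr invfM mulrA; apply=> s s01; rewrite addr0.
apply: le_trans (NMxM _ _) _; rewrite mulrC.
by apply: ler_pM => //; rewrite ?NMx_ge0 ?M_bound ?IH.
Qed.

Let B : R := 2 * (NMx (1%:M : 'M[R[i]]_n) * expR L).

Lemma picard_bound' k t : 0 <= t <= 1 -> NMx (picard k.+1 t) <= B / 2 ^+ k.+1.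
Proof.
move=> t01; apply: le_trans (picard_bound _ t01) _.
have k0 : 0 <= (2 ^+ k.+1)^-1 :> R by rewrite invr_ge0 exprn_ge0.
rewrite /B -mulrA [_^-1 * _]mulrC !mulrA ler_wpM2r //.
have h1 : expR (L * t) <= expR L.
  by rewrite ler_expR ler_piMr ?(ltW ode_L_gt0) //; case/andP: t01.
have h2 := ler_wpM2l (NMx_ge0 (1%:M : 'M[R[i]]_n)) h1.
apply: le_trans h2 _; rewrite -[leRHS]mulrA ler_peMl ?ler1n //.
by rewrite mulr_ge0 ?NMx_ge0 ?expR_ge0.
Qed.

Definition plim (t : R) : 'M[R[i]]_n := \matrix_(i, j)
  (glim (fun k => complex.Re (psum k t i j)) B +i* glim (fun k => complex.Im (psum k t i j)) B).

Lemma ode_B_ge0 : 0 <= B. Proof. by rewrite !mulr_ge0 ?NMx_ge0 ?expR_ge0. Qed.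

Lemma plim_dist k t i j : 0 <= t <= 1 -> N ((psum k t - plim t) i j) <= 2 * B / 2 ^+ k.
Proof.
move=> t01.
have inc l : N (psum l.+1 t i j - psum l t i j) <= B / 2 ^+ l.+1.
  rewrite /= mxE addrAC subrr add0r; exact: le_trans (N_le_NMx _ _ _) (picard_bound' l t01).
have h1 := @glim_dist (fun k => complex.Re (psum k t i j)) B ode_B_ge0.
have h2 := @glim_dist (fun k => complex.Im (psum k t i j)) B ode_B_ge0.
rewrite !mxE /N !ReImE /= mulr2n !mulrDl !mul1r; apply: lerD.
  apply: h1 => l; apply: le_trans (inc l); apply: le_trans (N_le_Re _).
  by rewrite !ReImE.
apply: h2 => l; apply: le_trans (inc l); apply: le_trans (N_le_Im _).
by rewrite !ReImE.
Qed.

Lemma plim_mrcont : mrcont plim.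
Proof.
move=> t t01 i j; apply/rcontP => e e0.
have [k hk] : exists k, 2 * B / 2 ^+ k < e / 4.
  apply: contrapT => h; have : e / 4 <= 0; last by rewrite leNgt divr_gt0.
  apply: (@geometric_le0 _ (2 * B)) => [|k]; first by rewrite mulr_ge0 ?ode_B_ge0.
  by rewrite leNgt; apply/negP => hk; apply: h; exists k.
have ck : mrcont (psum k).
  case: k {hk} => [|k]; first by move=> s s01 *; exact: cont_cst.
  by apply: (@mcder_mrcont _ (fun t => psum k t *m M t)) => s; exact: psum_mcder.
have /rcontP/(_ (e / 4))[|d d0 hd] := ck t t01 i j; first by rewrite divr_gt0.
exists d => // s /hd H.
have := plim_dist k i j (clamp01 s); have := plim_dist k i j (clamp01 t).
rewrite !mxBE => h1 h2.
have -> : plim (clamp s) i j - plim (clamp t) i j =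
  (psum k (clamp t) i j - plim (clamp t) i j) - (psum k (clamp s) i j - plim (clamp s) i j)
   + (psum k (clamp s) i j - psum k (clamp t) i j) by ring.
apply: le_lt_trans (ND _ _) _; have := NB (psum k (clamp t) i j - plim (clamp t) i j)
  (psum k (clamp s) i j - plim (clamp s) i j); lra.
Qed.

(** The limit [plim] is known only to be continuous, so the solution is sought as the integral [Z]
    built from it, which is differentiable by construction. Comparing [psum k.+1] with [Z] then
    shows that [plim] and [Z] agree on [[0, 1]]. *)
Lemma linear_ode : exists2 Y : R -> 'M[R[i]]_n, Y 0 = 1%:M &
  forall t : R, 0 <= t <= 1 -> mcder Y t (Y t *m M t).
Proof.
pose Z t := 1%:M + mprim plim t.
have Z0 : Z 0 = 1%:M by rewrite /Z mprim0 addr0.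
have dZ t : 0 <= t <= 1 -> mcder Z t (plim t *m M t).
  move=> t01; apply: mcder_eq (mcderD (mcder_cst _ t) (mcder_mprim plim_mrcont t01)) _.
  by rewrite add0r.
have psum0 k : psum k 0 = 1%:M.
  elim: k => [|k IH]; first exact: erefl.
  have -> : psum k.+1 0 = psum k 0 + mprim (picard k) 0 by exact: erefl.
  by rewrite IH mprim0 addr0.
have m0 := ode_m_ge0; have B0 := ode_B_ge0.
pose C := (n * n)%:R * (2 * B) * m.
have C0 : 0 <= C by do 3?apply: mulr_ge0.
have L0 := ode_L_gt0; have c0 := ode_c_ge0.
have bZ k t : 0 <= t <= 1 -> NMx (psum k.+1 t - Z t) <= c * (C / 2 ^+ k) * expR (L * t).
  move=> t01.
  have r0 : 0 <= C / 2 ^+ k by rewrite divr_ge0 ?exprn_ge0.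
  have := @mcder_exp_bound (fun t => psum k.+1 t - Z t)
    (fun t => (psum k t - plim t) *m M t) 0 _ (lexx 0) r0 _ _ _ t t01.
  rewrite mul0r add0r; apply=> [s s01|s s01|].
  - apply: mcder_eq (mcderB (psum_mcder k s01) (dZ s s01)) _.
    by rewrite mulmxBl.
  - rewrite mul0r mulr0 add0r; apply: le_trans (NMxM _ _) _.
    rewrite /C mulrAC; apply: ler_pM; rewrite ?NMx_ge0 ?M_bound //.
    rewrite -mulrA; apply: NMx_le => i j; exact: plim_dist.
  - by rewrite psum0 Z0 subrr.
have ZE t : 0 <= t <= 1 -> plim t = Z t.
  move=> t01; apply/matrixP => i j; apply/eqP; rewrite -subr_eq0; apply/eqP/N_eq0/le_anti.
  rewrite N_ge0 andbT.
  pose C' := 2 * B + c * C * expR (L * t).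
  have BB : 0 <= 2 * B by apply: mulr_ge0.
  have C'0 : 0 <= C'.
    by apply: addr_ge0 => //; apply: mulr_ge0; [exact: mulr_ge0|exact: expR_ge0].
  apply: (geometric_le0 C'0) => k.
  have h1 := plim_dist k.+1 i j t01; have h2 := le_trans (N_le_NMx _ i j) (bZ k t t01).
  have h3 : 2 * B / 2 ^+ k.+1 <= 2 * B / 2 ^+ k.
    rewrite ler_wpM2l // lef_pV2 ?posrE ?exprn_gt0 //.
    by rewrite exprS ler_peMl ?exprn_ge0 // ler1n.
  have -> : C' / 2 ^+ k = 2 * B / 2 ^+ k + c * (C / 2 ^+ k) * expR (L * t).
    by rewrite /C'; ring.
  have -> : plim t i j - Z t i j = (psum k.+1 t - Z t) i j - (psum k.+1 t - plim t) i j.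
    by move: (psum k.+1 t) (plim t) (Z t) => P1 P2 P3; rewrite !mxBE; ring.
  apply: le_trans (NB _ _) _; rewrite addrC; apply: lerD => //.
  exact: le_trans h1 h3.
by exists Z => // t t01; rewrite -(ZE t t01); exact: dZ.
Qed.

Lemma rcont_bounded (g : R -> R[i]) : (forall t : R, 0 <= t <= 1 -> rcont g t) ->
  exists K : R, forall t, 0 <= t <= 1 -> N (g t) <= K.
Proof.
move=> cg; have [||x x01 hx] := @EVT_max R (fun t => N (g t)) 0 1; first exact: ler01.
  apply: continuous_in_subspaceT => t; rewrite inE /= in_itv /= => t01.
  apply/cvgrPdist_lt => e e0; have /rcontP/(_ e e0)[d d0 hd] := cg t t01.
  apply/nbhs_ballP; exists d => // s; rewrite /ball /= distrC => /hd; apply: le_lt_trans.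
  rewrite distrC ler_distl; apply/andP; split.
    by rewrite lerBlDr NBC; apply: le_trans (ND _ _); rewrite addrC subrK.
  by have := ND (g s - g t) (g t); rewrite subrK addrC.
by exists (N (g x)) => t t01; apply: hx; rewrite in_itv.
Qed.

(** A Gronwall inequality by bootstrapping: some bound [K0] exists by compactness, and each use of
    [mcder_exp_bound] halves it while adding [c r]. The fixed point of this recursion is [2 c r]. *)
Lemma ode_bound (E S : R -> 'M[R[i]]_n) (r : R) : 0 <= r -> E 0 = 0 ->
  (forall t : R, 0 <= t <= 1 -> mcder E t (E t *m M t + S t)) ->
  (forall t : R, 0 <= t <= 1 -> NMx (S t) <= r) ->
  NMx (E 1) <= 2 * c * r * expR L.
Proof.
move=> r0 E0 dE bS; have L0 := ode_L_gt0; have c0 := ode_c_ge0; have m0 := ode_m_ge0.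
have [K0 K00 hK0] : exists2 K : R, 0 <= K & forall t, 0 <= t <= 1 -> NMx (E t) <= K.
  have /choice[K hK] : forall ij : 'I_n * 'I_n, exists K : R,
      forall t, 0 <= t <= 1 -> N (E t ij.1 ij.2) <= K.
    by move=> [i j]; apply: rcont_bounded => t t01; exact: cder_rcont (dE t t01 i j).
  exists (\sum_i \sum_j K (i, j)).
    apply: sumr_ge0 => i _; apply: sumr_ge0 => j _.
    by apply: le_trans (N_ge0 (E 0 i j)) (hK (i, j) 0 _); rewrite lexx ler01.
  move=> t t01; apply: ler_sum => i _; apply: ler_sum => j _; exact: (hK (i, j)).
have key k t : 0 <= t <= 1 -> NMx (E t) <= (K0 / 2 ^+ k + 2 * c * r) * expR (L * t).
  elim: k t => [|k IH] t t01.
    have e1 : 1 <= expR (L * t).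
      by rewrite one_le_expR // mulr_ge0 ?(ltW L0) //; case/andP: t01.
    apply: le_trans (hK0 t t01) _; rewrite expr0 divr1.
    rewrite (le_trans (_ : K0 <= K0 + 2 * c * r)) // ?lerDl ?mulr_ge0 //.
    by rewrite ler_peMr // addr_ge0 ?mulr_ge0.
  have KK : 0 <= K0 / 2 ^+ k + 2 * c * r by rewrite addr_ge0 ?mulr_ge0 ?divr_ge0 ?exprn_ge0.
  have := mcder_exp_bound KK r0 dE _ E0 t01.
  have -> : (K0 / 2 ^+ k + 2 * c * r) / 2 + c * r = K0 / 2 ^+ k.+1 + 2 * c * r.
    by rewrite exprS; field; rewrite expf_neq0.
  apply=> s s01; apply: le_trans (NMxD _ _) _; apply: lerD; last exact: bS.
  apply: le_trans (NMxM _ _) _; rewrite mulrC.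
  by apply: ler_pM; rewrite ?NMx_ge0 ?M_bound ?IH.
have one : 0 <= (1:R) <= 1 by rewrite ler01 lexx.
rewrite -subr_le0; apply: (@geometric_le0 _ (K0 * expR L)) => [|k].
  by rewrite mulr_ge0 ?expR_ge0.
have := key k 1 one; rewrite mulr1 mulrDl; rewrite lerBlDr => /le_trans; apply.
by rewrite lerD2r mulrAC.
Qed.

End LinearODE.
End MatrixCurves.

(** * Flat connections on the disc *)
Section Integrability.
Context {R : realType}.

Definition mwd {m n} (F : R[i] -> 'M[R[i]]_(m, n)) z (A B : 'M[R[i]]_(m, n)) :=
  forall i j, wd (fun w => F w i j) z (A i j) (B i j).

Lemma ray_cabs (t : R) (z : R[i]) : 0 <= t <= 1 -> cabs (t%:C * z) <= cabs z.
Proof.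
by case/andP=> t0 t1; rewrite cabsM cabsR // ler_piMl ?cabs_ge0.
Qed.

Lemma ray_disc (t : R) (z : R[i]) : 0 <= t <= 1 -> disc z -> disc (t%:C * z).
Proof. by move=> t01 /disc_cabs h; apply/disc_cabs/(le_lt_trans _ h)/ray_cabs. Qed.

Lemma ray_cder f (z : R[i]) (t : R) : smooth f -> disc (t%:C * z) ->
  cder (fun s => f (s%:C * z)) t (D f z (t%:C * z)).
Proof.
move=> hf dz'.
have h : cder (fun s => s%:C * z) t z.
  by apply: cder_eq (cderM (cder_id t) (cder_cst z t)) _; ring.
exact: (@wd_cder _ f (fun s => s%:C * z) t _ _ _ (smooth_wd hf dz') h).
Qed.

Lemma uniform_entries m n (P : 'I_m -> 'I_n -> R -> Prop) :
  (forall i j K K', K <= K' -> P i j K -> P i j K') ->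
  (forall i j, exists2 K, 0 <= K & P i j K) -> exists2 K, 0 <= K & forall i j, P i j K.
Proof.
move=> mono h.
have /choice[K hK] : forall ij : 'I_m * 'I_n, exists K, 0 <= K /\ P ij.1 ij.2 K.
  by move=> [i j]; have [K K0 hK] := h i j; exists K.
exists (\sum_ij K ij); first by apply: sumr_ge0 => ij _; case: (hK ij).
move=> i j; apply: mono (hK (i, j)).2.
rewrite (bigD1 (i, j)) //= lerDl; apply: sumr_ge0 => ij _; by case: (hK ij).
Qed.

Lemma N_le2 (z : R[i]) : cabs z <= 1 -> N z <= 2.
Proof. by move=> h; have := N_le_cabs z; lra. Qed.

(** The left side is the derivative of the error [E = Yw - Yz - t Yz al] of the guessed first
    variation. On the right, [E] satisfies the equation of [Yw] with a source. Once flatness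
    identifies the bracketed sum with the linear part of [Mw - Mz], that source is of second order,
    because [al] and [Mw - Mz] are both of first order. *)
Lemma error_identity n (Yw Yz Mw Mz al al' : 'M[R[i]]_n) (t : R[i]) :
  Yw *m Mw - Yz *m Mz - (1 *: (Yz *m al) + t *: (Yz *m Mz *m al + Yz *m al')) =
  (Yw - Yz - t *: (Yz *m al)) *m Mw +
  Yz *m (Mw - Mz - (al + t *: (al' + (Mz *m al - al *m Mz))) + t *: (al *m (Mw - Mz))).
Proof.
rewrite !(mulmxBl, mulmxBr, mulmxDr) -!scalemxAl -!scalemxAr !(mulmxBr, mulmxDr) !mulmxA.
move: (Yw *m Mw) (Yz *m Mw) (Yz *m Mz *m al) (Yz *m al *m Mw) (Yz *m al *m Mz)
  (Yz *m Mz) (Yz *m al) (Yz *m al') => p1 p2 p3 p4 p5 p6 p7 p8.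
by apply/matrixP => i j; rewrite !mxE; ring.
Qed.

Section FlatConnection.
Variables (n : nat) (A B : R[i] -> 'M[R[i]]_n).
Hypotheses (sA : smooth_mx A) (sB : smooth_mx B).

(** The connection form evaluated on the velocity of the ray [t z]. *)
Let M z (t : R) := z *: A (t%:C * z) + z^* *: B (t%:C * z).

Lemma ray_mcder (C : R[i] -> 'M[R[i]]_n) z t : smooth_mx C -> 0 <= t <= 1 -> disc z ->
  mcder (fun s => C (s%:C * z)) t (\matrix_(i, j) D (fun w => C w i j) z (t%:C * z)).
Proof. by move=> sC t01 dz' i j; rewrite mxE; apply: ray_cder => //; exact: ray_disc. Qed.

Lemma ray_rcont z t : 0 <= t <= 1 -> disc z -> forall i j, rcont (fun s => M z s i j) t.
Proof.
move=> t01 dz' i j.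
have hA := ray_mcder sA t01 dz'; have hB := ray_mcder sB t01 dz'.
exact: cder_rcont (mcderD (mcderZ (cder_cst z t) hA) (mcderZ (cder_cst z^* t) hB) i j).
Qed.

Lemma entries_bounded (C : R[i] -> 'M[R[i]]_n) (r : R) : smooth_mx C -> r < 1 ->
  exists2 K, 0 <= K & forall i j z, cabs z <= r -> N (C z i j) <= K.
Proof.
move=> sC r1.
apply: (@uniform_entries n n (fun i j K => forall z, cabs z <= r -> N (C z i j) <= K)).
  by move=> i j K K' KK h z /h /le_trans; apply.
move=> i j; apply: bounded_cdisc r1 => z; exact: smooth_cont (sC i j).
Qed.

Lemma ray_bound (r : R) : r < 1 -> exists2 m, 0 <= m & forall z t, cabs z <= r -> 0 <= t <= 1 ->
  NMx (M z t) <= m.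
Proof.
move=> r1; have [K1 K10 h1] := entries_bounded sA r1; have [K2 K20 h2] := entries_bounded sB r1.
exists ((n * n)%:R * (2 * (K1 + K2))) => [|z t zr t01].
  by rewrite mulr_ge0 // mulr_ge0 // addr_ge0.
have Nz : N z <= 2 by apply: N_le2; rewrite (le_trans zr) // ltW.
have tr : cabs (t%:C * z) <= r by apply: le_trans zr; exact: ray_cabs.
apply: NMx_le => i j; rewrite !mxE mulrDr; apply: le_trans (ND _ _) _; apply: lerD.
  by apply: le_trans (NM _ _) _; apply: ler_pM; rewrite ?N_ge0 ?h1.
by apply: le_trans (NM _ _) _; rewrite NJ; apply: ler_pM; rewrite ?N_ge0 ?h2.
Qed.

Lemma transport_exists z : disc z -> exists Y : R -> 'M[R[i]]_n, Y 0 = 1%:M /\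
  forall t : R, 0 <= t <= 1 -> mcder Y t (Y t *m M z t).
Proof.
move=> /[dup] dz' /disc_cabs z1; have [m _ hm] := ray_bound z1.
have [Y Y0 dY] := linear_ode (fun t t01 => ray_rcont t01 dz') (fun t => hm z t (lexx _)).
by exists Y.
Qed.

Lemma increment_bound (C : R[i] -> 'M[R[i]]_n) (r : R) : smooth_mx C -> r < 1 ->
  exists2 K, 0 <= K & forall i j z w, cabs z <= r -> cabs w <= r ->
    N (C w i j - C z i j) <= K * N (w - z) /\
    N (C w i j - C z i j - D (fun x => C x i j) (w - z) z) <= K * N (w - z) ^+ 2.
Proof.
move=> sC r1.
apply: (@uniform_entries n n (fun i j K => forall z w, cabs z <= r -> cabs w <= r ->
    N (C w i j - C z i j) <= K * N (w - z) /\
    N (C w i j - C z i j - D (fun x => C x i j) (w - z) z) <= K * N (w - z) ^+ 2)).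
  move=> i j K K' KK h z w zr wr; have [h1 h2] := h z w zr wr; split.
    by apply: le_trans h1 _; rewrite ler_wpM2r ?N_ge0.
  by apply: le_trans h2 _; rewrite ler_wpM2r ?exprn_ge0 ?N_ge0.
move=> i j; have [K1 K10 h1] := lipschitz_cdisc (sC i j) r1.
have [K2 K20 h2] := taylor_cdisc (sC i j) r1.
exists (K1 + K2) => [|z w zr wr]; first exact: addr_ge0.
split; [apply: le_trans (h1 z w zr wr) _|apply: le_trans (h2 z w zr wr) _].
  by rewrite ler_wpM2r ?N_ge0 // lerDl.
by rewrite ler_wpM2r ?exprn_ge0 ?N_ge0 // lerDr.
Qed.

(* [taylorM z w t] is the part of [M w t - M z t] of first order in [w - z]. *)
Definition taylorM z (w : R[i]) (t : R) : 'M[R[i]]_n :=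
  (w - z) *: A (t%:C * z) + (w - z)^* *: B (t%:C * z) +
  t%:C *: (z *: (\matrix_(i, j) D (fun x => A x i j) (w - z) (t%:C * z)) +
     z^* *: (\matrix_(i, j) D (fun x => B x i j) (w - z) (t%:C * z))).

Lemma taylorM_bound (r : R) : r < 1 -> exists2 K, 0 <= K &
  forall z w t, cabs z <= r -> cabs w <= r -> 0 <= t <= 1 ->
    NMx (M w t - M z t) <= K * N (w - z) /\
    NMx (M w t - M z t - taylorM z w t) <= K * N (w - z) ^+ 2 /\
    NMx ((w - z) *: A (t%:C * z) + (w - z)^* *: B (t%:C * z)) <= K * N (w - z).
Proof.
move=> r1; have [K1 K10 h1] := increment_bound sA r1; have [K2 K20 h2] := increment_bound sB r1.
have [K3 K30 h3] := entries_bounded sA r1; have [K4 K40 h4] := entries_bounded sB r1.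
pose S := K1 + K2 + K3 + K4.
have S0 : 0 <= S by rewrite !addr_ge0.
exists ((n * n)%:R * (3 * S)) => [|z w t zr wr t01]; first by rewrite !mulr_ge0.
have Nz : N z <= 2 by apply: N_le2; rewrite (le_trans zr) // ltW.
have Nw : N w <= 2 by apply: N_le2; rewrite (le_trans wr) // ltW.
have tzr : cabs (t%:C * z) <= r by apply: le_trans zr; exact: ray_cabs.
have twr : cabs (t%:C * w) <= r by apply: le_trans wr; exact: ray_cabs.
set d := N (w - z); have d0 : 0 <= d by exact: N_ge0.
have tE : t%:C * w - t%:C * z = t%:C * (w - z) by ring.
have td : N (t%:C * w - t%:C * z) <= d.
  by rewrite tE NMr; case/andP: t01 => t0 t1; rewrite ger0_norm // ler_piMl.
have td2 : N (t%:C * w - t%:C * z) ^+ 2 <= d ^+ 2 by rewrite ler_pXn2r ?nnegrE ?N_ge0.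
(* One estimate for a scalar coefficient times its base vector, used for [A] with [z], [w] and for
   [B] with their conjugates. The constants come from [N zz <= 2] in the unit disc and from moving
   one increment onto the base vector. *)
have ent (a : R[i] -> R[i]) (zz ww dd : R[i]) (K K' : R) : 0 <= K -> 0 <= K' ->
    N (a (t%:C * w) - a (t%:C * z)) <= K * N (t%:C * w - t%:C * z) /\
    N (a (t%:C * w) - a (t%:C * z) - D a (t%:C * w - t%:C * z) (t%:C * z))
       <= K * N (t%:C * w - t%:C * z) ^+ 2 ->
    N (a (t%:C * z)) <= K' ->
    N zz <= 2 -> N ww <= 2 -> ww - zz = dd -> N dd = d ->
    [/\ N (ww * a (t%:C * w) - zz * a (t%:C * z)) <= (2 * K + K') * d,
        N (ww * a (t%:C * w) - zz * a (t%:C * z) - (dd * a (t%:C * z) +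
          t%:C * (zz * D a (w - z) (t%:C * z)))) <= 3 * K * d ^+ 2
      & N (dd * a (t%:C * z)) <= K' * d].
  move=> K0 K'0 [H1 H2] H3 Hzz Hww ed Nd.
  have H1' : N (a (t%:C * w) - a (t%:C * z)) <= K * d by apply: le_trans H1 _; rewrite ler_wpM2l.
  have H2' : N (a (t%:C * w) - a (t%:C * z) - D a (t%:C * w - t%:C * z) (t%:C * z)) <= K * d ^+ 2.
    by apply: le_trans H2 _; rewrite ler_wpM2l.
  have Dt : D a (t%:C * w - t%:C * z) (t%:C * z) = t%:C * D a (w - z) (t%:C * z).
    by rewrite tE /D !cJM !cJR; ring.
  have H4 : N (dd * a (t%:C * z)) <= K' * d.
    by apply: le_trans (NM _ _) _; rewrite Nd mulrC ler_wpM2r.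
  split=> //.
  - have -> : ww * a (t%:C * w) - zz * a (t%:C * z) =
      ww * (a (t%:C * w) - a (t%:C * z)) + dd * a (t%:C * z) by rewrite -ed; ring.
    apply: le_trans (ND _ _) _; rewrite mulrDl; apply: lerD => //.
    apply: le_trans (NM _ _) _; rewrite -mulrA; apply: ler_pM => //; exact: N_ge0.
  - rewrite Dt in H2'.
    have -> : ww * a (t%:C * w) - zz * a (t%:C * z) - (dd * a (t%:C * z) +
        t%:C * (zz * D a (w - z) (t%:C * z))) =
      zz * (a (t%:C * w) - a (t%:C * z) - t%:C * D a (w - z) (t%:C * z)) +
      dd * (a (t%:C * w) - a (t%:C * z)) by rewrite -ed; ring.
    have -> : 3 * K * d ^+ 2 = 2 * (K * d ^+ 2) + d * (K * d) by ring.
    apply: le_trans (ND _ _) _; apply: lerD; apply: le_trans (NM _ _) _.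
      by apply: ler_pM => //; exact: N_ge0.
    by rewrite Nd ler_wpM2l.
have eA i j := ent (fun x => A x i j) z w _ K1 K3 K10 K30 (h1 i j _ _ tzr twr) (h3 i j _ tzr) Nz Nw
  erefl erefl.
have Nz' : N z^* <= 2 by rewrite NJ.
have Nw' : N w^* <= 2 by rewrite NJ.
have dE : w^* - z^* = (w - z)^* by rewrite cJD cJN.
have eB i j := ent (fun x => B x i j) z^* w^* (w - z)^* K2 K4 K20 K40 (h2 i j _ _ tzr twr)
  (h4 i j _ tzr) Nz' Nw' dE (NJ _).
have d2 : 0 <= d ^+ 2 by rewrite exprn_ge0.
split; [|split].
- rewrite -mulrA; apply: NMx_le => i j; have [a1 _ _] := eA i j; have [b1 _ _] := eB i j.
  rewrite mxBE !mxE.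
  rewrite [X in N X](_ : _ = (w * A (t%:C * w) i j - z * A (t%:C * z) i j) +
    (w^* * B (t%:C * w) i j - z^* * B (t%:C * z) i j)); last by ring.
  apply: le_trans (ND _ _) _; apply: le_trans (lerD a1 b1) _.
  by rewrite -mulrDl ler_wpM2r // /S; lra.
- rewrite -mulrA; apply: NMx_le => i j; have [_ a1 _] := eA i j; have [_ b1 _] := eB i j.
  rewrite !mxBE !mxE.
  move: a1 b1; set DA := D _ _ _; set DB := D _ _ _ => a1 b1.
  rewrite [X in N X](_ : _ = (w * A (t%:C * w) i j - z * A (t%:C * z) i j -
         ((w - z) * A (t%:C * z) i j + t%:C * (z * DA))) +
     (w^* * B (t%:C * w) i j - z^* * B (t%:C * z) i j -
         ((w - z)^* * B (t%:C * z) i j + t%:C * (z^* * DB)))); last by ring.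
  apply: le_trans (ND _ _) _; apply: le_trans (lerD a1 b1) _.
  by rewrite -mulrDl ler_wpM2r // /S; lra.
- rewrite -mulrA; apply: NMx_le => i j; have [_ _ a1] := eA i j; have [_ _ b1] := eB i j.
  rewrite !mxE; apply: le_trans (ND _ _) _; apply: le_trans (lerD a1 b1) _.
  by rewrite -mulrDl ler_wpM2r // /S; lra.
Qed.

Hypothesis flat : forall z, disc z ->
  entrywise dzbar A z - entrywise dz B z = A z *m B z - B z *m A z.

Lemma transport_wd (Y : R[i] -> R -> 'M[R[i]]_n) :
  (forall z, disc z -> Y z 0 = 1%:M /\
     forall t : R, 0 <= t <= 1 -> mcder (Y z) t (Y z t *m M z t)) ->
  forall z, disc z -> mwd (fun w => Y w 1) z (Y z 1 *m A z) (Y z 1 *m B z).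
Proof.
move=> hY z dz'.
have z1 : cabs z < 1 by exact/disc_cabs.
pose r := (1 + cabs z) / 2.
have r1 : r < 1 by rewrite /r; lra.
have zr : cabs z <= r by rewrite /r; lra.
have [m m0 hm] := ray_bound r1.
have [K K0 hK] := taylorM_bound r1.
have [Yz0 dYz] := hY z dz'.
have [KY KY0 hKY] : exists2 KY, 0 <= KY & forall t : R, 0 <= t <= 1 -> NMx (Y z t) <= KY.
  have [K' K'0 h'] : exists2 K' : R, 0 <= K' & forall (i j : 'I_n) (t : R), 0 <= t <= 1 -> N (Y z t i j) <= K'.
    apply: (@uniform_entries n n (fun i j K => forall t : R, 0 <= t <= 1 -> N (Y z t i j) <= K)).
      by move=> i j k k' kk h t /h /le_trans; apply.
    move=> i j; have [k hk] := rcont_bounded (fun t t01 => cder_rcont (dYz t t01 i j)).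
    exists k => //; apply: le_trans (N_ge0 _) (hk 0 _); rewrite lexx ler01 //.
  exists ((n * n)%:R * K') => [|t t01]; first exact: mulr_ge0.
  by apply: NMx_le => i j; exact: h'.
(* The constant of [ode_bound] for a source of size [KY (K + K^2) d^2], where [d] is the distance
   from [w] to [z]. *)
pose LL := expR (2 * ((n * n)%:R * 2 * m) + 1).
pose CC := 2 * ((n * n)%:R * 2) * (KY * (K + K * K)) * LL.
have CC0 : 0 <= CC.
  by rewrite /CC; do !apply: mulr_ge0 => //; rewrite ?expR_ge0 ?addr_ge0 ?mulr_ge0.
have main w : cabs w <= r ->
    NMx (Y w 1 - Y z 1 - Y z 1 *m ((w - z) *: A z + (w - z)^* *: B z)) <= CC * N (w - z) ^+ 2.
  move=> wr; have dw : disc w by exact: cdisc_sub r1 wr.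
  have [Yw0 dYw] := hY w dw.
  (* The connection form at [t z] on the displacement [w - z]. As the point [t z] moves by
     [t (w - z)], the expected variation of the transport is [t] times [Y z t *m al t]. *)
  pose al t := (w - z) *: A (t%:C * z) + (w - z)^* *: B (t%:C * z).
  pose DA t : 'M[R[i]]_n := \matrix_(i, j) D (fun x => A x i j) z (t%:C * z).
  pose DB t : 'M[R[i]]_n := \matrix_(i, j) D (fun x => B x i j) z (t%:C * z).
  pose al' t := (w - z) *: DA t + (w - z)^* *: DB t.
  have dal t : 0 <= t <= 1 -> mcder al t (al' t).
    move=> t01; have hA := ray_mcder sA t01 dz'; have hB := ray_mcder sB t01 dz'.
    apply: mcder_eq (mcderD (mcderZ (cder_cst _ t) hA) (mcderZ (cder_cst _ t) hB)) _.
    by rewrite !scale0r !add0r.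
  pose E t := Y w t - Y z t - t%:C *: (Y z t *m al t).
  pose S t := Y z t *m (M w t - M z t - taylorM z w t + t%:C *: (al t *m (M w t - M z t))).
  have dE t : 0 <= t <= 1 -> mcder E t (E t *m M w t + S t).
    move=> t01.
    have H := mcderB (mcderB (dYw t t01) (dYz t t01))
      (mcderZ (cder_id t) (mcderM (dYz t t01) (dal t t01))).
    apply: mcder_eq H _.
    (* Flatness enters here: the commutator is a multiple of [A B - B A], and replacing that by the
       derivatives of [A] and [B] exchanges the direction of differentiation [z] with the argument
       [w - z]. *)
    have comm : al' t + (M z t *m al t - al t *m M z t) =
        z *: (\matrix_(i, j) D (fun x => A x i j) (w - z) (t%:C * z)) +
        z^* *: (\matrix_(i, j) D (fun x => B x i j) (w - z) (t%:C * z)).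
      have fl := flat (ray_disc t01 dz').
      have -> : M z t *m al t - al t *m M z t = (z * (w - z)^* - z^* * (w - z)) *:
          (A (t%:C * z) *m B (t%:C * z) - B (t%:C * z) *m A (t%:C * z)).
        rewrite /M /al !mulmxDl !mulmxDr -!scalemxAl -!scalemxAr !scalerA.
        move: (_ *m _) (_ *m _) (_ *m _) (_ *m _) => P1 P2 P3 P4.
        by apply/matrixP => i j; rewrite !mxE; ring.
      rewrite -fl; apply/matrixP => i j; rewrite !mxE /D.
      by move: (dz _ _) (dzbar _ _) (dz _ _) (dzbar _ _) => *; rewrite !cJE; ring.
    have taylorE : taylorM z w t = al t + t%:C *: (al' t + (M z t *m al t - al t *m M z t)).
      by rewrite comm.
    rewrite /E /S taylorE; exact: error_identity.
  have E0 : E 0 = 0 by rewrite /E Yw0 Yz0 scale0r subr0 subrr.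
  set d := N (w - z); have d0 : 0 <= d by exact: N_ge0.
  have r0 : 0 <= KY * (K + K * K) * d ^+ 2 by rewrite !mulr_ge0 ?addr_ge0 ?mulr_ge0.
  have bS t : 0 <= t <= 1 -> NMx (S t) <= KY * (K + K * K) * d ^+ 2.
    move=> t01; have [k1 [k2 k3]] := hK z w t zr wr t01.
    apply: le_trans (NMxM _ _) _; rewrite -mulrA; apply: ler_pM; rewrite ?NMx_ge0 ?hKY //.
    apply: le_trans (NMxD _ _) _; rewrite mulrDl; apply: lerD => //.
    apply: (@le_trans _ _ (NMx (al t *m (M w t - M z t)))).
      rewrite /NMx; apply: ler_sum => i _; apply: ler_sum => j _; rewrite mxE NMr.
      by case/andP: t01 => t0 t1; rewrite ger0_norm // ler_piMl ?N_ge0.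
    apply: le_trans (NMxM _ _) _; rewrite expr2 mulrACA; apply: ler_pM; rewrite ?NMx_ge0 //.
  have := @ode_bound _ n (M w) m (fun t => hm w t wr) E S _ r0 E0 dE bS.
  rewrite /E /al mul1r scale1r => /le_trans; apply.
  by rewrite /CC le_eqVlt -/LL; apply/orP; left; apply/eqP; ring.
move=> i j; apply: wd_of_littleo => e e0.
(* The first bound keeps [w] in the closed disc of radius [r], the second turns the quadratic error
   into a little-o; the summand 1 covers [CC = 0]. *)
exists (Num.min (r - cabs z) (e / (CC + 1))).
  rewrite lt_min; apply/andP; split; first by rewrite /r; lra.
  by apply: divr_gt0 => //; lra.
move=> w; rewrite lt_min => /andP[w1 w2].
have wr : cabs w <= r by have := cabsD (w - z) z; rewrite subrK; have := cabs_le_N (w - z); lra.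
have -> : Y w 1 i j - Y z 1 i j - ((Y z 1 *m A z) i j * (w - z) + (Y z 1 *m B z) i j * (w - z)^*)
   = (Y w 1 - Y z 1 - Y z 1 *m ((w - z) *: A z + (w - z)^* *: B z)) i j.
  rewrite mulmxDr -!scalemxAr.
  move: (Y z 1 *m A z) (Y z 1 *m B z) (Y w 1) (Y z 1) => P1 P2 P3 P4.
  by rewrite !mxE; ring.
apply: le_trans (N_le_NMx _ _ _) _; apply: le_trans (main w wr) _.
rewrite expr2 mulrA ler_wpM2r ?N_ge0 //.
move: w2; rewrite ltr_pdivlMr ?ltr_wpDl //; have := N_ge0 (w - z); nra.
Qed.

(** The derivatives [F A] and [F B] are as regular as [F], so each order of regularity yields the
    next. *)
Lemma smooth_frame (F : R[i] -> 'M[R[i]]_n) :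
  (forall z, disc z -> mwd F z (F z *m A z) (F z *m B z)) -> smooth_mx F.
Proof.
move=> hF.
have key k : forall i j, Wk k (fun w => F w i j).
  elim: k => [|k IH] i j; first by split=> // z dz'; exact: wd_cont (hF z dz' i j).
  have prod (C : R[i] -> 'M[R[i]]_n) : smooth_mx C -> Wk k (fun w => (F w *m C w) i j).
    move=> sC; have h l : Wk k (fun w => F w i l * C w l j).
      by apply: WkM (IH i l) _; exact: smooth_Wk (sC l j).
    suff : Wk k (fun w => \sum_(l < n) F w i l * C w l j).
      by apply: Wk_eq => z _; rewrite mxE.
    elim: (index_enum _) => [|l s IHs].
      by apply: Wk_eq (Wk_cst k 0) => z _; rewrite big_nil.
    by apply: Wk_eq (WkD (h l) IHs) => z _; rewrite big_cons.
  apply: Wk_intro (fun z hz => hF z hz i j) (prod A sA) (prod B sB).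
by move=> i j; apply/smoothP => k; exact: key.
Qed.

Theorem flat_integrable : exists F : R[i] -> 'M[R[i]]_n,
  [/\ smooth_mx F, F 0 = 1%:M &
    forall z, disc z -> mwd F z (F z *m A z) (F z *m B z)].
Proof.
have /choice[Y hY] : forall z : R[i], exists Y : R -> 'M[R[i]]_n, disc z -> Y 0 = 1%:M /\
    forall t : R, 0 <= t <= 1 -> mcder Y t (Y t *m M z t).
  move=> z; have [/transport_exists[Y hY]|nz] := pselect (disc z); first by exists Y.
  by exists (fun=> 0).
have h := transport_wd hY.
have d0 : disc (0 : R[i]) by apply/disc_cabs; rewrite cabs0.
have [Y00 dY0] := hY 0 d0.
exists (fun z => Y z 1); split=> //; first exact: smooth_frame.
(* The ray to 0 does not move: its generator [M 0 t] is zero, so the transport stays at the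
   identity. *)
apply/matrixP => i j; rewrite -Y00; apply/eqP; rewrite -subr_eq0; apply/eqP/N_eq0/le_anti.
rewrite N_ge0 andbT.
have := @cder_mvi _ (fun t => Y 0 t i j) (fun t => (Y 0 t *m M 0 t) i j) 0 0
  (fun t t01 => dY0 t t01 i j).
rewrite subr0 mulr0; apply=> t _.
by rewrite /M cJ0 !scale0r addr0 mulmx0 mxE subr0 N0.
Qed.

End FlatConnection.
End Integrability.

(** * Determinants of 3x3 matrices *)

Section Det3.
Context {K : comNzRingType}.

Lemma det3E (M : 'M[K]_3) : \det M =
  M 0 0 * (M 1 1 * M 2%:R 2%:R - M 1 2%:R * M 2%:R 1)
  - M 0 1 * (M 1 0 * M 2%:R 2%:R - M 1 2%:R * M 2%:R 0)
  + M 0 2%:R * (M 1 0 * M 2%:R 1 - M 1 1 * M 2%:R 0).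
Proof.
rewrite (expand_det_row _ ord0) !big_ord_recl big_ord0 /cofactor.
rewrite !(expand_det_row _ ord0) !big_ord_recl !big_ord0 /cofactor !det_mx11 !mxE.
pose m (i j : nat) := M (inord i) (inord j).
have mE i j : M i j = m i j by rewrite /m !inord_val.
by rewrite !mE /= /bump /=; ring.
Qed.

Lemma sum3E (f : 'I_3 -> K) : \sum_k f k = f 0 + f 1 + f 2%:R.
Proof.
rewrite !big_ord_recl big_ord0 addr0 addrA.
by congr (_ + f _ + f _); exact: val_inj.
Qed.

(* Jacobi's formula for the derivative [F A] of a 3x3 matrix [F] *)
Lemma det3_deriv (F A : 'M[K]_3) (G := F *m A) :
  G 0 0 * (F 1 1 * F 2%:R 2%:R - F 1 2%:R * F 2%:R 1) +
  F 0 0 * (G 1 1 * F 2%:R 2%:R + F 1 1 * G 2%:R 2%:R - (G 1 2%:R * F 2%:R 1 + F 1 2%:R * G 2%:R 1))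
  - (G 0 1 * (F 1 0 * F 2%:R 2%:R - F 1 2%:R * F 2%:R 0) +
  F 0 1 * (G 1 0 * F 2%:R 2%:R + F 1 0 * G 2%:R 2%:R - (G 1 2%:R * F 2%:R 0 + F 1 2%:R * G 2%:R 0)))
  + (G 0 2%:R * (F 1 0 * F 2%:R 1 - F 1 1 * F 2%:R 0) +
  F 0 2%:R * (G 1 0 * F 2%:R 1 + F 1 0 * G 2%:R 1 - (G 1 1 * F 2%:R 0 + F 1 1 * G 2%:R 0)))
  = \det F * \tr A.
Proof. by rewrite det3E /mxtrace sum3E /G !mxE !sum3E; ring. Qed.
End Det3.

(** * Matrix-valued functions, the group U(2,1), and linear systems on the disc *)

Section MatrixFields.
Context {R : realType}.
Implicit Types (z : R[i]).

Lemma mwd_eq m n (F : R[i] -> 'M[R[i]]_(m, n)) z A B A' B' :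
  mwd F z A B -> A = A' -> B = B' -> mwd F z A' B'.
Proof. by move=> h <- <-. Qed.
Lemma mwd_disc m n (F G : R[i] -> 'M[R[i]]_(m, n)) z A B :
  (forall w, disc w -> F w = G w) -> disc z -> mwd F z A B -> mwd G z A B.
Proof. by move=> e dz' h i j; apply: wd_disc dz' (h i j) => w dw; rewrite e. Qed.
Lemma mwd_cst m n (C : 'M[R[i]]_(m, n)) z : mwd (fun=> C) z 0 0.
Proof. by move=> i j; rewrite mxE; exact: wd_cst. Qed.
Lemma mwdD m n (F G : R[i] -> 'M[R[i]]_(m, n)) z A B C E :
  mwd F z A B -> mwd G z C E -> mwd (fun w => F w + G w) z (A + C) (B + E).
Proof.
by move=> h h' i j; rewrite !mxE; apply: wd_ext (wdD (h i j) (h' i j)) => w; rewrite mxE.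
Qed.
Lemma mwdM m n p (F : R[i] -> 'M[R[i]]_(m, n)) (G : R[i] -> 'M[R[i]]_(n, p)) z A B C E :
  mwd F z A B -> mwd G z C E ->
  mwd (fun w => F w *m G w) z (A *m G z + F z *m C) (B *m G z + F z *m E).
Proof.
move=> h h' i j; rewrite !mxE -!big_split /=.
by apply: wd_ext (wd_sum _ (fun k => wdM (h i k) (h' k j))) => w; rewrite mxE.
Qed.
Lemma mwdMl m n p (C : 'M[R[i]]_(m, n)) (G : R[i] -> 'M[R[i]]_(n, p)) z A B :
  mwd G z A B -> mwd (fun w => C *m G w) z (C *m A) (C *m B).
Proof. by move=> h; apply: mwd_eq (mwdM (mwd_cst C z) h) _ _; rewrite mul0mx add0r. Qed.
Lemma mwdZ m n (g : R[i] -> R[i]) (F : R[i] -> 'M[R[i]]_(m, n)) z a b A B :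
  wd g z a b -> mwd F z A B ->
  mwd (fun w => g w *: F w) z (a *: F z + g z *: A) (b *: F z + g z *: B).
Proof.
by move=> h h' i j; rewrite !mxE; apply: wd_ext (wdM h (h' i j)) => w; rewrite mxE.
Qed.
Lemma mwdZl m n (c : R[i]) (F : R[i] -> 'M[R[i]]_(m, n)) z A B :
  mwd F z A B -> mwd (fun w => c *: F w) z (c *: A) (c *: B).
Proof. by move=> h; apply: mwd_eq (mwdZ (wd_cst c z) h) _ _; rewrite scale0r add0r. Qed.
Lemma mwd_comp m n (F : R[i] -> 'M[R[i]]_(m, n)) g z A B c d :
  mwd F (g z) A B -> wd g z c d ->
  mwd (fun w => F (g w)) z (c *: A + d^* *: B) (d *: A + c^* *: B).
Proof.
move=> h h' i j; rewrite !mxE.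
by apply: wd_eq (wd_comp (h i j) h') _ _; rewrite ![_ * A i j]mulrC ![_ * B i j]mulrC.
Qed.

Definition ctr {m n} (A : 'M[R[i]]_(m, n)) : 'M[R[i]]_(n, m) := \matrix_(i, j) (A j i)^*.

Lemma mwd_ctr m n (F : R[i] -> 'M[R[i]]_(m, n)) z A B :
  mwd F z A B -> mwd (fun w => ctr (F w)) z (ctr B) (ctr A).
Proof.
by move=> h i j; rewrite !mxE; apply: wd_ext (wdJ (h j i)) => w; rewrite mxE.
Qed.
Lemma ctrM m n p (A : 'M[R[i]]_(m, n)) (B : 'M[R[i]]_(n, p)) :
  ctr (A *m B) = ctr B *m ctr A.
Proof.
apply/matrixP => i j; rewrite !mxE rmorph_sum; apply: eq_bigr => k _.
by rewrite !mxE; exact: etrans (cJM _ _) (mulrC _ _).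
Qed.
Lemma ctrK m n (A : 'M[R[i]]_(m, n)) : ctr (ctr A) = A.
Proof. by apply/matrixP => i j; rewrite !mxE cJK. Qed.

Lemma mwd_entrywise m n (F : R[i] -> 'M[R[i]]_(m, n)) z A B : mwd F z A B ->
  entrywise dz F z = A /\ entrywise dzbar F z = B.
Proof.
by move=> h; split; apply/matrixP => i j; rewrite mxE; [exact: wd_dz (h i j)|exact: wd_dzbar (h i j)].
Qed.
Lemma mwd_unique m n (F : R[i] -> 'M[R[i]]_(m, n)) z A B A' B' : mwd F z A B ->
  mwd F z A' B' -> A = A' /\ B = B'.
Proof. by move=> /mwd_entrywise[<- <-] /mwd_entrywise[<- <-]. Qed.
Lemma smooth_mwd m n (F : R[i] -> 'M[R[i]]_(m, n)) z : smooth_mx F -> disc z ->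
  mwd F z (entrywise dz F z) (entrywise dzbar F z).
Proof. by move=> h dz' i j; rewrite !mxE; exact: smooth_wd (h i j) dz'. Qed.
Lemma mwd_pder m n (F : R[i] -> 'M[R[i]]_(m, n)) z A B v : mwd F z A B ->
  entrywise (pder v) F z = v *: A + v^* *: B.
Proof.
move=> h; apply/matrixP => i j; rewrite !mxE (wd_pder v (h i j)).
by rewrite mulrC [v^* * _]mulrC.
Qed.

Lemma smooth_mx_eq m n (F G : R[i] -> 'M[R[i]]_(m, n)) :
  (forall z, disc z -> F z = G z) -> smooth_mx F -> smooth_mx G.
Proof. by move=> e h i j; apply: smooth_eq (h i j) => z dz'; rewrite e. Qed.
Lemma smooth_mx_cst m n (C : 'M[R[i]]_(m, n)) : smooth_mx (fun=> C).
Proof. by move=> i j; exact: smooth_cst. Qed.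
Lemma smooth_mxM m n p (F : R[i] -> 'M[R[i]]_(m, n)) (G : R[i] -> 'M[R[i]]_(n, p)) :
  smooth_mx F -> smooth_mx G -> smooth_mx (fun w => F w *m G w).
Proof.
move=> h h' i j; apply: smooth_eq (smooth_sum _ (fun k => smoothM (h i k) (h' k j))) => z _.
by rewrite mxE.
Qed.
Lemma smooth_mxD m n (F G : R[i] -> 'M[R[i]]_(m, n)) :
  smooth_mx F -> smooth_mx G -> smooth_mx (fun w => F w + G w).
Proof. by move=> h h' i j; apply: smooth_eq (smoothD (h i j) (h' i j)) => z _; rewrite mxE. Qed.
Lemma smooth_mxZ m n g (F : R[i] -> 'M[R[i]]_(m, n)) :
  smooth g -> smooth_mx F -> smooth_mx (fun w => g w *: F w).
Proof. by move=> h h' i j; apply: smooth_eq (smoothM h (h' i j)) => z _; rewrite mxE. Qed.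
Lemma smooth_mx_comp m n (F : R[i] -> 'M[R[i]]_(m, n)) g :
  (forall z, disc z -> disc (g z)) -> smooth g -> smooth_mx F ->
  smooth_mx (fun w => F (g w)).
Proof. by move=> dg h h' i j; exact: smooth_comp dg (h' i j) h. Qed.
Lemma smooth_mx_dz m n (F : R[i] -> 'M[R[i]]_(m, n)) : smooth_mx F -> smooth_mx (entrywise dz F).
Proof. by move=> h i j; apply: smooth_eq (smooth_dz (h i j)) => z _; rewrite mxE. Qed.
Lemma smooth_mx_dzbar m n (F : R[i] -> 'M[R[i]]_(m, n)) :
  smooth_mx F -> smooth_mx (entrywise dzbar F).
Proof. by move=> h i j; apply: smooth_eq (smooth_dzbar (h i j)) => z _; rewrite mxE. Qed.

Lemma cst_disc_mx m n (F : R[i] -> 'M[R[i]]_(m, n)) :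
  (forall z, disc z -> mwd F z 0 0) -> forall z, disc z -> F z = F 0.
Proof.
move=> h z dz'; apply/matrixP => i j.
by apply: (@cst_disc _ (fun w => F w i j)) dz' => w dw; have := h w dw i j; rewrite !mxE.
Qed.

(** * The Hermitian form *)

Definition J : 'M[R[i]]_3 := mx3 [:: [:: 1; 0; 0]; [:: 0; 1; 0]; [:: 0; 0; -1]].

Lemma herm_ctr (u v : 'cV[R[i]]_3) : herm u v = (ctr v *m J *m u) 0 0.
Proof.
rewrite /herm !mxE !big_ord_recl big_ord0 !mxE !big_ord_recl !big_ord0 !mxE /=.
rewrite (_ : lift ord0 ord0 = 1); last exact/val_inj.
rewrite (_ : lift ord0 (lift ord0 ord0) = 2%:R :> 'I_3); last exact/val_inj.
by ring.
Qed.

Lemma JJ : J *m J = 1%:M.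
Proof.
apply/matrixP => i j; rewrite !mxE !big_ord_recl big_ord0 !mxE.
by case: i => [[|[|[|//]]] hi]; case: j => [[|[|[|//]]] hj];
  rewrite /= ?(mulr0, mul0r, mulr1, addr0, add0r, mulrNN).
Qed.
Lemma ctrJ : ctr J = J.
Proof.
apply/matrixP => i j; rewrite !mxE.
by case: i => [[|[|[|//]]] hi]; case: j => [[|[|[|//]]] hj]; rewrite /= ?(cJE).
Qed.

(** The order of factors is that of the quantity preserved by [dF = F alpha]; the equivalent form
    with [ctr F] on the left is [U21_ctr]. *)
Definition U21 (F : 'M[R[i]]_3) := F *m J *m ctr F = J.

Lemma U21_inv F : U21 F -> (J *m ctr F *m J) *m F = 1%:M.
Proof.
by move=> h; apply: mulmx1C; rewrite !mulmxA h JJ.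
Qed.
Lemma U21_ctr F : U21 F -> ctr F *m J *m F = J.
Proof.
by move=> /U21_inv h; rewrite -[RHS]mulmx1 -h !mulmxA JJ mul1mx.
Qed.
Lemma ctr_U21 F : ctr F *m J *m F = J -> U21 F.
Proof.
move=> h; have h1 : F *m (J *m ctr F *m J) = 1%:M.
  by apply: mulmx1C; rewrite -!mulmxA (mulmxA (ctr F)) h JJ.
by rewrite /U21 -[RHS]mul1mx -h1 -!mulmxA JJ mulmx1.
Qed.
Lemma U21_unit F : U21 F -> F \in unitmx.
Proof. by move/U21_inv/mulmx1_unit => []. Qed.

Lemma ctr_herm (A : 'M[R[i]]_3) i j :
  (ctr A *m J *m A) i j = herm (col j A) (col i A).
Proof.
rewrite herm_ctr !mxE; apply: eq_bigr => k _; rewrite !mxE; congr (_ * _).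
by apply: eq_bigr => l _; rewrite !mxE.
Qed.

Lemma herm_U21 F : U21 F <-> forall u v : 'cV_3, herm (F *m u) (F *m v) = herm u v.
Proof.
split=> [/U21_ctr h u v|h].
  by rewrite !herm_ctr ctrM -!mulmxA (mulmxA (ctr F)) (mulmxA (ctr F *m J)) h.
have c1 : ctr 1%:M = 1%:M :> 'M[R[i]]_3.
  by apply/matrixP => i j; rewrite !mxE rmorph_nat eq_sym.
apply: ctr_U21; apply/matrixP => i j; rewrite ctr_herm !colE h.
have := ctr_herm 1%:M i j; rewrite c1 mul1mx mulmx1 => ->.
by rewrite !colE !mul1mx.
Qed.

Lemma SU21P (F : 'M[R[i]]_3) : SU21 F <-> U21 F /\ \det F = 1.
Proof. by split=> -[/herm_U21 h1 h2]. Qed.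

Lemma U21M F G : U21 F -> U21 G -> U21 (F *m G).
Proof.
move=> hF hG; rewrite /U21 ctrM.
have -> : F *m G *m J *m (ctr G *m ctr F) = F *m (G *m J *m ctr G) *m ctr F.
  by rewrite !mulmxA.
by rewrite hG hF.
Qed.
Lemma SU21_unit (F : 'M[R[i]]_3) : SU21 F -> F \in unitmx.
Proof. by move=> /SU21P[h _]; exact: U21_unit. Qed.
Lemma U21V F : U21 F -> U21 (invmx F).
Proof.
move=> hF; have uF := U21_unit hF; apply/herm_U21 => u v.
by have /herm_U21/(_ (invmx F *m u) (invmx F *m v)) := hF; rewrite !mulKVmx.
Qed.
Lemma SU21M (F G : 'M[R[i]]_3) : SU21 F -> SU21 G -> SU21 (F *m G).
Proof.
move=> /SU21P[h1 h2] /SU21P[h3 h4]; apply/SU21P; split; first exact: U21M.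
by rewrite det_mulmx h2 h4 mulr1.
Qed.
Lemma SU21V (F : 'M[R[i]]_3) : SU21 F -> SU21 (invmx F).
Proof.
move=> /SU21P[h1 h2]; apply/SU21P; split; first exact: U21V.
by rewrite det_inv h2 invr1.
Qed.

Lemma U21_nondeg F (v : 'cV[R[i]]_3) : U21 F -> (forall j, herm v (col j F) = 0) -> v = 0.
Proof.
move=> hF h.
have e : ctr F *m J *m v = 0.
  apply/matrixP => i j; rewrite (ord1 j) [RHS]mxE -(h i) herm_ctr !mxE.
  by apply: eq_bigr => k _; rewrite !mxE; congr (_ * _); apply: eq_bigr => l _; rewrite !mxE.
rewrite /U21 in hF.
have := congr1 (mulmx (F *m J)) e.
by rewrite mulmx0 !mulmxA hF JJ mul1mx.
Qed.

(** * Solutions of [dF = F alpha] *)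

Definition sol (A B F : R[i] -> 'M[R[i]]_3) :=
  forall z, disc z -> mwd F z (F z *m A z) (F z *m B z).

(** The form [A dz + B dzbar] takes values in the Lie algebra u(2,1). Conjugation exchanges [dz] and
    [dzbar], so the condition pairs [A] with [B]. *)
Definition skewJ (A B : R[i] -> 'M[R[i]]_3) :=
  forall z, disc z -> A z *m J + J *m ctr (B z) = 0.

Lemma skew_sym A B : skewJ A B -> forall z, disc z -> B z *m J + J *m ctr (A z) = 0.
Proof.
move=> h z /h e; have := congr1 ctr e.
have cD (X Y : 'M[R[i]]_3) : ctr (X + Y) = ctr X + ctr Y.
  by apply/matrixP => i j; rewrite !mxE cJD.
have c0 : ctr 0 = 0 :> 'M[R[i]]_3 by apply/matrixP => i j; rewrite !mxE cJ0.
by rewrite cD !ctrM ctrJ ctrK c0 addrC.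
Qed.

Lemma disc0 : disc (0 : R[i]).
Proof. by apply/disc_cabs; rewrite cabs0. Qed.

Lemma sol_pairing A B F G : skewJ A B -> sol A B F -> sol A B G ->
  forall z, disc z -> F z *m J *m ctr (G z) = F 0 *m J *m ctr (G 0).
Proof.
move=> hAB hF hG; apply: (@cst_disc_mx _ _ (fun z => F z *m J *m ctr (G z))) => z dz'.
have H := mwdM (mwdM (hF z dz') (mwd_cst J z)) (mwd_ctr (hG z dz')).
apply: mwd_eq H _ _; rewrite !mulmx0 !addr0 !ctrM -!mulmxA -mulmxDr !mulmxA -mulmxDl.
  by rewrite (hAB z dz') mul0mx mulmx0.
by rewrite (skew_sym hAB dz') mul0mx mulmx0.
Qed.

Lemma sol_U21 A B F : skewJ A B -> sol A B F -> U21 (F 0) -> forall z, disc z -> U21 (F z).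
Proof. by move=> hAB hF h0 z dz'; rewrite /U21 (sol_pairing hAB hF hF dz'). Qed.

Lemma sol_unique A B F G : skewJ A B -> sol A B F -> sol A B G ->
  (forall z, disc z -> U21 (F z)) -> (forall z, disc z -> U21 (G z)) ->
  exists2 P, U21 P & forall z, disc z -> G z = P *m F z.
Proof.
move=> hAB hF hG uF uG; exists (G 0 *m invmx (F 0)).
  by apply: U21M; [exact/uG/disc0|exact/U21V/uF/disc0].
move=> z dz'.
have e := sol_pairing hAB hG hF dz'.
(* [F^* J F = J] and [J J = 1] recover [G] from the constant pairing and [F]. *)
have h w : disc w -> G w = (G w *m J *m ctr (F w)) *m (J *m F w).
  move=> dw; have := U21_ctr (uF w dw) => e'.
  have -> : G w *m J *m ctr (F w) *m (J *m F w) = G w *m J *m (ctr (F w) *m J *m F w).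
    by rewrite !mulmxA.
  by rewrite e' -mulmxA JJ mulmx1.
rewrite [LHS](h z dz') e {2}(h 0 disc0).
have u0 := U21_unit (uF 0 disc0).
have -> : G 0 *m J *m ctr (F 0) *m (J *m F 0) *m invmx (F 0) =
  G 0 *m J *m ctr (F 0) *m J *m (F 0 *m invmx (F 0)) by rewrite !mulmxA.
by rewrite mulmxV // mulmx1 !mulmxA.
Qed.

(** By Jacobi's formula the derivative of the determinant is the determinant times a trace, here
    zero. *)
Lemma sol_det A B F : (forall z, disc z -> \tr (A z) = 0) ->
  (forall z, disc z -> \tr (B z) = 0) -> sol A B F ->
  forall z, disc z -> \det (F z) = \det (F 0).
Proof.
move=> tA tB hF; apply: (@cst_disc _ (fun z => \det (F z))) => z dz'.
have h := hF z dz'.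
have H := wdD (wdB (wdM (h 0 0) (wdB (wdM (h 1 1) (h 2%:R 2%:R)) (wdM (h 1 2%:R) (h 2%:R 1))))
  (wdM (h 0 1) (wdB (wdM (h 1 0) (h 2%:R 2%:R)) (wdM (h 1 2%:R) (h 2%:R 0)))))
  (wdM (h 0 2%:R) (wdB (wdM (h 1 0) (h 2%:R 1)) (wdM (h 1 1) (h 2%:R 0)))).
apply: (wd_ext (f := _) (g := fun w => \det (F w))) (wd_eq H _ _).
- by move=> w; rewrite det3E.
- by rewrite det3_deriv tA // mulr0.
- by rewrite det3_deriv tB // mulr0.
Qed.
End MatrixFields.

(** * The connection form *)
Section Alpha.
Context {R : realType}.
Implicit Types (z p q c d S : R[i]).

(** The shape of [alpha] with its entries as free variables, so that matrix identities become
    polynomial identities. *)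
Definition amx p c S : 'M[R[i]]_3 :=
  mx3 [:: [:: p; 0; S]; [:: - c; - p; 0]; [:: 0; S; 0]].
Definition bmx q d S : 'M[R[i]]_3 :=
  mx3 [:: [:: - q; d; 0]; [:: 0; q; S]; [:: S; 0; 0]].

(** The first hypothesis settles the diagonal and will be the Gauss equation; those on [c'] and [d']
    will express holomorphy of [Q]; those on [S'] and [S''] say that [p] and [q] are the logarithmic
    derivatives of [S]. *)
Lemma amx_bmx_flat p c S q d p' q' c' d' S' S'' :
  p' + q' = S * S + c * d -> d' = - (2 * p * d) -> c' = - (2 * c * q) ->
  S' = q * S -> S'' = p * S ->
  amx p' c' S' - bmx q' d' S'' = amx p c S *m bmx q d S - bmx q d S *m amx p c S.
Proof.
move=> e -> -> -> ->; have {e}-> : p' = S * S + c * d - q' by rewrite -e addrK.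
apply/matrixP => i j; rewrite !mxE !sum3E !mxE.
by case: i => [[|[|[|//]]] hi]; case: j => [[|[|[|//]]] hj]; rewrite /=; ring.
Qed.

Lemma amx_bmx_skew p c S q d : q^* = p -> d^* = c -> S^* = S ->
  amx p c S *m J + J *m ctr (bmx q d S) = 0.
Proof.
move=> <- <- eS.
apply/matrixP => i j; rewrite !mxE !sum3E !mxE.
by case: i => [[|[|[|//]]] hi]; case: j => [[|[|[|//]]] hj]; rewrite /= ?cJE ?eS; ring.
Qed.

Lemma tr_amx p c S : \tr (amx p c S) = 0.
Proof. by rewrite /mxtrace sum3E !mxE /=; ring. Qed.
Lemma tr_bmx q d S : \tr (bmx q d S) = 0.
Proof. by rewrite /mxtrace sum3E !mxE /=; ring. Qed.

Lemma wd_amx (p c S : R[i] -> R[i]) z p1 p2 c1 c2 S1 S2 :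
  wd p z p1 p2 -> wd c z c1 c2 -> wd S z S1 S2 ->
  mwd (fun w => amx (p w) (c w) (S w)) z (amx p1 c1 S1) (amx p2 c2 S2).
Proof.
move=> hp hc hS i j; rewrite !mxE.
apply: (wd_ext (f := fun w =>
  (nth [::] [:: [:: p w; 0; S w]; [:: - c w; - p w; 0]; [:: 0; S w; 0]] i)`_j)) => [w|].
  by rewrite mxE.
by case: i => [[|[|[|//]]] hi]; case: j => [[|[|[|//]]] hj]; rewrite /=;
  try exact: wd_cst; try exact: wdN; assumption.
Qed.
Lemma wd_bmx (q d S : R[i] -> R[i]) z q1 q2 d1 d2 S1 S2 :
  wd q z q1 q2 -> wd d z d1 d2 -> wd S z S1 S2 ->
  mwd (fun w => bmx (q w) (d w) (S w)) z (bmx q1 d1 S1) (bmx q2 d2 S2).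
Proof.
move=> hp hc hS i j; rewrite !mxE.
apply: (wd_ext (f := fun w =>
  (nth [::] [:: [:: - q w; d w; 0]; [:: 0; q w; S w]; [:: S w; 0; 0]] i)`_j)) => [w|].
  by rewrite mxE.
by case: i => [[|[|[|//]]] hi]; case: j => [[|[|[|//]]] hj]; rewrite /=;
  try exact: wd_cst; try exact: wdN; assumption.
Qed.
Lemma smooth_amx (p c S : R[i] -> R[i]) : smooth p -> smooth c -> smooth S ->
  smooth_mx (fun w => amx (p w) (c w) (S w)).
Proof.
move=> hp hc hS i j; apply: (@smooth_eq _ (fun w =>
  (nth [::] [:: [:: p w; 0; S w]; [:: - c w; - p w; 0]; [:: 0; S w; 0]] i)`_j)) => [w _|].
  by rewrite mxE.
by case: i => [[|[|[|//]]] hi]; case: j => [[|[|[|//]]] hj]; rewrite /=;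
  try exact: smooth_cst; try exact: smoothN; assumption.
Qed.
Lemma smooth_bmx (q d S : R[i] -> R[i]) : smooth q -> smooth d -> smooth S ->
  smooth_mx (fun w => bmx (q w) (d w) (S w)).
Proof.
move=> hp hc hS i j; apply: (@smooth_eq _ (fun w =>
  (nth [::] [:: [:: - q w; d w; 0]; [:: 0; q w; S w]; [:: S w; 0; 0]] i)`_j)) => [w _|].
  by rewrite mxE.
by case: i => [[|[|[|//]]] hi]; case: j => [[|[|[|//]]] hj]; rewrite /=;
  try exact: smooth_cst; try exact: smoothN; assumption.
Qed.

Section Coefficients.
Context (s : R[i] -> R) (Q : R[i] -> R[i]).
Hypothesis s_gt0 : forall z, disc z -> 0 < s z.
Hypothesis s_smooth : smooth (fun z => (s z)%:C).
Hypothesis Q_smooth : smooth Q.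

Let S z := (s z)%:C.
Let p z := (S z)^-1 * dz S z.
Let q z := (S z)^-1 * dzbar S z.
Let c z := Q z * S z ^- 2.
Let d z := (Q z)^* * S z ^- 2.

Lemma alphaAE z : alphaA s Q z = amx (p z) (c z) (S z). Proof. by []. Qed.
Lemma alphaBE z : alphaB s Q z = bmx (q z) (d z) (S z). Proof. by []. Qed.

Lemma S_neq0 z : disc z -> S z != 0.
Proof. by move=> /s_gt0 h; rewrite eq_complex /= eqxx andbT gt_eqF. Qed.

Lemma S_conj z : (S z)^* = S z. Proof. exact: cJR. Qed.

Lemma S_dzbar z : disc z -> dzbar S z = (dz S z)^*.
Proof. by move=> dz'; exact: wd_real (smooth_wd s_smooth dz'). Qed.

Lemma p_smooth : smooth p.
Proof. exact: smoothM (smoothV S_neq0 s_smooth) (smooth_dz s_smooth). Qed.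
Lemma q_smooth : smooth q.
Proof. exact: smoothM (smoothV S_neq0 s_smooth) (smooth_dzbar s_smooth). Qed.
Lemma S2_smooth : smooth (fun z => S z ^- 2).
Proof.
have h := smoothV S_neq0 s_smooth.
by apply: smooth_eq (smoothM h h) => z _; rewrite -invfM -expr2.
Qed.
Lemma c_smooth : smooth c. Proof. exact: smoothM Q_smooth S2_smooth. Qed.
Lemma d_smooth : smooth d. Proof. exact: smoothM (smoothJ Q_smooth) S2_smooth. Qed.

Lemma smooth_alphaA : smooth_mx (alphaA s Q).
Proof. exact: smooth_amx p_smooth c_smooth s_smooth. Qed.
Lemma smooth_alphaB : smooth_mx (alphaB s Q).
Proof. exact: smooth_bmx q_smooth d_smooth s_smooth. Qed.

Lemma skew_alpha : skewJ (alphaA s Q) (alphaB s Q).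
Proof.
move=> z dz'; rewrite alphaAE alphaBE; apply: amx_bmx_skew.
- by rewrite /q /p cJM cJV S_conj S_dzbar // cJK.
- by rewrite /d /c cJM cJV cJX cJK S_conj.
- exact: S_conj.
Qed.

(** The left side is twice the mixed derivative of the logarithm of [S]: this is the Gauss equation
    written in terms of [S^2 = e^u h / 2]. *)
Definition gaussS z := 2 * ((S z)^-1 * dzbar (dz S) z - S z ^- 2 * dz S z * dzbar S z)
  = S z ^+ 2 + Q z * (Q z)^* * S z ^- 4.

Lemma alpha_deriv z : disc z ->
  entrywise dzbar (alphaA s Q) z =
    amx ((S z)^-1 * dzbar (dz S) z - S z ^- 2 * dz S z * dzbar S z)
        (dzbar Q z * S z ^- 2 - 2 * c z * q z) (dzbar S z) /\
  entrywise dz (alphaB s Q) z =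
    bmx ((S z)^-1 * dzbar (dz S) z - S z ^- 2 * dz S z * dzbar S z)
        ((dzbar Q z)^* * S z ^- 2 - 2 * p z * d z) (dz S z).
Proof.
move=> dz'; have S0 := S_neq0 dz'.
have wS : wd S z (dz S z) (dzbar S z) := smooth_wd s_smooth dz'.
have wQ := smooth_wd Q_smooth dz'.
have wV := wdV S0 wS.
have wSz : wd (dz S) z (dz (dz S) z) (dzbar (dz S) z) := smooth_wd (smooth_dz s_smooth) dz'.
have wSb : wd (dzbar S) z (dz (dzbar S) z) (dzbar (dzbar S) z) :=
  smooth_wd (smooth_dzbar s_smooth) dz'.
have wp := wdM wV wSz; have wq := wdM wV wSb.
have S20 : S z ^+ 2 != 0 by rewrite expf_neq0.
have wS2 : wd (fun w => S w ^+ 2) z (2 * S z * dz S z) (2 * S z * dzbar S z).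
  by apply: wd_eq (wdM wS wS) _ _; ring.
have wV2 := @wdV _ (fun w => S w ^+ 2) z _ _ S20 wS2.
have wc := wdM wQ wV2; have wd' := wdM (wdJ wQ) wV2.
have [_ ->] := mwd_entrywise (wd_amx wp wc wS).
have [-> _] := mwd_entrywise (wd_bmx wq wd' wS).
have -> : dz (dzbar S) z = dzbar (dz S) z by exact: dz_dzbar s_smooth dz'.
rewrite /c /d /p /q; move: (dz S z) (dzbar S z) (dzbar (dz S) z) (dzbar Q z) (Q z).
by move=> x y w k l; split; congr (_ _ _ _); field.
Qed.

Lemma flat_alpha : (forall z, disc z -> dzbar Q z = 0) -> (forall z, disc z -> gaussS z) ->
  forall z, disc z -> entrywise dzbar (alphaA s Q) z - entrywise dz (alphaB s Q) z =
    alphaA s Q z *m alphaB s Q z - alphaB s Q z *m alphaA s Q z.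
Proof.
move=> hQ hG z dz'; have S0 := S_neq0 dz'.
have [-> ->] := alpha_deriv dz'; rewrite alphaAE alphaBE hQ // cJ0 !mul0r !sub0r.
apply: amx_bmx_flat => //.
- have := hG z dz'; rewrite /gaussS => h.
  by rewrite -mulr2n -mulr_natl h /c /d; field.
- by rewrite /q; move: (dzbar S z) => x; field.
- by rewrite /p; move: (dz S z) => x; field.
Qed.

Lemma flat_alpha_inv z : disc z ->
  entrywise dzbar (alphaA s Q) z - entrywise dz (alphaB s Q) z =
    alphaA s Q z *m alphaB s Q z - alphaB s Q z *m alphaA s Q z ->
  dzbar Q z = 0 /\ gaussS z.
Proof.
move=> dz'; have S0 := S_neq0 dz'.
have [-> ->] := alpha_deriv dz'; rewrite alphaAE alphaBE => H.
(* Entry (1, 0) isolates the [dzbar] derivative of [Q], entry (0, 0) the Gauss equation. *)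
have := congr1 (fun M : 'M[R[i]]_3 => M 1 0) H; have := congr1 (fun M : 'M[R[i]]_3 => M 0 0) H.
rewrite !mxE !sum3E !mxE /= => h1 h2; split; last first.
  rewrite /gaussS mulr_natl mulr2n -[X in _ + X]opprK h1 /c /d; move: (p z) (q z) (Q z) => x y k.
  by field.
have : dzbar Q z * S z ^- 2 = 0.
  transitivity (- (- (dzbar Q z / S z ^+ 2 - 2 * c z * q z) - 0) + 2 * c z * q z); first by ring.
  by rewrite h2; ring.
by move/eqP; rewrite mulf_eq0 invr_eq0 expf_eq0 (negbTE S0) /= orbF => /eqP.
Qed.

Lemma frame_sol F : frame s Q F -> sol (alphaA s Q) (alphaB s Q) F.
Proof.
move=> [sF uF dF] z dz'; have [<- <-] := dF z dz'.
have u := SU21_unit (uF z dz').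
by rewrite !mulKVmx //; exact: smooth_mwd.
Qed.

Lemma sol_frame F : sol (alphaA s Q) (alphaB s Q) F ->
  (forall z, disc z -> SU21 (F z)) -> frame s Q F.
Proof.
move=> hF uF; split=> // [|z dz'].
  exact (smooth_frame smooth_alphaA smooth_alphaB hF).
have [-> ->] := mwd_entrywise (hF z dz').
by rewrite !mulKmx // SU21_unit //; exact: uF.
Qed.

Lemma sol_SU21 F : sol (alphaA s Q) (alphaB s Q) F -> SU21 (F 0) ->
  forall z, disc z -> SU21 (F z).
Proof.
move=> hF /SU21P[u0 d0] z dz'; apply/SU21P; split.
  exact: sol_U21 skew_alpha hF u0 z dz'.
rewrite (sol_det _ _ hF dz') // => w _; [exact: tr_amx|exact: tr_bmx].
Qed.

Lemma frame_exists : (forall z, disc z -> dzbar Q z = 0) ->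
  (forall z, disc z -> gaussS z) -> exists F, frame s Q F.
Proof.
move=> hQ hG.
have [F [_ F0 dF]] := flat_integrable smooth_alphaA smooth_alphaB (flat_alpha hQ hG).
exists F; apply: sol_frame => //; apply: sol_SU21 => //; rewrite F0.
by split; [move=> u v; rewrite !mul1mx|exact: det1].
Qed.

Lemma frame_unique F G : frame s Q F -> frame s Q G ->
  exists2 P, SU21 P & forall z, disc z -> G z = P *m F z.
Proof.
move=> hF hG; have [_ uF _] := hF; have [_ uG _] := hG.
have [||P uP h] := sol_unique skew_alpha (frame_sol hF) (frame_sol hG).
- by move=> z /uF/SU21P[].
- by move=> z /uG/SU21P[].
exists P => //; apply/SU21P; split=> //.
have /SU21P[_ dF0] := uF 0 disc0; have /SU21P[_ dG0] := uG 0 disc0.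
by have := congr1 (@determinant _ _) (h 0 disc0); rewrite dG0 det_mulmx dF0 mulr1.
Qed.

Lemma frame_mul P F : SU21 P -> frame s Q F -> frame s Q (fun z => P *m F z).
Proof.
move=> hP hF; apply: sol_frame => z dz'; last first.
  by have [_ uF _] := hF; apply: SU21M => //; exact: uF.
by apply: mwd_eq (mwdMl P (frame_sol hF dz')) _ _; rewrite mulmxA.
Qed.
End Coefficients.

(** * The Gauss equation *)

Section Gauss.
Context (h u : R[i] -> R) (Q : R[i] -> R[i]).
Hypothesis h_gt0 : forall z, disc z -> 0 < h z.
Hypothesis h_smooth : smooth (fun z => (h z)%:C).
Hypothesis u_smooth : smooth (fun z => (u z)%:C).

Let s := s_of h u.

Lemma lam_gt0 z : disc z -> 0 < expR (u z) * h z / 2.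
Proof. by move=> /h_gt0 h0; rewrite divr_gt0 // mulr_gt0 // expR_gt0. Qed.
Lemma s_of_gt0 z : disc z -> 0 < s z.
Proof. by move=> dz'; rewrite sqrtr_gt0 lam_gt0. Qed.
Lemma s_of_sqr z : disc z -> s z ^+ 2 = expR (u z) * h z / 2.
Proof. by move=> dz'; rewrite sqr_sqrtr // ltW // lam_gt0. Qed.
Lemma s_of_smooth : smooth (fun z => (s z)%:C).
Proof.
apply: smooth_sqrt => [z dz'|]; first exact: lam_gt0.
apply: smooth_eq (smoothM (smoothM (smooth_expR u_smooth) h_smooth) (smooth_cst 2^-1)) => z _.
by rewrite !rmorphM fmorphV rmorph_nat.
Qed.

(** Since [2 ln s = u + ln h - ln 2], the Laplacian of [u] and the curvature of [h] combine into the
    mixed derivative of [ln s]. The two equations then differ by the factor [h / 4]. *)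
Lemma gauss_equivS z : disc z ->
  laplacian h u z - 16%:R * cubic_norm2 h Q z * (expR (- 2%:R * u z))%:C
    - 2%:R * (expR (u z))%:C - 2%:R * gauss_curvature h z = 0 <-> gaussS s Q z.
Proof.
move=> dz'.
pose S z := (s z)%:C; pose T z := (ln (s z))%:C.
have sS : smooth S := s_of_smooth.
have S0 w : disc w -> S w != 0 := S_neq0 s_of_gt0 (z := w).
have lE w : disc w -> T w = 2^-1 * ((u w)%:C + (ln (h w))%:C - (ln (2:R))%:C).
  move=> dw; have e := s_of_sqr dw.
  have : 2 * ln (s w) = u w + ln (h w) - ln 2.
    have -> : 2 * ln (s w) = ln (s w ^+ 2) by rewrite lnXn ?s_of_gt0 // mulr_natl.
    rewrite e lnM ?posrE ?mulr_gt0 ?expR_gt0 ?invr_gt0 ?h_gt0 //.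
    by rewrite lnM ?posrE ?expR_gt0 ?h_gt0 // expRK lnV ?posrE.
  move=> e2; have -> : (u w)%:C + (ln (h w))%:C - (ln (2:R))%:C = (2 * ln (s w))%:C.
    by rewrite e2 rmorphB rmorphD.
  by rewrite rmorphM /= (rmorph_nat _ 2) mulKf ?two_neq0.
have sT : smooth T := smooth_ln s_of_gt0 sS.
have slh := smooth_ln h_gt0 h_smooth.
have dTb w : disc w -> dzbar T w = (S w)^-1 * dzbar S w.
  move=> dw; have H := is_derive_wd (is_derive1_ln (s_of_gt0 dw)) (smooth_wd sS dw).
  by rewrite /T (wd_dzbar H) fmorphV.
have e1 : dz (dzbar T) z = (S z)^-1 * dzbar (dz S) z - S z ^- 2 * dz S z * dzbar S z.
  rewrite (dz_eq dTb (smooth_dzbar sT) dz').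
  have H := wdM (wdV (S0 z dz') (smooth_wd sS dz')) (smooth_wd (smooth_dzbar sS) dz').
  rewrite (wd_dz H) (dz_dzbar sS dz').
  by move: (dz S z) (dzbar S z) (dzbar _ _) => x y w; field; exact: S0.
have e2 : dz (dzbar T) z = 2^-1 * (dz (dzbar (fun w => (u w)%:C)) z +
    dz (dzbar (fun w => (ln (h w))%:C)) z).
  have H w : disc w -> dzbar T w = 2^-1 * (dzbar (fun w => (u w)%:C) w +
     dzbar (fun w => (ln (h w))%:C) w).
    move=> dw; rewrite (dzbar_eq lE sT dw).
    rewrite (wd_dzbar (wdZ _ (wdB (wdD (smooth_wd u_smooth dw) (smooth_wd slh dw)) (wd_cst _ _)))).
    by rewrite subr0.
  rewrite (dz_eq H (smooth_dzbar sT) dz').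
  by rewrite (wd_dz (wdZ _ (wdD (smooth_wd (smooth_dzbar u_smooth) dz')
     (smooth_wd (smooth_dzbar slh) dz')))).
rewrite /gaussS -/S -e1 e2 /gauss_curvature /laplacian /cubic_norm2.
move: (dz (dzbar _) z) (dz (dzbar _) z) => X Y.
have E : S z ^+ 2 = (expR (u z))%:C * (h z)%:C / 2.
  by rewrite -rmorphXn s_of_sqr // !rmorphM fmorphV rmorph_nat.
have -> : S z ^- 4 = (S z ^+ 2 * S z ^+ 2)^-1 by rewrite -exprD.
have eE : (expR (- 2%:R * u z))%:C = ((expR (u z))%:C * (expR (u z))%:C)^-1.
  have -> : expR (- 2%:R * u z) = (expR (u z) * expR (u z))^-1.
    by rewrite mulNr expRN -expRD -mulr2n mulr_natl.
  by rewrite fmorphV rmorphM.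
rewrite E normCK eE.
have hn : (h z)%:C != 0 by rewrite eq_complex /= eqxx andbT gt_eqF ?h_gt0.
have en : (expR (u z))%:C != 0 by rewrite eq_complex /= eqxx andbT gt_eqF ?expR_gt0.
move: ((h z)%:C) ((expR (u z))%:C) (Q z) hn en => H e q0 hn en.
split=> [/(congr1 (fun x => x * H / 4))|/(congr1 (fun x => x * 4 / H))] K.
  apply/eqP; rewrite -subr_eq0; apply/eqP; rewrite mul0r mul0r in K; rewrite -[RHS]K.
  by field; rewrite hn en.
move/eqP: K; rewrite -subr_eq0 => /eqP K; rewrite -[RHS]K.
by field; rewrite hn en.
Qed.
End Gauss.
End Alpha.

(** * Lifts to the hyperquadric and changes of phase *)

Section Lifts.
Context {R : realType}.
Implicit Types (f : R[i] -> 'cV[R[i]]_3) (z x y : R[i]).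

Lemma hermDl (u v w : 'cV[R[i]]_3) : herm (u + v) w = herm u w + herm v w.
Proof. by rewrite /herm !mxE; ring. Qed.
Lemma hermZl x (u v : 'cV[R[i]]_3) : herm (x *: u) v = x * herm u v.
Proof. by rewrite /herm !mxE; ring. Qed.
Lemma hermDr (u v w : 'cV[R[i]]_3) : herm u (v + w) = herm u v + herm u w.
Proof. by rewrite /herm !mxE !cJE; ring. Qed.
Lemma hermZr x (u v : 'cV[R[i]]_3) : herm u (x *: v) = x^* * herm u v.
Proof. by rewrite /herm !mxE !cJE; ring. Qed.
Lemma herm_sym (u v : 'cV[R[i]]_3) : herm v u = (herm u v)^*.
Proof. by rewrite /herm !cJE; ring. Qed.
Lemma hermNl (u v : 'cV[R[i]]_3) : herm (- u) v = - herm u v.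
Proof. by rewrite -scaleN1r hermZl mulN1r. Qed.
Lemma hermNr (u v : 'cV[R[i]]_3) : herm u (- v) = - herm u v.
Proof. by rewrite -scaleN1r hermZr cJN cJ1 mulN1r. Qed.
Lemma herm0l (v : 'cV[R[i]]_3) : herm 0 v = 0.
Proof. by rewrite -(scale0r 0) hermZl mul0r. Qed.
Lemma herm0r (v : 'cV[R[i]]_3) : herm v 0 = 0.
Proof. by rewrite herm_sym herm0l cJ0. Qed.
Lemma herm_comb (a b c d : R[i]) (u v : 'cV[R[i]]_3) :
  herm (a *: u + b *: v) (c *: u + d *: v) =
  a * c^* * herm u u + a * d^* * herm u v + b * c^* * herm v u + b * d^* * herm v v.
Proof. by rewrite !hermDl !hermDr !hermZl !hermZr; ring. Qed.
Definition hermE := (hermDl, hermDr, hermNl, hermNr, hermZl, hermZr, @herm0l, @herm0r).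

Lemma wd_herm f g z a b c d : mwd f z a b -> mwd g z c d ->
  wd (fun w => herm (f w) (g w)) z (herm a (g z) + herm (f z) d) (herm b (g z) + herm (f z) c).
Proof.
move=> hf hg; have t i := wdM (hf i 0) (wdJ (hg i 0)).
apply: wd_eq (wdB (wdD (t 0) (t 1)) (t 2%:R)) _ _; rewrite /herm; ring.
Qed.

Lemma smooth_herm f g : smooth_mx f -> smooth_mx g -> smooth (fun w => herm (f w) (g w)).
Proof.
move=> hf hg; have t i := smoothM (hf i 0) (smoothJ (hg i 0)).
exact: smoothB (smoothD (t 0) (t 1)) (t 2%:R).
Qed.

Lemma herm_self_real (u : 'cV[R[i]]_3) : (herm u u)^* = herm u u. Proof. by rewrite -herm_sym. Qed.

(* By Cauchy-Schwarz in [C^2], [|u3|^2 herm v v >= |v1|^2 + |v2|^2]. *)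
Lemma herm_posdef (u v : 'cV[R[i]]_3) : herm u u = -1 -> herm v u = 0 ->
  0 <= complex.Re (herm v v) /\ (complex.Re (herm v v) = 0 -> v = 0).
Proof.
rewrite /herm.
set a := u 0 0; set b := u 1 0; set c := u 2%:R 0.
set x := v 0 0; set y := v 1 0; set w := v 2%:R 0 => hu hv.
have sq (t : R[i]) : t * t^* = (cabs t ^+ 2)%:C by rewrite -normCK cabsE rmorphXn.
have e1 : cabs c ^+ 2 = cabs a ^+ 2 + cabs b ^+ 2 + 1.
  move: hu; rewrite !sq -rmorphD -rmorphB => /(congr1 (@complex.Re _)) /=; lra.
have e2 : w * c^* = x * a^* + y * b^* by move/eqP: hv; rewrite subr_eq0 => /eqP.
have e3 : cabs w * cabs c <= cabs x * cabs a + cabs y * cabs b.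
  have cJ (t : R[i]) : cabs t^* = cabs t.
    by apply: complexI; rewrite -!cabsE norm_conjC.
  rewrite -(cJ c) -(cJ a) -(cJ b) -!cabsM e2; exact: cabsD.
have eR : complex.Re (x * x^* + y * y^* - w * w^*) = cabs x ^+ 2 + cabs y ^+ 2 - cabs w ^+ 2.
  by rewrite !sq -rmorphD -rmorphB.
rewrite eR.
have := cabs_ge0 a; have := cabs_ge0 b; have := cabs_ge0 c; have := cabs_ge0 x.
have := cabs_ge0 y; have := cabs_ge0 w.
move: e1 e3; set A := cabs a; set B := cabs b; set C := cabs c.
set X := cabs x; set Y := cabs y; set W := cabs w => e1 e3 W0 Y0 X0 C0 B0 A0.
have key : X ^+ 2 + Y ^+ 2 <= C ^+ 2 * (X ^+ 2 + Y ^+ 2 - W ^+ 2).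
  have h1 : (W * C) ^+ 2 <= (X * A + Y * B) ^+ 2.
    by rewrite ler_pXn2r ?nnegrE ?addr_ge0 ?mulr_ge0.
  have h2 : (X * A + Y * B) ^+ 2 <= (X ^+ 2 + Y ^+ 2) * (A ^+ 2 + B ^+ 2).
    rewrite -subr_ge0 (_ : _ - _ = (X * B - Y * A) ^+ 2) ?sqr_ge0 //; ring.
  have h3 : A ^+ 2 + B ^+ 2 = C ^+ 2 - 1 by lra.
  rewrite h3 in h2; have := le_trans h1 h2; rewrite exprMn; lra.
have C1 : 0 < C ^+ 2 by have := sqr_ge0 A; have := sqr_ge0 B; lra.
split.
  by rewrite -(pmulr_rge0 _ C1); have := sqr_ge0 X; have := sqr_ge0 Y; lra.
move=> h0; rewrite h0 mulr0 in key.
have X2 : X ^+ 2 = 0 by have := sqr_ge0 X; have := sqr_ge0 Y; lra.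
have Y2 : Y ^+ 2 = 0 by have := sqr_ge0 X; have := sqr_ge0 Y; lra.
have W2 : W ^+ 2 = 0 by lra.
have z0 (t : R[i]) : cabs t ^+ 2 = 0 -> t = 0.
  move/eqP; rewrite expf_eq0 /= => /eqP h; apply/eqP.
  by rewrite -normr_eq0 cabsE h.
apply/matrixP => i j; rewrite (ord1 j) mxE.
case: i => [[|[|[|//]]] hi].
- by have -> : Ordinal hi = 0; [exact/val_inj|exact: z0].
- by have -> : Ordinal hi = 1; [exact/val_inj|exact: z0].
- by have -> : Ordinal hi = 2%:R; [exact/val_inj|exact: z0].
Qed.

Lemma entrywise_iter f z : entrywise (fun k => dz (dz (dz k))) f z =
  entrywise dz (entrywise dz (entrywise dz f)) z.
Proof.
apply/matrixP => i j; rewrite !mxE; congr (dz _ z); apply/funext => w; rewrite mxE.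
by congr (dz _ w); apply/funext => t; rewrite mxE.
Qed.

Lemma dphiE f v z a b : mwd f z a b ->
  dphi f v z = v *: a + v^* *: b + herm (v *: a + v^* *: b) (f z) *: f z.
Proof. by move=> h; rewrite /dphi /hor (mwd_pder v h). Qed.

(** * Lifts to the hyperquadric *)

(** Pairing [g = l f] with [f] gives [l = - herm g f], because [herm f f = -1]. This explicit
    formula is what makes the phase smooth. *)
Lemma lift_change phi f g : S_lift phi f -> S_lift phi g ->
  exists c : R[i] -> R[i], [/\ smooth c, forall z, disc z -> c z * (c z)^* = 1 &
    forall z, disc z -> g z = c z *: f z].
Proof.
move=> [sf hf] [sg hg]; exists (fun z => - herm (g z) (f z)).
have e z : disc z -> g z = - herm (g z) (f z) *: f z.
  move=> dz'; have [n1 p1] := hf z dz'; have [n2 p2] := hg z dz'.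
  have : proj_pt (f z) (g z).
    by rewrite p1 -p2; exists 1 => /=; [exact: oner_neq0|rewrite scale1r].
  by case=> l _ <-; rewrite hermZl n1 mulrN1 opprK.
split=> // [|z dz']; first exact: smoothN (smooth_herm sg sf).
have [n1 _] := hf z dz'; have [n2 _] := hg z dz'.
by move: n2; rewrite {1 2}(e z dz') hermZl hermZr n1 mulrN1 mulrN => /eqP; rewrite eqr_opp => /eqP.
Qed.

Lemma S_lift_scale phi f (c : R[i] -> R[i]) : smooth c ->
  (forall z, disc z -> c z * (c z)^* = 1) -> S_lift phi f ->
  S_lift phi (fun z => c z *: f z).
Proof.
move=> sc c1 [sf hf]; split=> [|z dz']; first exact (smooth_mxZ sc sf).
have [n1 p1] := hf z dz'; split.
  by rewrite hermZl hermZr n1 mulrA c1 // mul1r.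
have c0 : c z != 0.
  by apply/eqP => c0; have := c1 z dz'; rewrite c0 mul0r => /esym/eqP; rewrite oner_eq0.
rewrite -p1; apply/seteqP; split=> w [l /= l0 <-].
  by exists (l * c z); rewrite /= ?mulf_neq0 // scalerA.
exists (l / c z); first by rewrite /= mulf_neq0 ?invr_neq0.
by rewrite scalerA divfK.
Qed.

Lemma comb_scale (a b d c : R[i]) (X Y Z : 'cV[R[i]]_3) :
  a *: (c *: X) - b *: (c *: Y) + d *: (c *: Z) = c *: (a *: X - b *: Y + d *: Z).
Proof. by apply/matrixP => i j; rewrite !mxE; ring. Qed.

Section PhaseChange.
Context (f g : R[i] -> 'cV[R[i]]_3) (c : R[i] -> R[i]).
Hypothesis sf : smooth_mx f.
Hypothesis hf : forall z, disc z -> herm (f z) (f z) = -1.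
Hypothesis sc : smooth c.
Hypothesis c1 : forall z, disc z -> c z * (c z)^* = 1.
Hypothesis gE : forall z, disc z -> g z = c z *: f z.

Lemma phase_mwd z : disc z ->
  mwd g z (dz c z *: f z + c z *: entrywise dz f z) (dzbar c z *: f z + c z *: entrywise dzbar f z).
Proof.
move=> dz'; apply: mwd_disc dz' (mwdZ (smooth_wd sc dz') (smooth_mwd sf dz')) => w dw.
by rewrite gE.
Qed.

Lemma phase_D v z : disc z ->
  entrywise (pder v) g z = D c v z *: f z + c z *: entrywise (pder v) f z.
Proof.
move=> dz'; rewrite (mwd_pder v (phase_mwd dz')) (mwd_pder v (smooth_mwd sf dz')).
by rewrite /D !scalerDr !scalerDl !scalerA ![v * _]mulrC ![v^* * _]mulrC addrACA.
Qed.

Lemma phase_herm v z : disc z -> herm (entrywise (pder v) g z) (g z) =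
  - D c v z * (c z)^* + herm (entrywise (pder v) f z) (f z).
Proof.
move=> dz'; rewrite phase_D // gE // !hermE hf //.
move: (herm _ _) => x; have {2}-> : x = c z * (c z)^* * x by rewrite c1 // mul1r.
by move: (D c v z) (c z) => y w; ring.
Qed.

Lemma hor_phase z (w : 'cV[R[i]]_3) : disc z -> hor g z (c z *: w) = c z *: hor f z w.
Proof.
move=> dz'; rewrite /hor gE // hermZl hermZr scalerDr !scalerA.
by rewrite mulrA c1 // mul1r mulrC.
Qed.

Lemma hor_add_f z (w : 'cV[R[i]]_3) x : disc z -> hor f z (x *: f z + w) = hor f z w.
Proof.
by move=> dz'; rewrite /hor !hermE hf // mulrN1 scalerDl scaleNr addrACA subrr add0r.
Qed.

Lemma phase_dphi v z : disc z -> dphi g v z = c z *: dphi f v z.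
Proof.
move=> dz'; rewrite /dphi phase_D // -hor_phase //.
have c0 : c z != 0.
  by apply/eqP => c0; have := c1 dz'; rewrite c0 mul0r => /esym/eqP; rewrite oner_eq0.
set X := entrywise _ f z; rewrite -[X in X *: f z](mulVKf c0) -scalerA -scalerDr hor_phase //.
by rewrite hor_add_f // -hor_phase.
Qed.

Lemma phase_pull_metric z v w : disc z -> pull_metric g z v w = pull_metric f z v w.
Proof.
by move=> dz'; rewrite /pull_metric !phase_dphi // hermZl hermZr mulrA c1 // mul1r.
Qed.

(** Differentiating [c V] produces an extra [(D c) V], while by [phase_herm] the connection term of
    [g] carries [- (D c) c^*]; they cancel because [|c| = 1]. *)
Lemma phase_cov v (V W : R[i] -> 'cV[R[i]]_3) z : smooth_mx V ->
  (forall z, disc z -> W z = c z *: V z) -> disc z ->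
  cov g v W z = c z *: cov f v V z.
Proof.
move=> sV hW dz'; rewrite /cov.
have hW' : mwd W z (dz c z *: V z + c z *: entrywise dz V z)
    (dzbar c z *: V z + c z *: entrywise dzbar V z).
  by apply: mwd_disc dz' (mwdZ (smooth_wd sc dz') (smooth_mwd sV dz')) => w dw; rewrite hW.
rewrite (mwd_pder v hW') phase_herm // hW // (mwd_pder v (smooth_mwd sV dz')) -hor_phase //.
congr (hor g z _).
have e : - D c v z * (c z)^* * c z = - D c v z by rewrite -mulrA [_^* * _]mulrC c1 // mulr1.
rewrite [(_ + _) *: (c z *: _)]scalerA mulrDl e /D; apply/matrixP => i j; rewrite !mxE.
by move: (herm _ _) (dz c z) (dzbar c z) (c z) (V z i j) (dz _ z) (dzbar _ z) => *; ring.
Qed.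

Lemma smooth_dphi v : smooth_mx (dphi f v).
Proof.
have sv : smooth_mx (entrywise (pder v) f).
  apply: (@smooth_mx_eq _ _ _ (fun z => v *: entrywise dz f z + v^* *: entrywise dzbar f z)).
    by move=> z dz'; rewrite (mwd_pder v (smooth_mwd sf dz')).
  exact (smooth_mxD (smooth_mxZ (smooth_cst v) (smooth_mx_dz sf))
    (smooth_mxZ (smooth_cst v^*) (smooth_mx_dzbar sf))).
exact (smooth_mxD sv (smooth_mxZ (smooth_herm sv sf) sf)).
Qed.

Lemma phase_trace_hessian z : disc z -> trace_hessian g z = c z *: trace_hessian f z.
Proof.
move=> dz'; rewrite /trace_hessian !phase_pull_metric //.
rewrite !(phase_cov _ (smooth_dphi _) (phase_dphi _)) //.
exact: comb_scale.
Qed.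
End PhaseChange.
End Lifts.

(** * Structure equations of a horizontal lift *)
Section Horizontal.
Context {R : realType}.
Implicit Types (f : R[i] -> 'cV[R[i]]_3) (z v w : R[i]).

Lemma entrywise_comm m n (F : R[i] -> 'M[R[i]]_(m, n)) z : smooth_mx F -> disc z ->
  entrywise dz (entrywise dzbar F) z = entrywise dzbar (entrywise dz F) z.
Proof.
move=> sF dz'; apply/matrixP => i j; rewrite !mxE.
have -> : (fun w => entrywise dzbar F w i j) = dzbar (fun w => F w i j).
  by apply/funext => w; rewrite mxE.
have -> : (fun w => entrywise dz F w i j) = dz (fun w => F w i j).
  by apply/funext => w; rewrite mxE.
exact: dz_dzbar (sF i j) dz'.
Qed.

(** The two mixed derivatives of [F], each computed from the system, coincide; their difference is
    the flatness equation multiplied by the invertible matrix [F]. *)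
Lemma sol_flat (A B F : R[i] -> 'M[R[i]]_3) z : smooth_mx A -> smooth_mx B ->
  sol A B F -> disc z -> F z \in unitmx ->
  entrywise dzbar A z - entrywise dz B z = A z *m B z - B z *m A z.
Proof.
move=> sA sB hF dz' uF.
have sF : smooth_mx F by exact (smooth_frame sA sB hF).
have hA w : disc w -> F w *m A w = entrywise dz F w by move=> /hF/mwd_entrywise[-> _].
have hB w : disc w -> F w *m B w = entrywise dzbar F w by move=> /hF/mwd_entrywise[_ ->].
have [_ e1] := mwd_entrywise (mwd_disc hA dz' (mwdM (hF z dz') (smooth_mwd sA dz'))).
have [e2 _] := mwd_entrywise (mwd_disc hB dz' (mwdM (hF z dz') (smooth_mwd sB dz'))).
have := entrywise_comm sF dz'; rewrite e1 e2 => e.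
apply: (can_inj (mulKmx uF)); rewrite !mulmxBr !mulmxA.
move: e; move: (_ *m _) (_ *m _) (_ *m _) (_ *m _) => p1 p2 p3 p4 /eqP.
rewrite -subr_eq => /eqP <-; apply/matrixP => i j; rewrite !mxE; ring.
Qed.

Lemma herm_cst_deriv (g1 g2 : R[i] -> 'cV[R[i]]_3) k z a b c d : disc z ->
  (forall w, disc w -> herm (g1 w) (g2 w) = k) -> mwd g1 z a b -> mwd g2 z c d ->
  herm a (g2 z) + herm (g1 z) d = 0 /\ herm b (g2 z) + herm (g1 z) c = 0.
Proof.
move=> dz' h h1 h2; have H := wd_herm h1 h2.
have h' : forall w, disc w -> k = herm (g1 w) (g2 w) by move=> w /h ->.
exact: wd_unique H (wd_disc h' dz' (wd_cst k z)).
Qed.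

(** Second derivatives in the directions 1 and [I] add up to the Laplacian, four times the mixed
    Wirtinger derivative [Y]; the pure ones cancel since [I * I = -1]. *)
Lemma laplace_sum (I : R[i]) (X Y W : 'cV[R[i]]_3) : I * I = -1 ->
  1 *: (1 *: X + 1 *: Y) + 1 *: (1 *: Y + 1 *: W) +
  (I *: (I *: X + (- I) *: Y) + (- I) *: (I *: Y + (- I) *: W)) = 4 *: Y.
Proof.
move=> II; apply/matrixP => i j; rewrite !mxE.
move: (X i j) (Y i j) (W i j) => x y w.
transitivity (x + y + y + w + (I * I) * (x - 2 * y + w)); first by ring.
by rewrite II; ring.
Qed.

Lemma det_ctr (F : 'M[R[i]]_3) : \det (ctr F) = (\det F)^*.
Proof.
have -> : ctr F = (map_mx Num.conj F)^T by apply/matrixP => i j; rewrite !mxE.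
by rewrite det_tr det_map_mx.
Qed.

Lemma ord3P (P : 'I_3 -> Prop) : P 0 -> P 1 -> P 2%:R -> forall i, P i.
Proof.
move=> h0 h1 h2 [[|[|[|//]]] hi].
- by rewrite (_ : Ordinal hi = 0) //; exact/val_inj.
- by rewrite (_ : Ordinal hi = 1) //; exact/val_inj.
- by rewrite (_ : Ordinal hi = 2%:R) //; exact/val_inj.
Qed.

Definition mat3 (a b c : 'cV[R[i]]_3) : 'M[R[i]]_3 :=
  \matrix_(i, j) nth 0 [:: a i 0; b i 0; c i 0] j.

Lemma col_mat3 a b c :
  [/\ col 0 (mat3 a b c) = a, col 1 (mat3 a b c) = b & col 2%:R (mat3 a b c) = c].
Proof. by split; apply/matrixP => i j; rewrite !mxE (ord1 j). Qed.

Lemma mwd_mat3 (a b c : R[i] -> 'cV[R[i]]_3) z a1 a2 b1 b2 c1 c2 :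
  mwd a z a1 a2 -> mwd b z b1 b2 -> mwd c z c1 c2 ->
  mwd (fun w => mat3 (a w) (b w) (c w)) z (mat3 a1 b1 c1) (mat3 a2 b2 c2).
Proof.
move=> ha hb hc i j; rewrite !mxE.
apply: (wd_ext (f := fun w => nth 0 [:: a w i 0; b w i 0; c w i 0] j)) => [w|].
  by rewrite mxE.
elim/ord3P: j => /=; [exact: ha|exact: hb|exact: hc].
Qed.

Lemma mat3_amx (a b c : 'cV[R[i]]_3) (p k S : R[i]) :
  mat3 a b c *m amx p k S = mat3 (p *: a - k *: b) (S *: c - p *: b) (S *: a).
Proof.
apply/matrixP => i j; rewrite !mxE !sum3E !mxE.
by elim/ord3P: j; rewrite /= ?mxE; ring.
Qed.
Lemma mat3_bmx (a b c : 'cV[R[i]]_3) (q d S : R[i]) :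
  mat3 a b c *m bmx q d S = mat3 (S *: c - q *: a) (d *: a + q *: b) (S *: b).
Proof.
apply/matrixP => i j; rewrite !mxE !sum3E !mxE.
by elim/ord3P: j; rewrite /= ?mxE; ring.
Qed.

Section HorizontalLift.
Context (f : R[i] -> 'cV[R[i]]_3).
Hypothesis sf : smooth_mx f.
Hypothesis ff : forall z, disc z -> herm (f z) (f z) = -1.
Hypothesis hz : forall z, disc z -> herm (entrywise dz f z) (f z) = 0.
Hypothesis hb : forall z, disc z -> herm (entrywise dzbar f z) (f z) = 0.

Let fz := entrywise dz f.
Let fb := entrywise dzbar f.
Let fzz := entrywise dz fz.
Let fzb := entrywise dzbar fz.
Let fbb := entrywise dzbar fb.

Lemma hl_wf z : disc z -> mwd f z (fz z) (fb z).
Proof. exact: smooth_mwd. Qed.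
Lemma hl_sfz : smooth_mx fz. Proof. exact (smooth_mx_dz sf). Qed.
Lemma hl_sfb : smooth_mx fb. Proof. exact (smooth_mx_dzbar sf). Qed.
Lemma hl_wfz z : disc z -> mwd fz z (fzz z) (fzb z).
Proof. exact: smooth_mwd hl_sfz. Qed.
Lemma hl_wfb z : disc z -> mwd fb z (fzb z) (fbb z).
Proof.
by move=> dz'; rewrite /fzb -(entrywise_comm sf dz'); apply: smooth_mwd dz'; exact hl_sfb.
Qed.

(** All four come from differentiating the horizontality conditions. The mixed derivative is reached
    in two ways, which forces [fz] and [fb] to have the same norm: this is how horizontality
    contains the Lagrangian condition. *)
Lemma hl_rel z : disc z ->
  [/\ herm (fzz z) (f z) = - herm (fz z) (fb z), herm (fzb z) (f z) = - herm (fz z) (fz z),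
      herm (fzb z) (f z) = - herm (fb z) (fb z) & herm (fbb z) (f z) = - herm (fb z) (fz z)].
Proof.
move=> dz'.
have [/eqP e1 /eqP e2] := herm_cst_deriv dz' hz (hl_wfz dz') (hl_wf dz').
have [/eqP e3 /eqP e4] := herm_cst_deriv dz' hb (hl_wfb dz') (hl_wf dz').
by split; apply/eqP; rewrite -addr_eq0.
Qed.

Lemma hl_pder v z : disc z -> entrywise (pder v) f z = v *: fz z + v^* *: fb z.
Proof. by move=> dz'; exact: mwd_pder (hl_wf dz'). Qed.

Lemma hl_herm_pder v z : disc z -> herm (entrywise (pder v) f z) (f z) = 0.
Proof.
by move=> dz'; rewrite hl_pder // hermDl !hermZl hz // hb // !mulr0 addr0.
Qed.

Lemma hl_dphi v z : disc z -> dphi f v z = v *: fz z + v^* *: fb z.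
Proof.
by move=> dz'; rewrite /dphi /hor hl_herm_pder // scale0r addr0 hl_pder.
Qed.

Lemma hl_dphi_herm v w z : disc z -> herm (dphi f v z) (dphi f w z) =
  v * w^* * herm (fz z) (fz z) + v * w * herm (fz z) (fb z) +
  v^* * w^* * herm (fb z) (fz z) + v^* * w * herm (fb z) (fb z).
Proof. by move=> dz'; rewrite (hl_dphi v dz') (hl_dphi w dz') herm_comb cJK. Qed.

Lemma hl_cov0 v V z : disc z -> cov f v V z = hor f z (entrywise (pder v) V z).
Proof. by move=> dz'; rewrite /cov (hl_herm_pder v dz') scale0r addr0. Qed.

Lemma hl_cov v z : disc z -> cov f v (dphi f v) z =
  hor f z (v *: (v *: fzz z + v^* *: fzb z) + v^* *: (v *: fzb z + v^* *: fbb z)).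
Proof.
move=> dz'; rewrite hl_cov0 //; congr (hor f z _); apply: mwd_pder.
apply: (mwd_disc (F := fun w => v *: fz w + v^* *: fb w)) => [w dw||] //.
  by rewrite hl_dphi.
exact: mwdD (mwdZl v (hl_wfz dz')) (mwdZl v^* (hl_wfb dz')).
Qed.

Lemma horD z (a b : 'cV[R[i]]_3) : hor f z (a + b) = hor f z a + hor f z b.
Proof. by rewrite /hor hermDl scalerDl addrACA. Qed.
Lemma horZ z k (a : 'cV[R[i]]_3) : hor f z (k *: a) = k *: hor f z a.
Proof. by rewrite /hor hermZl scalerDr scalerA. Qed.

Lemma hl_trace_hessian z (l : R) : disc z ->
  pull_metric f z 1 1 = l -> pull_metric f z 'i%C 'i%C = l -> pull_metric f z 1 'i%C = 0 ->
  trace_hessian f z = (4 * l%:C) *: hor f z (fzb z).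
Proof.
move=> dz' e1 e2 e3; rewrite /trace_hessian e1 e2 e3 mulr0 scale0r subr0 -scalerDr !hl_cov //.
have i_conj : ('i%C : R[i])^* = - 'i%C by exact: conj_i.
rewrite -horD i_conj cJ1 (laplace_sum _ _ _ (mul_ii (R := R))) horZ scalerA.
by congr (_ *: _); rewrite mulrC.
Qed.

(** [herm fzz f] vanishes by conformality; differentiating it moves one derivative to the right
    factor, where conjugation turns [dz] into [dzbar]. The cubic differential thus becomes a
    component of [fzz] in the moving frame. *)
Lemma hl_cubic z : disc z -> (forall w, disc w -> herm (fz w) (fb w) = 0) ->
  herm (entrywise (fun k => dz (dz (dz k))) f z) (f z) = - herm (fzz z) (fb z).
Proof.
move=> dz' h0; rewrite entrywise_iter -/fz -/fzz.
have h w : disc w -> herm (fzz w) (f w) = 0 by move=> /[dup] /hl_rel[-> _ _ _] /h0 ->; rewrite oppr0.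
have sfzz : smooth_mx fzz by exact (smooth_mx_dz hl_sfz).
have [/eqP e _] := herm_cst_deriv dz' h (smooth_mwd sfzz dz') (hl_wf dz').
by apply/eqP; rewrite -addr_eq0.
Qed.

Section Structure.
Context (s : R[i] -> R) (Q : R[i] -> R[i]).
Hypothesis s_gt0 : forall z, disc z -> 0 < s z.
Hypothesis s_smooth : smooth (fun z => (s z)%:C).
Hypothesis met : forall z v w, disc z ->
  pull_metric f z v w = 2 * s z ^+ 2 * complex.Re (v * w^*).
Hypothesis mini : forall z n, disc z -> herm n (f z) = 0 ->
  (forall v, complex.Re (herm n (dphi f v z)) = 0) ->
  complex.Re (herm (trace_hessian f z) n) = 0.
Hypothesis QE : forall z, disc z ->
  Q z = herm (entrywise (fun k => dz (dz (dz k))) f z) (f z).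

Let S z := (s z)%:C.

(** Horizontality makes the two norms equal; the metric on the pairs (1, 1), ('i, 'i), (1, 'i) then
    determines the common norm and kills [herm fz fb]. *)
Lemma hl_metric z : disc z ->
  [/\ herm (fz z) (fz z) = S z ^+ 2, herm (fb z) (fb z) = S z ^+ 2 & herm (fz z) (fb z) = 0].
Proof.
move=> dz'; have [_ r2 r3 _] := hl_rel dz'.
have eab : herm (fb z) (fb z) = herm (fz z) (fz z).
  by apply: oppr_inj; rewrite -r3 r2.
have := met 1 1 dz'; have := met 'i%C 'i%C dz'; have := met 1 'i%C dz'.
rewrite /pull_metric !(hl_dphi_herm _ _ dz') eab (herm_sym (fz z) (fb z)).
have := herm_self_real (fz z).
case: (herm (fz z) (fz z)) => a a'; case: (herm (fz z) (fb z)) => x y.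
rewrite !conjcE /= => -[ha] h1 h2 h3.
have a0 : a' = 0 by lra.
have x0 : x = 0 by lra.
have y0 : y = 0 by lra.
have aE : a = s z ^+ 2 by lra.
by rewrite a0 x0 y0 aE /S -rmorphXn.
Qed.

Definition hframe z : 'M[R[i]]_3 := mat3 ((S z)^-1 *: fz z) ((S z)^-1 *: fb z) (f z).

Lemma hS_neq0 z : disc z -> S z != 0. Proof. exact: S_neq0. Qed.

Lemma hframe_U21 z : disc z -> U21 (hframe z).
Proof.
move=> dz'; apply: ctr_U21; have S0 := hS_neq0 dz'; have SJ := S_conj s z.
have [m1 m2 m3] := hl_metric dz'.
have [c0 c1 c2] := col_mat3 ((S z)^-1 *: fz z) ((S z)^-1 *: fb z) (f z).
have m4 : herm (fb z) (fz z) = 0 by rewrite herm_sym m3 cJ0.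
have z1 := hz dz'; have z2 := hb dz'.
have z3 : herm (f z) (fz z) = 0 by rewrite herm_sym z1 cJ0.
have z4 : herm (f z) (fb z) = 0 by rewrite herm_sym z2 cJ0.
have z5 := ff dz'.
apply/matrixP; elim/ord3P; elim/ord3P; rewrite ctr_herm /hframe ?c0 ?c1 ?c2
  ?hermZl ?hermZr ?m1 ?m2 ?m3 ?m4 ?z1 ?z2 ?z3 ?z4 ?z5 ?mulr0 ?cJV ?SJ !mxE //=; by field.
Qed.

Lemma hframe_eq z (v w : 'cV[R[i]]_3) : disc z -> herm v (fz z) = herm w (fz z) ->
  herm v (fb z) = herm w (fb z) -> herm v (f z) = herm w (f z) -> v = w.
Proof.
move=> dz' h1 h2 h3; apply/eqP; rewrite -subr_eq0; apply/eqP.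
apply: (U21_nondeg (hframe_U21 dz')).
have [c0 c1 c2] := col_mat3 ((S z)^-1 *: fz z) ((S z)^-1 *: fb z) (f z).
by elim/ord3P; rewrite /hframe ?c0 ?c1 ?c2 ?hermZr hermDl hermNl ?h1 ?h2 ?h3 subrr ?mulr0.
Qed.

(** The trace of the Hessian is a positive multiple of the horizontal part of [fzb]. Differentiated
    conformality relates the two horizontal components of [fzb], minimality makes them vanish, and
    [hl_rel] gives the component along [f]. *)
Lemma hl_fzb z : disc z -> fzb z = S z ^+ 2 *: f z.
Proof.
move=> dz'; have [m1 m2 m3] := hl_metric dz'; have [_ r2 _ _] := hl_rel dz'.
have m4 : herm (fb z) (fz z) = 0 by rewrite herm_sym m3 cJ0.
have z1 := hz dz'; have z2 := hb dz'.
have z3 : herm (f z) (fz z) = 0 by rewrite herm_sym z1 cJ0.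
have z4 : herm (f z) (fb z) = 0 by rewrite herm_sym z2 cJ0.
have h0 w : disc w -> herm (fz w) (fb w) = 0 by move=> /hl_metric[].
have [_ eB] := herm_cst_deriv dz' h0 (hl_wfz dz') (hl_wfb dz').
have {}eB : herm (fzb z) (fb z) = - (herm (fzb z) (fz z))^*.
  by rewrite -herm_sym; apply/eqP; rewrite -addr_eq0 eB.
have hess := @hl_trace_hessian z (2 * s z ^+ 2) dz'.
(* For a Lagrangian map, ['i] times a tangent vector is normal; minimality is tested on these
   vectors. *)
have key v : complex.Im (v^* * herm (fzb z) (fz z)) = 0.
  have orth : herm ('i%C *: (v *: fz z + v^* *: fb z)) (f z) = 0.
    by rewrite hermZl hermDl !hermZl z1 z2 !mulr0 addr0 mulr0.
  have H := @mini z ('i%C *: (v *: fz z + v^* *: fb z)) dz' orth.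
  have /H : forall w, complex.Re (herm ('i%C *: (v *: fz z + v^* *: fb z)) (dphi f w z)) = 0.
    move=> w; rewrite (hl_dphi _ dz') hermZl herm_comb m1 m2 m3 m4 !mulr0 !addr0.
    rewrite cJK -rmorphXn; case: (v) => a b; case: (w) => c d.
    by rewrite !conjcE /=; ring.
  have i_conj : ('i%C : R[i])^* = - 'i%C by exact: conj_i.
  rewrite hess; last 3 first.
  - by rewrite met // cJ1 mulr1 mulr1.
  - by rewrite met // i_conj mulrN (mul_ii (R := R)) opprK mulr1.
  - by rewrite met // i_conj mul1r !ReImE /= oppr0 mulr0.
  have hh (X : 'cV[R[i]]_3) : herm (hor f z X) (v *: fz z + v^* *: fb z) =
      v^* * herm X (fz z) + v * herm X (fb z).
    by rewrite /hor hermDl hermZl !hermDr !hermZr z3 z4 !mulr0 addr0 mulr0 addr0 cJK.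
  rewrite hermZl hermZr hh eB.
  have s0 : 0 < s z ^+ 2 by rewrite exprn_gt0 // s_gt0.
  move: (s z ^+ 2) s0 (herm (fzb z) (fz z)) => t t0 A; case: (v) => a b; case: (A) => c d.
  rewrite !conjcE /= => H'.
  have : 16 * t * (a * d - b * c) = 0 by rewrite -[RHS]H'; ring.
  have t16 : 0 < 16 * t by rewrite pmulr_rgt0.
  move/eqP; rewrite mulf_eq0 (gt_eqF t16) /= => /eqP e; rewrite -[RHS]e; ring.
(* The directions 1 and ['i] give the imaginary and the real part. *)
have A0 : herm (fzb z) (fz z) = 0.
  have := key 1; have := key 'i%C; case: (herm _ _) => a b.
  rewrite !conjcE /= => h1 h2.
  have b0 : b = 0 by rewrite -[RHS]h2; ring.
  have a0 : a = 0 by apply: oppr_inj; rewrite oppr0 -[RHS]h1; ring.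
  by rewrite a0 b0.
rewrite A0 cJ0 oppr0 in eB.
apply: (hframe_eq dz').
- by rewrite A0 hermZl z3 mulr0.
- by rewrite eB hermZl z4 mulr0.
- by rewrite r2 m1 hermZl ff // mulrN1.
Qed.
Let p z := (S z)^-1 * dz S z.
Let q z := (S z)^-1 * dzbar S z.

Lemma hl_fbfz z : disc z -> herm (fb z) (fz z) = 0.
Proof. by move=> /hl_metric[_ _ h]; rewrite herm_sym h cJ0. Qed.

Lemma hl_Q z : disc z -> herm (fzz z) (fb z) = - Q z.
Proof.
move=> dz'; rewrite QE // hl_cubic // ?opprK // => w /hl_metric[_ _ h]; exact: h.
Qed.

Lemma hl_wS2 z : disc z -> wd (fun w => S w ^+ 2) z (2 * S z * dz S z) (2 * S z * dzbar S z).
Proof.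
move=> dz'; have wS : wd S z (dz S z) (dzbar S z) := smooth_wd s_smooth dz'.
by apply: wd_eq (wdM wS wS) _ _; ring.
Qed.

(** The component along [fz] comes from differentiating [herm fz fz = S^2], where the term with
    [fzb] drops out because [fzb] is a multiple of [f]; the component along [fb] is [- Q], up to
    normalisation. *)
Lemma hl_fzz z : disc z -> fzz z = (2 * p z) *: fz z - (Q z * S z ^- 2) *: fb z.
Proof.
move=> dz'; have [m1 m2 m3] := hl_metric dz'; have [r1 _ _ _] := hl_rel dz'.
have S0 := hS_neq0 dz'.
have e1 : herm (fzz z) (fz z) = 2 * S z * dz S z.
  have h w : disc w -> herm (fz w) (fz w) = S w ^+ 2 by move=> /hl_metric[].
  have [+ _] := wd_unique (wd_disc h dz' (wd_herm (hl_wfz dz') (hl_wfz dz'))) (hl_wS2 dz').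
  by rewrite hl_fzb // hermZr [herm (fz z) (f z)]hz // mulr0 addr0.
apply: (hframe_eq dz').
- rewrite e1 hermDl hermNl !hermZl m1 hl_fbfz // mulr0 subr0 /p.
  by move: (dz S z) => x; field.
- rewrite hl_Q // hermDl hermNl !hermZl m2 m3 mulr0 sub0r.
  by move: (Q z) => x; field.
- by rewrite r1 m3 hermDl hermNl !hermZl hz // hb // !mulr0 subr0 oppr0.
Qed.

Lemma hl_fbb z : disc z -> fbb z = (2 * q z) *: fb z + ((Q z)^* * S z ^- 2) *: fz z.
Proof.
move=> dz'; have [m1 m2 m3] := hl_metric dz'; have [_ _ _ r4] := hl_rel dz'.
have S0 := hS_neq0 dz'.
have e1 : herm (fbb z) (fb z) = 2 * S z * dzbar S z.
  have h w : disc w -> herm (fb w) (fb w) = S w ^+ 2 by move=> /hl_metric[].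
  have [_ +] := wd_unique (wd_disc h dz' (wd_herm (hl_wfb dz') (hl_wfb dz'))) (hl_wS2 dz').
  by rewrite hl_fzb // hermZr [herm (fb z) (f z)]hb // mulr0 addr0.
have e2 : herm (fbb z) (fz z) = (Q z)^*.
  have [_ e] := herm_cst_deriv dz' hl_fbfz (hl_wfb dz') (hl_wfz dz').
  by move/eqP: e; rewrite addr_eq0 => /eqP ->; rewrite herm_sym hl_Q // cJN opprK.
apply: (hframe_eq dz').
- rewrite e2 hermDl !hermZl m1 hl_fbfz // mulr0 add0r.
  by move: ((Q z)^*) => x; field.
- rewrite e1 hermDl !hermZl m2 m3 mulr0 addr0 /q.
  by move: (dzbar S z) => x; field.
- by rewrite r4 hl_fbfz // hermDl !hermZl hz // hb // !mulr0 addr0 oppr0.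
Qed.

Lemma hframe_sol : sol (alphaA s Q) (alphaB s Q) hframe.
Proof.
move=> z dz'; have S0 := hS_neq0 dz'.
have wS : wd S z (dz S z) (dzbar S z) := smooth_wd s_smooth dz'.
have wV := wdV S0 wS.
have H := mwd_mat3 (mwdZ wV (hl_wfz dz')) (mwdZ wV (hl_wfb dz')) (hl_wf dz').
rewrite alphaAE alphaBE /hframe mat3_amx mat3_bmx.
apply: mwd_eq H _ _; congr (mat3 _ _ _).
- rewrite (hl_fzz dz') /p; move: (fz z) (fb z) (dz S z) (Q z) => x y k l.
  by apply/matrixP => i j; rewrite !mxE; move: (x i j) (y i j) => x' y'; field.
- rewrite (hl_fzb dz'); move: (f z) (fb z) (dz S z) => x y k.
  by apply/matrixP => i j; rewrite !mxE; move: (x i j) (y i j) => x' y'; field.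
- by rewrite scalerA divff // scale1r.
- rewrite (hl_fzb dz'); move: (f z) (fz z) (dzbar S z) => x y k.
  by apply/matrixP => i j; rewrite !mxE; move: (x i j) (y i j) => x' y'; field.
- rewrite (hl_fbb dz') /q; move: (fz z) (fb z) (dzbar S z) ((Q z)^*) => x y k l.
  by apply/matrixP => i j; rewrite !mxE; move: (x i j) (y i j) => x' y'; field.
- by rewrite scalerA divff // scale1r.
Qed.

Lemma hl_smooth_Q : smooth Q.
Proof.
have s3 : smooth_mx (entrywise dz (entrywise dz (entrywise dz f))).
  by exact (smooth_mx_dz (smooth_mx_dz hl_sfz)).
apply: smooth_eq (smooth_herm s3 sf) => z dz'.
by have := QE dz'; rewrite entrywise_iter => ->.
Qed.

Lemma hl_compat z : disc z -> dzbar Q z = 0 /\ gaussS s Q z.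
Proof.
move=> dz'; apply: (flat_alpha_inv s_gt0 s_smooth hl_smooth_Q dz').
have sA := smooth_alphaA s_gt0 s_smooth hl_smooth_Q.
have sB := smooth_alphaB s_gt0 s_smooth hl_smooth_Q.
exact: (sol_flat sA sB hframe_sol dz' (U21_unit (hframe_U21 dz'))).
Qed.

(* The frame has constant determinant of modulus 1, which is absorbed by a
   cube root. *)
Lemma hl_frame : exists (k : R[i]) F, [/\ k * k^* = 1, frame s Q F &
  forall z, disc z -> col 2%:R (F z) = k *: f z].
Proof.
pose d := \det (hframe 0).
have d1 : d * d^* = 1.
  have := congr1 (@determinant _ _) (hframe_U21 disc0); rewrite !det_mulmx.
  rewrite det_ctr -/d.
  have -> : \det J = -1 :> R[i] by rewrite det3E !mxE /=; ring.
  by rewrite mulrN1 mulNr => /eqP; rewrite eqr_opp => /eqP.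
pose k := (3.-root d)^-1.
have k3 : k ^+ 3 = d^-1 by rewrite exprVn rootCK.
have d0 : d != 0 by apply/eqP => d0; move: d1; rewrite d0 mul0r => /esym/eqP; rewrite oner_eq0.
have k1 : k * k^* = 1.
  rewrite -normCK; apply/eqP; rewrite sqrf_eq1; apply/orP; left.
  rewrite -(@pexpr_eq1 _ _ 3) // -normrX k3 normfV.
  have : `|d| ^+ 2 == 1 by rewrite normCK d1.
  by rewrite pexpr_eq1 // => /eqP ->; rewrite invr1.
have solF : sol (alphaA s Q) (alphaB s Q) (fun z => k *: hframe z).
  by move=> z dz'; apply: mwd_eq (mwdZl k (hframe_sol dz')) _ _; rewrite scalemxAl.
exists k, (fun z => k *: hframe z); split=> //.
  apply: (sol_frame s_gt0 s_smooth hl_smooth_Q solF); apply: (sol_SU21 s_smooth solF).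
  apply/SU21P; split; last by rewrite detZ k3 mulVf.
  have /herm_U21 h := hframe_U21 disc0; apply/herm_U21 => u v.
  by rewrite -!scalemxAl hermZl hermZr h mulrA k1 mul1r.
move=> z _; have [_ _ <-] := col_mat3 ((S z)^-1 *: fz z) ((S z)^-1 *: fb z) (f z).
by apply/matrixP => i j; rewrite !mxE.
Qed.
End Structure.
End HorizontalLift.
End Horizontal.

(** * Horizontal lifts of Lagrangian maps and isometries of the complex hyperbolic plane *)

Section Maps.
Context {R : realType}.
Implicit Types (f g : R[i] -> 'cV[R[i]]_3) (z v w : R[i]) (phi : R[i] -> set 'cV[R[i]]_3).

Lemma herm_hor (x y n : 'cV[R[i]]_3) : herm n n = -1 ->
  herm (x + herm x n *: n) (y + herm y n *: n) = herm x y + herm x n * (herm y n)^*.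
Proof.
move=> nn; rewrite !hermDl !hermDr !hermZl !hermZr nn (herm_sym y n).
by move: (herm x y) (herm x n) (herm y n) => *; ring.
Qed.

Lemma herm_hor_comb (v w : R[i]) (X Y n : 'cV[R[i]]_3) : herm n n = -1 ->
  herm (v *: X + v^* *: Y + herm (v *: X + v^* *: Y) n *: n)
    (w *: X + w^* *: Y + herm (w *: X + w^* *: Y) n *: n) =
  v * w^* * herm X X + v * w * herm X Y + v^* * w^* * (herm X Y)^* + v^* * w * herm Y Y
  + (v * herm X n + v^* * herm Y n) * (w * herm X n + w^* * herm Y n)^*.
Proof.
by move=> nn; rewrite (herm_hor _ _ nn) herm_comb -(herm_sym X Y) cJK !hermDl !hermZl.
Qed.

(** With [X] and [Y] the two Wirtinger derivatives of an arbitrary lift, the symplectic form on (1,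
    'i) reduces to the difference of their squared norms: the terms from projecting off [n] cancel
    by the second hypothesis. *)
Lemma symplectic_norms (X Y n : 'cV[R[i]]_3) : herm n n = -1 ->
  herm X n + (herm Y n)^* = 0 ->
  complex.Im (herm (1 *: X + 1^* *: Y + herm (1 *: X + 1^* *: Y) n *: n)
    ('i%C *: X + 'i%C^* *: Y + herm ('i%C *: X + 'i%C^* *: Y) n *: n)) = 0 ->
  herm X X = herm Y Y.
Proof.
move=> nn; rewrite (herm_hor_comb _ _ _ _ nn).
have := herm_self_real X; have := herm_self_real Y.
case: (herm X X) => p p'; case: (herm Y Y) => m m'; case: (herm X Y) => a b.
case: (herm X n) => c d; case: (herm Y n) => e f.
rewrite !conjcE /= => -[hm] [hp] [h1 h2] H.
have p0 : p' = 0 by lra.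
have m0 : m' = 0 by lra.
have e0 : e = - c by lra.
have f0 : f = d by lra.
rewrite p0 m0 e0 f0 in H *; apply: complex_ext => //=.
have : m - p = 0 by rewrite -[RHS]H; ring.
lra.
Qed.

(* On horizontal lifts the connection form [herm (df) f] vanishes; for a
   Lagrangian map this form is closed, and a primitive of it gives the phase
   that makes a lift horizontal. *)
Lemma horizontal_exists phi f : S_lift phi f ->
  (forall z v w, disc z -> pull_symplectic f z v w = 0) -> exists g, horizontal_lift phi g.
Proof.
move=> lf lag; have [sf hf] := lf.
have ff z : disc z -> herm (f z) (f z) = -1 by move=> /hf[].
have sfz : smooth_mx (entrywise dz f) by exact (smooth_mx_dz sf).
have sfb : smooth_mx (entrywise dzbar f) by exact (smooth_mx_dzbar sf).
pose a z := herm (entrywise dz f z) (f z); pose b z := herm (entrywise dzbar f z) (f z).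
have sa : smooth a := smooth_herm sfz sf; have sb : smooth b := smooth_herm sfb sf.
have ab z : disc z -> a z + (b z)^* = 0.
  move=> dz'; have wf := smooth_mwd sf dz'.
  by have [+ _] := herm_cst_deriv dz' ff wf wf; rewrite /a /b -herm_sym.
have PM z : disc z -> herm (entrywise dz f z) (entrywise dz f z) =
    herm (entrywise dzbar f z) (entrywise dzbar f z).
  move=> dz'; have := lag z 1 'i%C dz'; rewrite /pull_symplectic.
  rewrite !(dphiE _ (smooth_mwd sf dz')); exact: symplectic_norms (ff z dz') (ab z dz').
(* A closed scalar form is a flat connection of rank 1, so the integration theorem yields a function
   [c] with logarithmic differential [a dz + b dzbar]. *)
pose A z : 'M[R[i]]_1 := const_mx (a z); pose B z : 'M[R[i]]_1 := const_mx (b z).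
have sA : smooth_mx A by move=> i j; apply: smooth_eq sa => z _; rewrite mxE.
have sB : smooth_mx B by move=> i j; apply: smooth_eq sb => z _; rewrite mxE.
have flat z : disc z -> entrywise dzbar A z - entrywise dz B z = A z *m B z - B z *m A z.
  move=> dz'; have wf := smooth_mwd sf dz'.
  have wa := wd_herm (smooth_mwd sfz dz') wf.
  have wb := wd_herm (smooth_mwd sfb dz') wf.
  (* Both sides are the pairing of the mixed derivative with [f] plus a squared norm, and the norms
     agree by [PM]. *)
  have e1 : dzbar a z = dz b z.
    rewrite (wd_dzbar wa) (wd_dz wb) (entrywise_comm sf dz') (PM z dz') //.
  apply/matrixP => i j; rewrite !mxE !big_ord1 !mxE.
  have -> : (fun w => A w i j) = a by apply/funext => w; rewrite mxE.
  have -> : (fun w => B w i j) = b by apply/funext => w; rewrite mxE.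
  by rewrite e1 [b z * a z]mulrC !subrr.
have [F [sF F0 dF]] := flat_integrable sA sB flat.
pose c z := F z 0 0.
have sc : smooth c := sF 0 0.
have wc z : disc z -> wd c z (c z * a z) (c z * b z).
  by move=> /dF/(_ 0 0); rewrite !mxE !big_ord1 !mxE.
(* The form is purely imaginary by [ab], hence [|c|] is constant. *)
have c1 z : disc z -> c z * (c z)^* = 1.
  have c00 : c 0 * (c 0)^* = 1 by rewrite /c F0 mxE /= mulr1n cJ1 mulr1.
  rewrite -c00; apply: (@cst_disc _ (fun z => c z * (c z)^*)) => w dw.
  have ba : (b w)^* = - a w by apply/eqP; rewrite -addr_eq0 addrC ab.
  have ab' : (a w)^* = - b w by rewrite -[b w]cJK ba cJN opprK.
  apply: wd_eq (wdM (wc w dw) (wdJ (wc w dw))) _ _.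
    by rewrite cJM ba; ring.
  by rewrite cJM ab'; ring.
exists (fun z => c z *: f z); split; first exact: S_lift_scale.
move=> z dz'; have [-> ->] := mwd_entrywise (mwdZ (wc z dz') (smooth_mwd sf dz')).
rewrite !hermDl !hermZl !hermZr ff // -/(a z) -/(b z).
by split; ring.
Qed.

Section TwoHorizontalLifts.
Context (phi : R[i] -> set 'cV[R[i]]_3) (f g : R[i] -> 'cV[R[i]]_3).
Hypotheses (lf : horizontal_lift phi f) (lg : horizontal_lift phi g).

(** If [f] and [c f] are both horizontal, expanding [herm (d (c f)) (c f)] leaves only a nonzero
    multiple of [dc], which must vanish. *)
Lemma horizontal_unique : exists2 k : R[i], k * k^* = 1 & forall z, disc z -> g z = k *: f z.
Proof.
have [lf' hf] := lf; have [lg' hg] := lg.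
have [c [sc c1 gE]] := lift_change lf' lg'.
have [sf ff'] := lf'; have ff z : disc z -> herm (f z) (f z) = -1 by move=> /ff'[].
have cc z : disc z -> c z = c 0.
  apply: cst_disc => w dw; apply: wd_eq (smooth_wd sc dw) _ _.
    have [h1 _] := hg w dw; have [h2 _] := hf w dw.
    have [e _] := mwd_entrywise (phase_mwd sf sc gE dw).
    move: h1; rewrite e gE // hermDl !hermZl !hermZr ff // h2 !mulr0 addr0.
    have c0 : (c w)^* != 0.
      by apply/eqP => c0; have := c1 w dw; rewrite c0 mulr0 => /esym/eqP; rewrite oner_eq0.
    by rewrite mulrN1 mulrN => /eqP; rewrite oppr_eq0 mulf_eq0 (negbTE c0) orbF => /eqP.
  have [_ h1] := hg w dw; have [_ h2] := hf w dw.
  have [_ e] := mwd_entrywise (phase_mwd sf sc gE dw).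
  move: h1; rewrite e gE // hermDl !hermZl !hermZr ff // h2 !mulr0 addr0.
  have c0 : (c w)^* != 0.
    by apply/eqP => c0; have := c1 w dw; rewrite c0 mulr0 => /esym/eqP; rewrite oner_eq0.
  by rewrite mulrN1 mulrN => /eqP; rewrite oppr_eq0 mulf_eq0 (negbTE c0) orbF => /eqP.
exists (c 0); first by rewrite c1 //; exact: disc0.
by move=> z dz'; rewrite gE // cc.
Qed.
End TwoHorizontalLifts.

Lemma entrywise_dz_scale m n (F G : R[i] -> 'M[R[i]]_(m, n)) k : smooth_mx F ->
  (forall z, disc z -> G z = k *: F z) ->
  forall z, disc z -> entrywise dz G z = k *: entrywise dz F z.
Proof.
move=> sF GE z dz'; have h w : disc w -> k *: F w = G w by move=> /GE ->.
by have [-> _] := mwd_entrywise (mwd_disc h dz' (mwdZl k (smooth_mwd sF dz'))).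
Qed.

Lemma herm_phase k (u v : 'cV[R[i]]_3) : k * k^* = 1 -> herm (k *: u) (k *: v) = herm u v.
Proof. by move=> k1; rewrite hermZl hermZr mulrA k1 mul1r. Qed.

Lemma cubic_scale f g k z : smooth_mx f -> k * k^* = 1 ->
  (forall z, disc z -> g z = k *: f z) -> disc z ->
  herm (entrywise (fun k => dz (dz (dz k))) g z) (g z) =
  herm (entrywise (fun k => dz (dz (dz k))) f z) (f z).
Proof.
move=> sf k1 gE dz'; rewrite !entrywise_iter.
have s1 : smooth_mx (entrywise dz f) by exact (smooth_mx_dz sf).
have s2 : smooth_mx (entrywise dz (entrywise dz f)) by exact (smooth_mx_dz s1).
have e1 := entrywise_dz_scale sf gE.
have e2 := entrywise_dz_scale s1 e1.
have e3 := entrywise_dz_scale s2 e2.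
exact: etrans (congr2 herm (e3 z dz') (gE z dz')) (herm_phase _ _ k1).
Qed.

(** * Properties of a map read off an arbitrary lift *)

Section AnyLift.
Context (phi : R[i] -> set 'cV[R[i]]_3) (f : R[i] -> 'cV[R[i]]_3).
Hypothesis lf : S_lift phi f.

Lemma lift_from g : S_lift phi g -> exists c : R[i] -> R[i],
  [/\ smooth_mx g, forall z, disc z -> herm (g z) (g z) = -1, smooth c,
   forall z, disc z -> c z * (c z)^* = 1 & forall z, disc z -> f z = c z *: g z].
Proof.
move=> lg; have [c [sc c1 e]] := lift_change lg lf; exists c; case: lg => sg hg; split=> //.
by move=> z /hg[].
Qed.

Lemma immersion_lift : immersion phi -> forall z v, disc z -> dphi f v z = 0 -> v = 0.
Proof.
case=> g lg h z v dz'; have [c [sg gg sc c1 fE]] := lift_from lg.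
rewrite (phase_dphi sg gg sc c1 fE) // => /eqP; rewrite scaler_eq0 => /orP[/eqP c0|/eqP]; last exact: h.
by have := c1 z dz'; rewrite c0 mul0r => /esym/eqP; rewrite oner_eq0.
Qed.

Lemma induced_metric_lift lam : induced_metric phi lam ->
  forall z v w, disc z -> pull_metric f z v w = lam z * complex.Re (v * w^*).
Proof.
case=> g lg h z v w dz'; have [c [sg gg sc c1 fE]] := lift_from lg.
by rewrite (phase_pull_metric sg gg sc c1 fE) // h.
Qed.

(** A vector normal to the map as seen by [f = c g] becomes normal as seen by [g] after
    multiplication by the conjugate of [c]. *)
Lemma minimal_lift : minimal phi -> forall z (n : 'cV[R[i]]_3), disc z -> herm n (f z) = 0 ->
  (forall v, complex.Re (herm n (dphi f v z)) = 0) ->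
  complex.Re (herm (trace_hessian f z) n) = 0.
Proof.
case=> g lg h z n dz'; have [c [sg gg sc c1 fE]] := lift_from lg.
rewrite fE // (phase_trace_hessian sg gg sc c1 fE) // hermZl hermZr => h1 h2.
have c0 : c z != 0.
  by apply/eqP => c0; have := c1 z dz'; rewrite c0 mul0r => /esym/eqP; rewrite oner_eq0.
have := h z ((c z)^* *: n) dz'; rewrite hermZl h1 hermZr cJK; apply => // v.
by have := h2 v; rewrite (phase_dphi sg gg sc c1 fE) // hermZr hermZl.
Qed.
End AnyLift.

(** * The group acting on the complex hyperbolic plane *)

Lemma mact_proj (P : 'M[R[i]]_3) (u : 'cV[R[i]]_3) : mact P (proj_pt u) = proj_pt (P *m u).
Proof.
apply/seteqP; split=> w.
  by case=> _ [l l0 <-] <-; exists l => //; rewrite scalemxAr.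
case=> l l0 <-; exists (l *: u); first by exists l.
by rewrite scalemxAr.
Qed.

Lemma mactM (P S : 'M[R[i]]_3) p : mact (P *m S) p = mact P (mact S p).
Proof.
apply/seteqP; split=> w; first by case=> u pu <-; exists (S *m u); [exists u|rewrite mulmxA].
by case=> _ [u pu <-] <-; exists u => //; rewrite mulmxA.
Qed.

Lemma mact1 (p : set 'cV[R[i]]_3) : mact 1%:M p = p.
Proof.
apply/seteqP; split=> w; first by case=> u pu <-; rewrite mul1mx.
by move=> pw; exists w => //; rewrite mul1mx.
Qed.

Lemma mact_CH2 (P : 'M[R[i]]_3) p : U21 P -> CH2 p -> CH2 (mact P p).
Proof.
move=> /herm_U21 hP [u /= hu <-]; rewrite mact_proj; exists (P *m u) => //=.
by rewrite hP.
Qed.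

Lemma S_lift_mact (P : 'M[R[i]]_3) phi f : U21 P -> S_lift phi f ->
  S_lift (fun z => mact P (phi z)) (fun z => P *m f z).
Proof.
move=> /herm_U21 hP [sf hf]; split; first exact (smooth_mxM (smooth_mx_cst P) sf).
by move=> z /hf[h1 h2]; rewrite hP -h2 mact_proj.
Qed.

Lemma dphi_mact (P : 'M[R[i]]_3) f v z : U21 P -> smooth_mx f -> disc z ->
  dphi (fun z => P *m f z) v z = P *m dphi f v z.
Proof.
move=> /herm_U21 hP sf dz'; have wf := smooth_mwd sf dz'.
rewrite (dphiE v (mwdMl P wf)) (dphiE v wf).
have e (a b : 'cV[R[i]]_3) : v *: (P *m a) + v^* *: (P *m b) = P *m (v *: a + v^* *: b).
  by rewrite mulmxDr -!scalemxAr.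
by rewrite e hP [RHS]mulmxDr -[in RHS](scalemxAr _ P).
Qed.

Lemma pull_metric_mact (P : 'M[R[i]]_3) f z v w : U21 P -> smooth_mx f -> disc z ->
  pull_metric (fun z => P *m f z) z v w = pull_metric f z v w.
Proof.
by move=> hP sf dz'; rewrite /pull_metric !dphi_mact //; move/herm_U21: hP => ->.
Qed.

Lemma mact_isometry (P : 'M[R[i]]_3) : U21 P -> CH2_isometry (mact P).
Proof.
move=> hP; have hV := U21V hP; have uP := U21_unit hP.
split.
  split.
  - by move=> p; exact: mact_CH2.
  - by move=> p p' _ _ e; rewrite -[p]mact1 -[p']mact1 -(mulVmx uP) !mactM e.
  - move=> p Cp; exists (mact (invmx P) p); first exact: mact_CH2.
    by rewrite -mactM mulmxV // mact1.
move=> psi f lf; exists (fun z => P *m f z); first exact: S_lift_mact.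
by move=> z v w dz'; rewrite pull_metric_mact //; case: lf.
Qed.
End Maps.

(** * The map defined by a frame *)
Section FrameMap.
Context {R : realType}.
Implicit Types (z v w : R[i]).

Lemma mat3_col (M : 'M[R[i]]_3) : mat3 (col 0 M) (col 1 M) (col 2%:R M) = M.
Proof.
by apply/matrixP => i j; rewrite !mxE; elim/ord3P: j.
Qed.

Lemma mwd_col m n (F : R[i] -> 'M[R[i]]_(m, n)) z A B j : mwd F z A B ->
  mwd (fun w => col j (F w)) z (col j A) (col j B).
Proof. by move=> h i k; rewrite !mxE; apply: wd_ext (h i j) => w; rewrite mxE. Qed.

Lemma smooth_col m n (F : R[i] -> 'M[R[i]]_(m, n)) j : smooth_mx F ->
  smooth_mx (fun w => col j (F w)).
Proof. by move=> h i k; apply: smooth_eq (h i j) => z _; rewrite mxE. Qed.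

Lemma ord_max3 : ord_max = 2%:R :> 'I_3. Proof. exact/val_inj. Qed.

Lemma mulmx_col n m (P : 'M[R[i]]_n) (M : 'M[R[i]]_(n, m)) j : P *m col j M = col j (P *m M).
Proof. by rewrite !colE mulmxA. Qed.

Lemma proj_ptZ (k : R[i]) (u : 'cV[R[i]]_3) : k != 0 -> proj_pt (k *: u) = proj_pt u.
Proof.
move=> k0; apply/seteqP; split=> w; case=> l /= l0 <-.
  by exists (l * k); rewrite /= ?scalerA // mulf_neq0.
by exists (l / k); rewrite /= ?scalerA ?divfK // mulf_neq0 ?invr_eq0.
Qed.

Context (s : R[i] -> R) (Q : R[i] -> R[i]) (F : R[i] -> 'M[R[i]]_3).
Hypothesis s_gt0 : forall z, disc z -> 0 < s z.
Hypothesis s_smooth : smooth (fun z => (s z)%:C).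
Hypothesis hF : frame s Q F.

Let S z := (s z)%:C.
Let p z := (S z)^-1 * dz S z.
Let q z := (S z)^-1 * dzbar S z.
Let c z := Q z * S z ^- 2.
Let d z := (Q z)^* * S z ^- 2.
Let e0 z := col 0 (F z).
Let e1 z := col 1 (F z).
Let f z := col 2%:R (F z).

Lemma fm_deriv z : disc z ->
  [/\ mwd e0 z (p z *: e0 z - c z *: e1 z) (S z *: f z - q z *: e0 z),
      mwd e1 z (S z *: f z - p z *: e1 z) (d z *: e0 z + q z *: e1 z)
    & mwd f z (S z *: e0 z) (S z *: e1 z)].
Proof.
move=> dz'; have := frame_sol hF dz'.
rewrite alphaAE alphaBE -{1 2}(mat3_col (F z)) mat3_amx mat3_bmx.
rewrite -!/(e0 z) -!/(e1 z) -!/(f z) => H.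
have [a0 a1 a2] := col_mat3 (p z *: e0 z - c z *: e1 z) (S z *: f z - p z *: e1 z) (S z *: e0 z).
have [b0 b1 b2] := col_mat3 (S z *: f z - q z *: e0 z) (d z *: e0 z + q z *: e1 z) (S z *: e1 z).
split; [have := mwd_col 0 H | have := mwd_col 1 H | have := mwd_col 2%:R H].
- by rewrite a0 b0.
- by rewrite a1 b1.
by rewrite a2 b2.
Qed.

Lemma fm_herm z i j : disc z -> herm (col j (F z)) (col i (F z)) = (J : 'M[R[i]]_3) i j.
Proof.
move=> dz'; have [_ uF _] := hF; have /SU21P[/U21_ctr u _] := uF z dz'.
by rewrite -ctr_herm u.
Qed.

Lemma fm_basis z : disc z ->
  [/\ herm (e0 z) (e0 z) = 1, herm (e1 z) (e1 z) = 1, herm (f z) (f z) = -1,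
      herm (e0 z) (e1 z) = 0 & herm (e0 z) (f z) = 0 /\ herm (e1 z) (f z) = 0].
Proof. by move=> dz'; split; rewrite ?fm_herm // ?mxE //; split; rewrite fm_herm // mxE. Qed.

Lemma fm_smooth : smooth_mx f.
Proof. by have [sF _ _] := hF; exact (smooth_col _ sF). Qed.

Lemma fm_norm z : disc z -> herm (f z) (f z) = -1.
Proof. by case/fm_basis. Qed.

Lemma fm_dz z : disc z -> entrywise dz f z = S z *: e0 z.
Proof. by move=> /fm_deriv[_ _ /mwd_entrywise[]]. Qed.
Lemma fm_dzbar z : disc z -> entrywise dzbar f z = S z *: e1 z.
Proof. by move=> /fm_deriv[_ _ /mwd_entrywise[]]. Qed.

Lemma fm_hz z : disc z -> herm (entrywise dz f z) (f z) = 0.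
Proof. by move=> dz'; rewrite fm_dz // hermZl; have [_ _ _ _ [-> _]] := fm_basis dz'; rewrite mulr0. Qed.
Lemma fm_hb z : disc z -> herm (entrywise dzbar f z) (f z) = 0.
Proof. by move=> dz'; rewrite fm_dzbar // hermZl; have [_ _ _ _ [_ ->]] := fm_basis dz'; rewrite mulr0. Qed.

Lemma fm_lift : horizontal_lift (frame_map F) f.
Proof.
split; last by move=> z dz'; split; [exact: fm_hz|exact: fm_hb].
split; first exact fm_smooth.
by move=> z dz'; split; [exact: fm_norm | rewrite /frame_map ord_max3].
Qed.

Lemma fm_pull v w z : disc z ->
  herm (dphi f v z) (dphi f w z) = S z ^+ 2 * (v * w^* + (v * w^*)^*).
Proof.
move=> dz'; rewrite (hl_dphi_herm fm_smooth fm_hz fm_hb v w dz') fm_dz // fm_dzbar //.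
have [h0 h1 _ h01 _] := fm_basis dz'; have h10 : herm (e1 z) (e0 z) = 0 by rewrite herm_sym h01 cJ0.
rewrite !hermZl !hermZr h0 h1 h01 h10 cJM cJK (S_conj s z).
by rewrite -/(S z); move: (S z) (v^*) (w^*) => *; ring.
Qed.

Lemma addJ (x : R[i]) : x + x^* = (2 * complex.Re x)%:C.
Proof. by case: x => a b; apply/eqP; rewrite eq_complex /= subrr eqxx andbT mulrDl mul1r. Qed.

Lemma fm_pull_real v w z : disc z ->
  herm (dphi f v z) (dphi f w z) = (s z ^+ 2 * (2 * complex.Re (v * w^*)))%:C.
Proof. by move=> dz'; rewrite fm_pull // addJ /S -rmorphXn -rmorphM. Qed.

Lemma fm_metric z v w : disc z -> pull_metric f z v w = 2 * s z ^+ 2 * complex.Re (v * w^*).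
Proof. by move=> dz'; rewrite /pull_metric fm_pull_real //=; ring. Qed.

Lemma fm_symplectic z v w : disc z -> pull_symplectic f z v w = 0.
Proof. by move=> dz'; rewrite /pull_symplectic fm_pull_real. Qed.

Lemma fm_immersion z v : disc z -> dphi f v z = 0 -> v = 0.
Proof.
move=> dz' h; have := fm_metric v v dz'; rewrite /pull_metric h herm0l /=.
move=> /esym/eqP; rewrite mulf_eq0 mulf_eq0 pnatr_eq0 /= sqrf_eq0 gt_eqF ?s_gt0 //=.
case: v {h} => a b /= /eqP e; have : a ^+ 2 + b ^+ 2 = 0 by rewrite -[RHS]e; ring.
by move/eqP; rewrite paddr_eq0 ?sqr_ge0 // !sqrf_eq0 => /andP[/eqP -> /eqP ->].
Qed.

Lemma fm_deriv_dz z : disc z ->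
  mwd (entrywise dz f) z (dz S z *: e0 z + S z *: (p z *: e0 z - c z *: e1 z))
                         (S z ^+ 2 *: f z).
Proof.
move=> dz'; have [w0 _ _] := fm_deriv dz'.
have H := mwdZ (smooth_wd s_smooth dz') w0.
apply: (mwd_disc (F := fun w => S w *: e0 w)) (dz') _ => [w dw|]; first by rewrite fm_dz.
apply: mwd_eq H _ _ => //; rewrite scalerBr !scalerA -expr2 /q mulrA divff ?mul1r; last exact: (S_neq0 s_gt0 dz').
by rewrite addrC subrK.
Qed.

(** The mixed derivative of [f] is [S^2 f], whose horizontal part is zero, so the whole trace of the
    Hessian vanishes. *)
Lemma fm_minimal z (n : 'cV[R[i]]_3) : disc z -> herm n (f z) = 0 ->
  (forall v, complex.Re (herm n (dphi f v z)) = 0) ->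
  complex.Re (herm (trace_hessian f z) n) = 0.
Proof.
move=> dz' _ _.
have m := fm_metric _ _ dz'.
have [_ e] := mwd_entrywise (fm_deriv_dz dz').
rewrite (hl_trace_hessian fm_smooth fm_hz fm_hb dz' (l := 2 * s z ^+ 2)); first last.
- by rewrite m /=; ring.
- by rewrite m /=; ring.
- by rewrite m /=; ring.
by rewrite e /hor !hermZl fm_norm // mulrN1 scaleNr subrr herm0l mulr0.
Qed.

Lemma fm_cubic z : disc z ->
  Q z = herm (entrywise (fun k => dz (dz (dz k))) f z) (f z).
Proof.
move=> dz'; have [h0 h1 _ h01 _] := fm_basis dz'; have S0 := S_neq0 s_gt0 dz'.
rewrite (hl_cubic fm_smooth fm_hz fm_hb dz').
  have [-> _] := mwd_entrywise (fm_deriv_dz dz').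
  rewrite fm_dzbar // !hermDl !hermZl !hermDl !hermNl !hermZl !hermZr h1 h01 (S_conj s z) /c.
  by move: S0; rewrite -/(S z); move: (S z) (Q z) (dz S z) => x y t x0; field.
by move=> w dw; rewrite fm_dz // fm_dzbar // hermZl hermZr; have [_ _ _ -> _] := fm_basis dw; rewrite !mulr0.
Qed.

Lemma frame_map_mli : minimal_lagrangian_immersion (frame_map F).
Proof.
have [lf _] := fm_lift; split; exists f => //.
- exact: fm_immersion.
- exact: fm_symplectic.
exact: fm_minimal.
Qed.

Lemma frame_map_metric lam : (forall z, disc z -> s z ^+ 2 = lam z / 2) ->
  induced_metric (frame_map F) lam.
Proof.
move=> e; have [lf _] := fm_lift; exists f => // z v w dz'.
by rewrite fm_metric // e // mulrC; field.
Qed.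

Lemma frame_map_cubic : induced_cubic (frame_map F) Q.
Proof.
split; first by exists f; exact: fm_lift.
move=> g lg z dz'; have [k k1 e] := horizontal_unique fm_lift lg.
by rewrite (cubic_scale fm_smooth k1 e dz') fm_cubic.
Qed.

(** A horizontal lift of [psi] yields a frame for the same [s] and [Q]; two frames differ by a
    constant matrix on the left, which acts by an isometry. *)
Lemma frame_map_unique psi lam : (forall z, disc z -> s z ^+ 2 = lam z / 2) ->
  minimal_lagrangian_immersion psi -> induced_metric psi lam -> induced_cubic psi Q ->
  exists2 T, CH2_isometry T & forall z, disc z -> psi z = T (frame_map F z).
Proof.
move=> e [_ _ mini] met [[g lg] QE].
have [lg' hg] := lg; have [sg gg'] := lg'.
have gg z : disc z -> herm (g z) (g z) = -1 by move=> /gg'[].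
have hgz z : disc z -> herm (entrywise dz g z) (g z) = 0 by move=> /hg[].
have hgb z : disc z -> herm (entrywise dzbar g z) (g z) = 0 by move=> /hg[].
have met' z v w : disc z -> pull_metric g z v w = 2 * s z ^+ 2 * complex.Re (v * w^*).
  by move=> dz'; rewrite (induced_metric_lift lg' met) // e //; field.
have [k [G [k1 hG GE]]] := hl_frame sg gg hgz hgb s_gt0 s_smooth met' (minimal_lift lg' mini) (QE g lg).
have [P uP PE] := frame_unique s_smooth hF hG.
exists (mact P); first by apply: mact_isometry; case/SU21P: uP.
move=> z dz'; have [_ <-] := gg' z dz'.
rewrite /frame_map ord_max3 mact_proj (mulmx_col P) -PE // GE //.
by rewrite proj_ptZ //; apply/eqP => k0; move/eqP: k1; rewrite k0 mul0r eq_sym oner_eq0.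
Qed.
End FrameMap.

(** * Holonomy *)
Section Pullback.
Context {R : realType}.
Implicit Types (z v w : R[i]).

Definition diag3 (a b c : R[i]) : 'M[R[i]]_3 := mx3 [:: [:: a; 0; 0]; [:: 0; b; 0]; [:: 0; 0; c]].

(** The [dz] part of a gauge transformation: pulled-back coefficient times the twist, plus the
    derivative of the twist, equals the twist times the original coefficient. [bmx_diag] is the
    [dzbar] part. *)
Lemma amx_diag (e e' t k p c S p' c' S' : R[i]) :
  p = t * p' + k -> t * S' = e * S -> e' * c = t * c' * e -> t * S' * e' = S ->
  t *: (amx p' c' S' *m diag3 e e' 1) + diag3 (e * k) (- (e' * k)) 0 =
  diag3 e e' 1 *m amx p c S.
Proof.
move=> -> h1 h2 h3; apply/matrixP => i j; rewrite !mxE !sum3E !mxE.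
elim/ord3P: i; elim/ord3P: j; rewrite /= ?(mulr0, mul0r, mulr1, mul1r, addr0, add0r) //; try by ring.
  by rewrite mulrN h2; ring.
by rewrite -h3; ring.
Qed.

Lemma bmx_diag (e e' t k q d S q' d' S' : R[i]) :
  q = t * q' + k -> t * S' = e' * S -> e * d = t * d' * e' -> t * S' * e = S ->
  t *: (bmx q' d' S' *m diag3 e e' 1) + diag3 (- (e * k)) (e' * k) 0 =
  diag3 e e' 1 *m bmx q d S.
Proof.
move=> -> h1 h2 h3; apply/matrixP => i j; rewrite !mxE !sum3E !mxE.
elim/ord3P: i; elim/ord3P: j; rewrite /= ?(mulr0, mul0r, mulr1, mul1r, addr0, add0r) //; try by ring.
  by rewrite h2; ring.
by rewrite -h3; ring.
Qed.

Lemma wd_diag3 (a b c : R[i] -> R[i]) z a1 a2 b1 b2 c1 c2 :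
  wd a z a1 a2 -> wd b z b1 b2 -> wd c z c1 c2 ->
  mwd (fun w => diag3 (a w) (b w) (c w)) z (diag3 a1 b1 c1) (diag3 a2 b2 c2).
Proof.
move=> ha hb hc i j; rewrite !mxE.
apply: (@wd_ext _ (fun w => (nth [::] [:: [:: a w; 0; 0]; [:: 0; b w; 0]; [:: 0; 0; c w]] i)`_j)).
  by move=> w; rewrite mxE.
have h0 := wd_cst 0 z.
by elim/ord3P: i; elim/ord3P: j.
Qed.

Lemma SU21_diag3 e : e * e^* = 1 -> SU21 (diag3 e e^* 1).
Proof.
move=> ee; apply/SU21P; split.
  apply/matrixP => i j; rewrite !mxE !sum3E !mxE !sum3E !mxE.
  elim/ord3P: i; elim/ord3P: j; rewrite /= ?(mulr0, mul0r, mulr1, mul1r, addr0, add0r, cJ0, cJ1, cJK) //.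
  by rewrite mulrC.
by rewrite det3E !mxE /= -[RHS]ee; ring.
Qed.

Lemma col_diag3 m (M : 'M[R[i]]_(m, 3)) a b : col 2%:R (M *m diag3 a b 1) = col 2%:R M.
Proof. by apply/matrixP => i j; rewrite !mxE !sum3E !mxE /=; ring. Qed.

Definition twist (g : R[i] -> R[i]) z : 'M[R[i]]_3 :=
  diag3 (dz g z / `|dz g z|) ((dz g z)^* / `|dz g z|) 1.

Context (s : R[i] -> R) (Q : R[i] -> R[i]) (g : R[i] -> R[i]).
Hypothesis s_gt0 : forall z, disc z -> 0 < s z.
Hypothesis s_smooth : smooth (fun z => (s z)%:C).
Hypothesis Q_smooth : smooth Q.
Hypothesis dg : forall z, disc z -> disc (g z).
Hypothesis g_hol : holomorphic g.
Hypothesis sg : forall z, disc z -> (s (g z))%:C * `|dz g z| = (s z)%:C.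
Hypothesis Qg : forall z, disc z -> Q (g z) * dz g z ^+ 3 = Q z.

Let S z := (s z)%:C.
Let t := dz g.
(** On the disc this is the modulus of [dz g], written as a quotient of smooth functions so that it
    can be differentiated. *)
Let n z := S z / S (g z).
(** Half the logarithmic derivative of [dz g]: the logarithmic [dz] derivative of its modulus, and
    also of its unit phase [e]. *)
Let k z := dz t z / (2 * t z).

Lemma pb_S0 z : disc z -> S z != 0. Proof. exact: S_neq0. Qed.

Lemma pb_nE z : disc z -> `|t z| = n z.
Proof. by move=> dz'; rewrite /n /S -(sg dz') [_ * `|_|]mulrC mulfK //; exact: pb_S0 (dg dz'). Qed.

Lemma pb_n0 z : disc z -> n z != 0.
Proof. by move=> dz'; rewrite mulf_neq0 ?invr_eq0 ?pb_S0 //; exact: dg. Qed.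

Lemma pb_t0 z : disc z -> t z != 0.
Proof. by move=> dz'; rewrite -normr_eq0 pb_nE // pb_n0. Qed.

Lemma pb_nn z : disc z -> n z ^+ 2 = t z * (t z)^*.
Proof. by move=> dz'; rewrite -pb_nE // normCK. Qed.

Lemma pb_nJ z : (n z)^* = n z.
Proof. by rewrite /n !cJE. Qed.

Lemma pb_wg z : disc z -> wd g z (t z) 0.
Proof. by move=> dz'; rewrite -(g_hol.2 z dz'); exact: smooth_wd g_hol.1 dz'. Qed.

Lemma pb_wt z : disc z -> wd t z (dz t z) 0.
Proof.
move=> dz'; have st : smooth t by exact: smooth_dz g_hol.1.
apply: wd_eq (smooth_wd st dz') _ _ => //.
rewrite /t -dz_dzbar //; last exact: g_hol.1.
rewrite (dz_eq (g := fun=> 0)) //; last by exact: smooth_dzbar g_hol.1.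
  exact: wd_dz (wd_cst 0 z).
exact: g_hol.2.
Qed.

(** Differentiate [n^2 = t t^*], where [t] is holomorphic, and divide by [2 n]. *)
Lemma pb_wn z : disc z -> wd n z (n z * k z) (n z * (k z)^*).
Proof.
move=> dz'; have n0 := pb_n0 dz'; have t0 := pb_t0 dz'.
have sn : smooth n.
  by apply: smoothM s_smooth (smoothV _ (smooth_comp dg s_smooth g_hol.1)) => w dw; exact: pb_S0 (dg dw).
have w1 := smooth_wd sn dz'.
have w2 := wdM (pb_wt dz') (wdJ (pb_wt dz')).
have w3 : wd (fun w => n w * n w) z _ _ := wdM w1 w1.
have [e1 e2] : dz n z * n z + n z * dz n z = dz t z * (t z)^* + t z * 0^* /\
   dzbar n z * n z + n z * dzbar n z = 0 * (t z)^* + t z * (dz t z)^*.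
  apply: wd_unique w3 _; apply: wd_disc (dz') w2 => w dw.
  by rewrite -pb_nn // expr2.
have nn := pb_nn dz'.
have tJ0 : (t z)^* != 0 by rewrite conjC_eq0.
apply: wd_eq w1 _ _.
- apply: (mulIf n0); apply: (mulIf two_neq0).
  have -> : dz n z * n z * 2 = dz t z * (t z)^* by rewrite -[RHS]addr0 -(mulr0 (t z)) -cJ0 -e1; ring.
  have -> : n z * k z * n z * 2 = n z ^+ 2 * k z * 2 by ring.
  by rewrite nn /k; move: t0; move: (t z) (dz t z) => x y x0; field.
- apply: (mulIf n0); apply: (mulIf two_neq0).
  have -> : dzbar n z * n z * 2 = t z * (dz t z)^* by rewrite -[RHS]add0r -(mul0r (t z)^*) -e2; ring.
  have -> : n z * (k z)^* * n z * 2 = n z ^+ 2 * (k z)^* * 2 by ring.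
  rewrite nn /k cJM cJV cJM cJn; move: tJ0; move: (t z) ((t z)^*) ((dz t z)^*) => x x' y x0; field.
  exact: x0.
Qed.

Let e z := t z / n z.

Lemma pb_eJ z : (e z)^* = (t z)^* / n z.
Proof. by rewrite /e cJM cJV pb_nJ. Qed.

Lemma pb_ee z : disc z -> e z * (e z)^* = 1.
Proof.
move=> dz'; have n0 := pb_n0 dz'.
by rewrite pb_eJ /e mulf_div -pb_nn // expr2 divff // mulf_neq0.
Qed.

Lemma pb_we z : disc z -> wd e z (e z * k z) (- (e z * (k z)^*)).
Proof.
move=> dz'; have n0 := pb_n0 dz'; have t0 := pb_t0 dz'.
apply: wd_eq (wdM (pb_wt dz') (wdV n0 (pb_wn dz'))) _ _; rewrite /e.
  by rewrite /k; move: n0 t0; move: (n z) (t z) (dz t z) => x y y' x0 y0; field; rewrite x0 y0.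
by move: n0; move: (n z) (t z) ((k z)^*) => x y y' x0; field; rewrite x0.
Qed.

Lemma pb_rot z : disc z -> twist g z = diag3 (e z) (e z)^* 1.
Proof. by move=> dz'; rewrite /twist pb_eJ /e -/t pb_nE. Qed.

Lemma pb_wrot z : disc z ->
  mwd (twist g) z (diag3 (e z * k z) (- ((e z)^* * k z)) 0)
                (diag3 (- (e z * (k z)^*)) ((e z)^* * (k z)^*) 0).
Proof.
move=> dz'; have we := pb_we dz'.
apply: (mwd_disc (F := fun w => diag3 (e w) (e w)^* 1)) (dz') _ => [w dw|]; first by rewrite pb_rot.
apply: wd_diag3 (we) _ (wd_cst 1 z).
by apply: wd_eq (wdJ we) _ _; rewrite ?cJN cJM ?cJK.
Qed.

Lemma pb_p z : disc z -> (S z)^-1 * dz S z = t z * ((S (g z))^-1 * dz S (g z)) + k z /\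
  (S z)^-1 * dzbar S z = (t z)^* * ((S (g z))^-1 * dzbar S (g z)) + (k z)^*.
Proof.
move=> dz'; have S0 := pb_S0 dz'; have S0' := pb_S0 (dg dz').
have H := wdM (pb_wn dz') (wd_comp (smooth_wd s_smooth (dg dz')) (pb_wg dz')).
have [-> ->] : dz S z = (n z * k z) * S (g z) + n z * (dz S (g z) * t z + dzbar S (g z) * 0^*) /\
   dzbar S z = n z * (k z)^* * S (g z) + n z * (dz S (g z) * 0 + dzbar S (g z) * (t z)^*).
  apply: wd_unique (smooth_wd s_smooth dz') _; apply: wd_disc (dz') H => w dw.
  by rewrite /n divfK //; exact: pb_S0 (dg dw).
rewrite /n cJ0; move: S0 S0'; move: (S z) (S (g z)) (k z) (dz S (g z)) (dzbar S (g z)) (t z) => a b c d e' f a0 b0.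
by split; field; rewrite a0 b0.
Qed.

(** Composition with [g] pulls back the connection form; the twist by the phase of [dz g] is the
    gauge transformation that restores [alpha], thanks to the transformation rules of [s] and
    [Q]. *)
Lemma pullback_frame F : frame s Q F -> frame s Q (fun z => F (g z) *m twist g z).
Proof.
move=> hF; apply: (sol_frame s_gt0 s_smooth Q_smooth) => z dz'; last first.
  have [_ uF _] := hF; rewrite pb_rot //; apply: SU21M; first exact: uF (dg dz').
  exact: SU21_diag3 (pb_ee dz').
have H := mwdM (mwd_comp (frame_sol hF (dg dz')) (pb_wg dz')) (pb_wrot dz').
have S0 := pb_S0 dz'; have S0' := pb_S0 (dg dz'); have n0 := pb_n0 dz'; have t0 := pb_t0 dz'.
have tJ0 : (t z)^* != 0 by rewrite conjC_eq0.
have nn := pb_nn dz'.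
have Sn : S z = n z * S (g z) by rewrite /n divfK.
have [p1 q1] := pb_p dz'.
have ac : (t z)^* / n z * (Q z * S z ^- 2) = t z * (Q (g z) * S (g z) ^- 2) * (t z / n z).
  have tt : (t z)^* = n z ^+ 2 / t z by rewrite nn mulrC mulKf.
  rewrite tt -Qg // -/t Sn; move: S0' n0 t0; move: (S (g z)) (n z) (t z) (Q (g z)) => a b c d a0 b0 c0.
  by field; rewrite a0 b0 c0.
have h2 : t z * S (g z) = t z / n z * S z.
  by rewrite Sn; move: n0; move: (S (g z)) (n z) (t z) => a b c b0; field.
have h2' : (t z)^* * S (g z) = (t z)^* / n z * S z.
  by rewrite Sn; move: n0; move: (S (g z)) (n z) ((t z)^*) => a b c b0; field.
have h3 : t z * S (g z) * ((t z)^* / n z) = S z.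
  transitivity (t z * (t z)^* * S (g z) / n z); first by ring.
  by rewrite -nn Sn; move: n0; move: (S (g z)) (n z) => a b b0; field.
have h3' : (t z)^* * S (g z) * (t z / n z) = S z.
  transitivity (t z * (t z)^* * S (g z) / n z); first by ring.
  by rewrite -nn Sn; move: n0; move: (S (g z)) (n z) => a b b0; field.
have bc : t z / n z * ((Q z)^* * S z ^- 2) = (t z)^* * ((Q (g z))^* * S (g z) ^- 2) * ((t z)^* / n z).
  have := congr1 Num.conj ac.
  by rewrite !cJM !cJV pb_nJ !cJK !cJX !(S_conj s).
have EA : t z *: (alphaA s Q (g z) *m twist g z) + diag3 (e z * k z) (- ((e z)^* * k z)) 0 =
    twist g z *m alphaA s Q z.
  by rewrite pb_rot // pb_eJ; exact (amx_diag p1 h2 ac h3).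
have EB : (t z)^* *: (alphaB s Q (g z) *m twist g z) +
    diag3 (- (e z * (k z)^*)) ((e z)^* * (k z)^*) 0 = twist g z *m alphaB s Q z.
  by rewrite pb_rot // pb_eJ; exact (bmx_diag q1 h2' bc h3').
apply: mwd_eq H _ _.
  by rewrite cJ0 !scale0r addr0 -scalemxAl -!mulmxA scalemxAr -mulmxDr EA.
by rewrite !scale0r add0r -scalemxAl -!mulmxA scalemxAr -mulmxDr EB.
Qed.
End Pullback.

Section Monodromy.
Context {R : realType} {G : groupType} (act : G -> R[i] -> R[i]).
Hypothesis Gdeck : deck_group act.
Implicit Types (z : R[i]) (rho : G -> 'M[R[i]]_3).

Lemma mulmx_unitI (P A B : 'M[R[i]]_3) : P \in unitmx -> A *m P = B *m P -> A = B.
Proof. by move=> uP e; rewrite -(mulmxK uP A) e mulmxK. Qed.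

Lemma cocycleE g z : cocycle act g z = twist (act g) z. Proof. by []. Qed.

Lemma act_deriv_mul g h z : disc z ->
  dz (act (g * h)%g) z = dz (act g) (act h z) * dz (act h) z.
Proof.
move=> dz'; have dhz := deck_disc Gdeck h dz'.
have wa k w : disc w -> wd (act k) w (dz (act k) w) 0.
  move=> dw; have [sk hk] := deck_holomorphic Gdeck k.
  by rewrite -(hk w dw); exact: smooth_wd.
have H := wd_comp (wa g _ dhz) (wa h z dz').
rewrite mul0r addr0 in H; apply: (wd_dz (b := 0)).
apply: (wd_disc _ dz' (wd_eq H (erefl _) _)) => [w dw|]; first by rewrite (deck_mul Gdeck).
by rewrite mulr0 mul0r addr0.
Qed.

Lemma diag3M (a b c a' b' c' : R[i]) :
  diag3 a b c *m diag3 a' b' c' = diag3 (a * a') (b * b') (c * c').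
Proof.
apply/matrixP => i j; rewrite !mxE !sum3E !mxE.
by elim/ord3P: i; elim/ord3P: j; rewrite /= ?(mulr0, mul0r, addr0, add0r).
Qed.

Lemma cocycleM g h z : disc z ->
  cocycle act (g * h)%g z = cocycle act g (act h z) *m cocycle act h z.
Proof.
move=> dz'; rewrite !cocycleE /twist act_deriv_mul // diag3M mulr1 normrM cJM invfM.
by rewrite mulrACA [X in diag3 _ X _]mulrACA.
Qed.

Lemma monodromy_conj (P : 'M[R[i]]_3) F rho : P \in unitmx -> monodromy act F rho ->
  monodromy act (fun z => P *m F z) (fun g => P *m rho g *m invmx P).
Proof. by move=> uP h g z dz'; rewrite h // !mulmxA mulmxKV. Qed.

Lemma SU_rep_conj (P : 'M[R[i]]_3) rho : SU21 P -> SU_rep rho ->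
  SU_rep (fun g => P *m rho g *m invmx P).
Proof.
move=> hP [h1 h2]; have uP := SU21_unit hP; split=> [g|g h].
  by apply: SU21M (SU21V hP); apply: SU21M.
by rewrite h2 !mulmxA mulmxKV.
Qed.

Context (s : R[i] -> R) (Q : R[i] -> R[i]).
Hypothesis s_gt0 : forall z, disc z -> 0 < s z.
Hypothesis s_smooth : smooth (fun z => (s z)%:C).
Hypothesis Q_smooth : smooth Q.
Hypothesis s_inv : forall g z, disc z -> (s (act g z))%:C * `|dz (act g) z| = (s z)%:C.
Hypothesis Q_inv : forall g z, disc z -> Q (act g z) * dz (act g) z ^+ 3 = Q z.

Lemma cocycle_SU21 g z : disc z -> SU21 (cocycle act g z).
Proof.
move=> dz'; have dg := deck_disc Gdeck g; have hg := deck_holomorphic Gdeck g.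
rewrite cocycleE (pb_rot s_gt0 dg (s_inv g) dz').
exact: SU21_diag3 (pb_ee s_gt0 dg (s_inv g) dz').
Qed.

Lemma cocycle_unit g z : disc z -> cocycle act g z \in unitmx.
Proof. by move=> dz'; exact: SU21_unit (cocycle_SU21 g dz'). Qed.

Lemma monodromy_exists F : frame s Q F -> exists2 rho, SU_rep rho & monodromy act F rho.
Proof.
move=> hF; have [_ uF _] := hF.
have uF' z : disc z -> F z \in unitmx by move=> dz'; exact: SU21_unit (uF z dz').
have ex g : exists P, SU21 P /\ forall z, disc z -> F (act g z) *m cocycle act g z = P *m F z.
  have [P hP e] := frame_unique s_smooth hF (pullback_frame s_gt0 s_smooth Q_smooth
    (deck_disc Gdeck g) (deck_holomorphic Gdeck g) (s_inv g) (Q_inv g) hF).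
  by exists P.
have [rho hrho] := choice ex.
exists rho; last first.
  by move=> g z dz'; rewrite -(hrho g).2 // mulmxK //; exact: cocycle_unit.
split=> [g|g h]; first exact: (hrho g).1.
have d0 := @disc0 R; have dh := deck_disc Gdeck h d0.
(* [rho] is determined by its products with the invertible [F 0], where the cocycle rule for the
   twists gives multiplicativity. *)
apply: (mulmx_unitI (uF' 0 d0)); rewrite -(hrho _).2 //.
by rewrite (deck_mul Gdeck) // cocycleM // mulmxA (hrho g).2 // -mulmxA (hrho h).2 // mulmxA.
Qed.

Lemma monodromy_unique F rho rho' : frame s Q F ->
  monodromy act F rho -> monodromy act F rho' -> rho =1 rho'.
Proof.
move=> [_ uF _] h h' g; have d0 := @disc0 R.
have := h' g 0 d0; rewrite h // => /mulmx_unitI e; apply: (mulmx_unitI (SU21_unit (uF 0 d0))).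
by apply: e; rewrite unitmx_inv cocycle_unit.
Qed.

Lemma holonomy_conj F rho : frame s Q F -> SU_rep rho -> monodromy act F rho ->
  forall rho', holonomy act s Q rho' <->
    exists2 P, SU21 P & forall g, rho' g = P *m rho g *m invmx P.
Proof.
move=> hF rrho hrho rho'; split.
  move=> [rrho' [F' hF' hrho']]; have [P hP e] := frame_unique s_smooth hF hF'.
  exists P => // g.
  have m : monodromy act F' (fun g => P *m rho g *m invmx P).
    move=> g' z dz'; rewrite !e //; last exact: deck_disc Gdeck g' _ dz'.
    exact: monodromy_conj (SU21_unit hP) hrho g' z dz'.
  exact: (monodromy_unique hF' hrho' m).
move=> [P hP e]; have -> : rho' = fun g => P *m rho g *m invmx P by apply/funext.
split; first exact: SU_rep_conj.
exists (fun z => P *m F z); first exact: frame_mul.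
by apply: monodromy_conj => //; exact: SU21_unit.
Qed.

(** The cocycle fixes the third basis vector, so the third column of the frame is equivariant
    without a phase. *)
Lemma monodromy_col F rho g z : monodromy act F rho -> disc z ->
  col 2%:R (F (act g z)) = rho g *m col 2%:R (F z).
Proof.
move=> h dz'; rewrite -(col_diag3 _ (dz (act g) z / `|dz (act g) z|) ((dz (act g) z)^* / `|dz (act g) z|)).
by rewrite -/(twist (act g) z) -cocycleE h // mulmxKV ?cocycle_unit // mulmx_col.
Qed.

End Monodromy.

(** * Equivariant maps *)
Section Equivariance.
Context {R : realType}.
Implicit Types (z v w : R[i]).

Lemma mwd_comp_hol m n (F : R[i] -> 'M[R[i]]_(m, n)) g z A B c :
  mwd F (g z) A B -> wd g z c 0 -> mwd (fun w => F (g w)) z (c *: A) (c^* *: B).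
Proof.
move=> h h'; apply: mwd_eq (mwd_comp h h') _ _; last by rewrite scale0r add0r.
by rewrite cJ0 scale0r addr0.
Qed.

Context (f : R[i] -> 'cV[R[i]]_3) (s : R[i] -> R) (Q : R[i] -> R[i]).
Hypothesis sf : smooth_mx f.
Hypothesis ff : forall z, disc z -> herm (f z) (f z) = -1.
Hypothesis hz : forall z, disc z -> herm (entrywise dz f z) (f z) = 0.
Hypothesis hb : forall z, disc z -> herm (entrywise dzbar f z) (f z) = 0.
Hypothesis s_gt0 : forall z, disc z -> 0 < s z.
Hypothesis met : forall z v w, disc z ->
  pull_metric f z v w = 2 * s z ^+ 2 * complex.Re (v * w^*).
Hypothesis QE : forall z, disc z ->
  Q z = herm (entrywise (fun k => dz (dz (dz k))) f z) (f z).

(** Differentiating at 0, the two matrices also agree on [f_z] and [f_zbar], which together with [f]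
    form a basis. *)
Lemma hframe_fix (M M' : 'M[R[i]]_3) :
  (forall z, disc z -> M *m f z = M' *m f z) -> M = M'.
Proof.
move=> e; have d0 := @disc0 R.
have wf := smooth_mwd sf d0.
have [e1 e2] := mwd_unique (mwd_disc e d0 (mwdMl M wf)) (mwdMl M' wf).
have uX := U21_unit (hframe_U21 sf ff hz hb s_gt0 met d0).
apply: (mulmx_unitI uX).
have mulmx_mat3 (N : 'M[R[i]]_3) a b c : N *m mat3 a b c = mat3 (N *m a) (N *m b) (N *m c).
  apply/matrixP => i j; rewrite !mxE !sum3E !mxE.
  by elim/ord3P: j.
by rewrite /hframe !mulmx_mat3 -!scalemxAr e1 e2 e.
Qed.

Context (g : R[i] -> R[i]) (B : 'M[R[i]]_3).
Hypothesis dg : forall z, disc z -> disc (g z).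
Hypothesis g_hol : holomorphic g.
Hypothesis uB : U21 B.
Hypothesis fg : forall z, disc z -> f (g z) = B *m f z.

Let t := dz g.

Lemma eqv_deriv z : disc z -> t z *: entrywise dz f (g z) = B *m entrywise dz f z /\
  (t z)^* *: entrywise dzbar f (g z) = B *m entrywise dzbar f z.
Proof.
move=> dz'; have H := mwd_comp_hol (smooth_mwd sf (dg dz')) (pb_wg g_hol dz').
have [e1 e2] := mwd_unique (mwd_disc fg dz' H) (mwdMl B (smooth_mwd sf dz')).
by rewrite -e1 -e2.
Qed.

Lemma eqv_deriv2 z : disc z ->
  dz t z *: entrywise dz f (g z) + t z ^+ 2 *: entrywise dz (entrywise dz f) (g z) =
  B *m entrywise dz (entrywise dz f) z.
Proof.
move=> dz'.
have H := mwdZ (pb_wt g_hol dz') (mwd_comp_hol (hl_wfz sf (dg dz')) (pb_wg g_hol dz')).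
have e w : disc w -> t w *: entrywise dz f (g w) = B *m entrywise dz f w by case/eqv_deriv.
have [<- _] := mwd_unique (mwd_disc e dz' H) (mwdMl B (hl_wfz sf dz')).
by rewrite scalerA.
Qed.

(** [B] preserves the norm of [f_z], which is [s], and the chain rule contributes the modulus of
    [dz g]. *)
Lemma eqv_s z : disc z -> (s (g z))%:C * `|dz g z| = (s z)%:C.
Proof.
move=> dz'; have [m1 _ _] := hl_metric sf hz hb met dz'.
have [m1' _ _] := hl_metric sf hz hb met (dg dz').
have [e1 _] := eqv_deriv dz'.
have := (herm_U21 B).1 uB (entrywise dz f z) (entrywise dz f z).
rewrite -e1 hermZl hermZr m1 m1' mulrA -normCK -exprMn => /eqP.
rewrite eqrXn2 // ?mulr_ge0 ?normr_ge0 ?lecR ?ltW ?s_gt0 //; last exact: dg.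
by move/eqP <-; rewrite mulrC.
Qed.

(** [Q] is minus the pairing of [f_zz] with [f_zbar]. The chain rule gives [t^2] on the left and,
    after conjugation, one more [t] on the right; the term with the second derivative of [g] dies by
    conformality. *)
Lemma eqv_Q z : disc z -> Q (g z) * dz g z ^+ 3 = Q z.
Proof.
move=> dz'; have [_ _ m3] := hl_metric sf hz hb met (dg dz').
have [_ e1] := eqv_deriv dz'; have e2 := eqv_deriv2 dz'.
have q := hl_Q sf hz hb met QE dz'; have q' := hl_Q sf hz hb met QE (dg dz').
have := (herm_U21 B).1 uB (entrywise dz (entrywise dz f) z) (entrywise dzbar f z).
rewrite -e1 -e2 q -/t; move: m3 q'; move: (entrywise dz f _) (entrywise dzbar f _)
  (entrywise dz (entrywise dz f) _) (dz t z) (t z) => a b c d x m3 q'.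
rewrite hermDl !hermZl !hermZr cJK m3 q' => e.
by rewrite -[RHS]opprK -e; ring.
Qed.
End Equivariance.

Section Converse.
Context {R : realType} {G : groupType} (act : G -> R[i] -> R[i]).
Hypothesis Gdeck : deck_group act.

Lemma horizontal_pullback phi f g : (forall z : R[i], disc z -> disc (g z)) -> holomorphic g ->
  horizontal_lift phi f -> horizontal_lift (phi \o g) (f \o g).
Proof.
move=> dg gh [[sf hf] hh]; split.
  split; first exact (smooth_mx_comp dg gh.1 sf).
  by move=> z dz' /=; exact: hf (dg z dz').
move=> z dz' /=; have H := mwd_comp_hol (smooth_mwd sf (dg z dz')) (pb_wg gh dz').
have [-> ->] := mwd_entrywise H; have [h1 h2] := hh _ (dg z dz').
by split; rewrite hermZl ?h1 ?h2 mulr0.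
Qed.

Lemma horizontal_mact (A : 'M[R[i]]_3) phi f : U21 A -> horizontal_lift phi f ->
  horizontal_lift (fun z => mact A (phi z)) (fun z => A *m f z).
Proof.
move=> uA [lf hf]; split; first exact: S_lift_mact.
move=> z dz'; have [-> ->] := mwd_entrywise (mwdMl A (smooth_mwd lf.1 dz')).
by rewrite !((herm_U21 A).1 uA); exact: hf.
Qed.

Lemma horizontal_eq phi psi (f : R[i] -> 'cV[R[i]]_3) : (forall z, disc z -> phi z = psi z) ->
  horizontal_lift phi f -> horizontal_lift psi f.
Proof.
by move=> e [[sf hf] hh]; split=> //; split=> // z dz'; rewrite -e //; exact: hf.
Qed.

Lemma U21_scale (k : R[i]) A : k * k^* = 1 -> U21 A -> U21 (k *: A).
Proof.
move=> k1 /herm_U21 hA; apply/herm_U21 => x y.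
by rewrite -!scalemxAl herm_phase.
Qed.

Lemma PSU_class_scale (c : R[i]) A : c ^+ 3 = 1 -> PSU_class (c *: A) = PSU_class A.
Proof.
move=> c3; have c0 : c != 0 by apply/eqP => c0; move/eqP: c3; rewrite c0 expr0n eq_sym oner_eq0.
apply/seteqP; split=> X; case=> l /= l3 <-.
  by exists (l * c); rewrite /= ?scalerA // exprMn l3 c3 mulr1.
by exists (l / c); rewrite /= ?scalerA ?divfK // exprMn exprVn l3 c3 mul1r invr1.
Qed.

Lemma PSU21_rep X : PSU21 X -> exists A : 'M[R[i]]_3, [/\ SU21 A, X A & X = PSU_class A].
Proof.
by case=> A hA <-; exists A; split=> //; exists 1; rewrite /= ?expr1n // scale1r.
Qed.

End Converse.

(** * The data determined by an equivariant minimal Lagrangian immersion *)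

Section ConverseData.
Context {R : realType} {G : groupType} (act : G -> R[i] -> R[i]).
Hypothesis Gdeck : deck_group act.
Context (h : R[i] -> R).
Hypothesis hmetric : metric_on act h.
Context (phi : R[i] -> set 'cV[R[i]]_3) (rhobar : G -> set 'M[R[i]]_3).
Hypothesis phi_immersion : immersion phi.
Hypothesis phi_minimal : minimal phi.
Hypothesis rhobar_rep : PSU_rep rhobar.
Hypothesis phi_equiv : forall g z A, disc z -> rhobar g A -> phi (act g z) = mact A (phi z).
Context (lam : R[i] -> R) (f : R[i] -> 'cV[R[i]]_3).
Hypothesis phi_metric : induced_metric phi lam.
Hypothesis f_lift : horizontal_lift phi f.
Implicit Types (z v w : R[i]).

Let sf : smooth_mx f. Proof. exact: f_lift.1.1. Qed.
Let ff z : disc z -> herm (f z) (f z) = -1.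
Proof. by move=> /(f_lift.1.2 z)[]. Qed.
Let hz z : disc z -> herm (entrywise dz f z) (f z) = 0.
Proof. by move=> /(f_lift.2 z)[]. Qed.
Let hb z : disc z -> herm (entrywise dzbar f z) (f z) = 0.
Proof. by move=> /(f_lift.2 z)[]. Qed.

Let met := induced_metric_lift f_lift.1 phi_metric.

Let dphi_f v z : disc z -> herm (dphi f v z) (f z) = 0.
Proof. by move=> dz'; rewrite /dphi /hor hermDl hermZl ff // mulrN1 subrr. Qed.

Lemma conv_lam z : disc z -> lam z = complex.Re (herm (dphi f 1 z) (dphi f 1 z)).
Proof. by move=> dz'; rewrite -/(pull_metric f z 1 1) met // cJ1 mulr1 mulr1. Qed.

(** The form is positive definite on the complement of [f], and an immersion has nonzero
    differential there. *)
Lemma conv_lam_gt0 z : disc z -> 0 < lam z.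
Proof.
move=> dz'; have [p0 pe] := herm_posdef (ff dz') (dphi_f 1 dz').
rewrite conv_lam // lt_neqAle p0 andbT eq_sym; apply/eqP => /pe e.
by have /eqP := immersion_lift f_lift.1 phi_immersion dz' e; rewrite oner_eq0.
Qed.

(** [lam] is given as a bare function; its smoothness is recovered by writing it through the smooth
    lift. *)
Lemma conv_lam_smooth : smooth (fun z => (lam z)%:C).
Proof.
have sd : smooth_mx (dphi f 1) by exact (smooth_dphi sf 1).
apply: smooth_eq (smooth_herm sd sd) => z dz'; rewrite conv_lam //.
have := herm_self_real (dphi f 1 z); case: (herm _ _) => a b /= e.
apply: complex_ext => //=; have := congr1 (@complex.Im R) e => /= /eqP.
by rewrite eqNr => /eqP.
Qed.

Let h_smooth : smooth (fun z => (h z)%:C). Proof. by case: hmetric. Qed.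
Let h_gt0 z : disc z -> 0 < h z. Proof. by case: hmetric => _ + _; apply. Qed.

Definition conf_factor z : R := ln (lam z / h z).
Let u := conf_factor.

Let ratio_gt0 z : disc z -> 0 < lam z / h z.
Proof. by move=> dz'; rewrite divr_gt0 ?conv_lam_gt0 ?h_gt0. Qed.

Lemma conv_expu z : disc z -> expR (u z) * h z = lam z.
Proof. by move=> dz'; rewrite lnK ?posrE ?ratio_gt0 // divfK // gt_eqF // h_gt0. Qed.

Lemma conv_u_smooth : smooth (fun z => (u z)%:C).
Proof.
apply: smooth_ln; first exact: ratio_gt0.
have hV : smooth (fun z => (h z)%:C^-1) by apply: smoothV h_smooth; exact: S_neq0 h_gt0.
by apply: smooth_eq (smoothM conv_lam_smooth hV) => z _; rewrite rmorphM fmorphV.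
Qed.

Let s := s_of h u.
Definition cubic_coef z := herm (entrywise (fun k => dz (dz (dz k))) f z) (f z).
Let Q := cubic_coef.

Let s_gt0 : forall z, disc z -> 0 < s z. Proof. exact: s_of_gt0. Qed.
Let s_smooth : smooth (fun z => (s z)%:C).
Proof. exact: s_of_smooth h_gt0 h_smooth conv_u_smooth. Qed.
Let s_sqr z : disc z -> s z ^+ 2 = lam z / 2.
Proof. by move=> dz'; rewrite s_of_sqr // conv_expu. Qed.
Let metS z v w : disc z -> pull_metric f z v w = 2 * s z ^+ 2 * complex.Re (v * w^*).
Proof. by move=> dz'; rewrite met // s_sqr //; field. Qed.
Let QE z : disc z -> Q z = herm (entrywise (fun k => dz (dz (dz k))) f z) (f z).
Proof. by []. Qed.
Let Q_smooth : smooth Q. Proof. exact (hl_smooth_Q sf QE). Qed.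
Let mini := minimal_lift f_lift.1 phi_minimal.

Lemma conv_equiv g : exists (c : R[i]) (A : 'M[R[i]]_3),
  [/\ c * c^* = 1, SU21 A, rhobar g = PSU_class A &
    forall z, disc z -> f (act g z) = (c *: A) *m f z].
Proof.
have [A [hA gA eA]] := PSU21_rep (rhobar_rep.1 g).
have uA : U21 A by case/SU21P: hA.
have l1 := horizontal_mact uA f_lift.
have l2 : horizontal_lift (fun z => mact A (phi z)) (f \o act g).
  apply: horizontal_eq (horizontal_pullback (deck_disc Gdeck g) (deck_holomorphic Gdeck g) f_lift) => z dz' /=.
  exact: phi_equiv.
have [c c1 e] := horizontal_unique l1 l2.
by exists c, A; split=> // z dz'; rewrite -scalemxAl -e.
Qed.

Lemma conv_inv g z : disc z ->
  (s (act g z))%:C * `|dz (act g) z| = (s z)%:C /\ Q (act g z) * dz (act g) z ^+ 3 = Q z.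
Proof.
move=> dz'; have [c [A [c1 /SU21P[uA _] _ e]]] := conv_equiv g.
have uB := U21_scale c1 uA.
have dg := deck_disc Gdeck g; have gh := deck_holomorphic Gdeck g.
split; first exact: (eqv_s sf hz hb s_gt0 metS dg gh uB e dz').
exact: (eqv_Q sf hz hb metS QE dg gh uB e dz').
Qed.

(** The induced metric and [h] transform by the same factor, the squared modulus of the derivative
    of the deck transformation, so their ratio is invariant. *)
Lemma conv_u_inv g z : disc z -> u (act g z) = u z.
Proof.
move=> dz'; have dgz := deck_disc Gdeck g dz'.
have [e _] := conv_inv g dz'; have [_ _ hi] := hmetric.
rewrite /u /conf_factor; congr ln; apply: complexI.
have lE w : disc w -> (lam w)%:C = 2 * ((s w)%:C * (s w)%:C).
  move=> dw; have -> : lam w = 2 * (s w * s w) by rewrite -expr2 s_sqr //; field.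
  by rewrite !rmorphM rmorph_nat.
have ratC w : (lam w / h w)%:C = (lam w)%:C / (h w)%:C by rewrite rmorphM fmorphV.
rewrite !ratC !lE // -e -(hi g z dz').
have h0 := S_neq0 h_gt0 dgz; have t0 : `|dz (act g) z| != 0.
  by apply/eqP => t0; move: e (S_neq0 s_gt0 dz'); rewrite t0 mulr0 => <-; rewrite eqxx.
by move: h0 t0; move: ((h _)%:C) ((s _)%:C) (`|_|) => a b c a0 c0; field; rewrite a0 c0.
Qed.

Lemma conv_function_on : function_on act u.
Proof. by split; [exact: conv_u_smooth|exact: conv_u_inv]. Qed.

Lemma conv_induced_metric : induced_metric phi (fun z => expR (u z) * h z).
Proof. by exists f; [exact: f_lift.1|move=> z v w dz'; rewrite met // conv_expu]. Qed.

Let compat := hl_compat sf ff hz hb s_gt0 s_smooth metS mini QE.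

Lemma conv_cubic_on : cubic_on act Q.
Proof.
split; first by split; [exact: Q_smooth|move=> z dz'; exact: (compat dz').1].
by move=> g z dz'; exact: (conv_inv g dz').2.
Qed.

Lemma conv_induced_cubic : induced_cubic phi Q.
Proof.
split; first by exists f.
move=> g lg z dz'; have [k k1 e] := horizontal_unique f_lift lg.
by rewrite (cubic_scale sf k1 e dz').
Qed.

Lemma conv_gauss : gauss_equation h Q u.
Proof.
move=> z dz'; apply/(gauss_equivS Q h_gt0 h_smooth conv_u_smooth dz').
exact: (compat dz').2.
Qed.

Lemma conv_monodromy : exists F rho, [/\ frame s Q F, SU_rep rho, monodromy act F rho &
  forall g, rhobar g = PSU_class (rho g)].
Proof.
have [k [F [k1 hF FE]]] := hl_frame sf ff hz hb s_gt0 s_smooth metS mini QE.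
have s_inv g z dz' := (@conv_inv g z dz').1.
have Q_inv g z dz' := (@conv_inv g z dz').2.
have [rho rrho hrho] := monodromy_exists Gdeck s_gt0 s_smooth Q_smooth s_inv Q_inv hF.
exists F, rho; split=> // g.
have k0 : k != 0 by apply/eqP => k0; move/eqP: k1; rewrite k0 mul0r eq_sym oner_eq0.
have [c [A [c1 hA -> e]]] := conv_equiv g.
(* The third column of the frame is transformed by [rho g] and, being [k f], also by [c A]. *)
have E : rho g = c *: A.
  apply: (hframe_fix sf ff hz hb s_gt0 metS) => z dz'.
  have := monodromy_col Gdeck s_gt0 s_inv g hrho dz'.
  rewrite !FE //; last exact: deck_disc Gdeck g _ dz'.
  by rewrite e // -scalemxAr => /(scalerI k0).
rewrite E PSU_class_scale //.
have := rrho.1 g => /SU21P[_]; rewrite E detZ.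
by case/SU21P: hA => _ ->; rewrite mulr1.
Qed.

Lemma conv_holonomy rho : holonomy act s Q rho ->
  exists2 P, SU21 P & forall g, rhobar g = PSU_class (P *m rho g *m invmx P).
Proof.
have [F [rho1 [hF r1 m1 e1]]] := conv_monodromy.
have s_inv g z dz' := (@conv_inv g z dz').1.
move=> /(holonomy_conj Gdeck s_gt0 s_smooth Q_smooth s_inv hF r1 m1)[P hP e].
exists (invmx P) => [|g]; first exact: SU21V.
have uP := SU21_unit hP.
by rewrite e1 e invmxK !mulmxA mulVmx // mul1mx -mulmxA mulVmx // mulmx1.
Qed.

End ConverseData.

Local Open Scope complex_scope.

Theorem theorem4p1 (R : realType) (G : groupType) (act : G -> R[i] -> R[i])
    (Gdeck : deck_group act) (h : R[i] -> R) (hmetric : metric_on act h) :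
  (forall (Q : R[i] -> R[i]) (u : R[i] -> R),
     cubic_on act Q -> function_on act u -> gauss_equation h Q u ->
     (exists F, frame (s_of h u) Q F) /\
     forall F, frame (s_of h u) Q F ->
       [/\ minimal_lagrangian_immersion (frame_map F),
           induced_metric (frame_map F) (fun z => expR (u z) * h z) /\
             induced_cubic (frame_map F) Q,
           forall psi : R[i] -> set 'cV[R[i]]_3,
             minimal_lagrangian_immersion psi ->
             induced_metric psi (fun z => expR (u z) * h z) ->
             induced_cubic psi Q ->
             exists2 T, CH2_isometry T &
               forall z, disc z -> psi z = T (frame_map F z)
         & exists rho : G -> 'M[R[i]]_3,
             [/\ holonomy act (s_of h u) Q rho,
                 monodromy act F rho,
                 forall g z, disc z ->
                   frame_map F (act g z) = mact (rho g) (frame_map F z)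
               & forall rho' : G -> 'M[R[i]]_3,
                   holonomy act (s_of h u) Q rho' <->
                   exists2 P, SU21 P &
                     forall g, rho' g = P *m rho g *m invmx P]])
  /\
  (forall (phi : R[i] -> set 'cV[R[i]]_3) (rhobar : G -> set 'M[R[i]]_3),
     minimal_lagrangian_immersion phi -> conformal phi ->
     PSU_rep rhobar ->
     (forall g z A, disc z -> rhobar g A -> phi (act g z) = mact A (phi z)) ->
     exists (u : R[i] -> R) (Q : R[i] -> R[i]),
       [/\ function_on act u /\
             induced_metric phi (fun z => expR (u z) * h z),
           cubic_on act Q /\ induced_cubic phi Q,
           gauss_equation h Q u,
           exists rho : G -> 'M[R[i]]_3, holonomy act (s_of h u) Q rho
         & forall rho : G -> 'M[R[i]]_3, holonomy act (s_of h u) Q rho ->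
             exists2 P, SU21 P &
               forall g, rhobar g = PSU_class (P *m rho g *m invmx P)]).
Proof.
split.
  move=> Q u [[sQ hQ] Qinv] [su uinv] gauss.
  have [sh h_gt0 hinv] := hmetric.
  have s_gt0 := s_of_gt0 u h_gt0.
  have s_smooth := s_of_smooth h_gt0 sh su.
  have s_sqr := s_of_sqr u h_gt0.
  (* Both sides are nonnegative, so their squares may be compared, and there the transformation rule
     of [h] applies directly. *)
  have s_inv g z : disc z -> (s_of h u (act g z))%:C * `|dz (act g) z| = (s_of h u z)%:C.
    move=> dz'; have dgz := deck_disc Gdeck g dz'; apply/eqP.
    rewrite -(eqrXn2 (n := 2)) // ?mulr_ge0 ?lecR ?sqrtr_ge0 ?normr_ge0 //.
    have sC w : disc w -> (s_of h u w)%:C ^+ 2 = (expR (u w))%:C * (h w)%:C / 2%:C.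
      by move=> dw; rewrite -rmorphXn s_sqr // !rmorphM fmorphV.
    apply/eqP; rewrite exprMn !sC // uinv // -(hinv g z dz').
    by move: ((expR _)%:C) ((h _)%:C) (`|_|) (2%:C) => *; ring.
  split; first by apply: (frame_exists s_gt0 s_smooth sQ hQ) => z dz'; apply/(gauss_equivS Q h_gt0 sh su dz'); exact: gauss.
  move=> F hF; split.
  - exact: frame_map_mli hF.
  - by split; [exact: frame_map_metric hF _ s_sqr|exact: frame_map_cubic hF].
  - move=> psi; exact: frame_map_unique hF psi _ s_sqr.
  have [rho rrho hrho] := monodromy_exists Gdeck s_gt0 s_smooth sQ s_inv Qinv hF.
  exists rho; split=> //; first by split=> //; exists F.
    by move=> g z dz'; rewrite /frame_map ord_max3 (monodromy_col Gdeck s_gt0 s_inv g hrho dz') mact_proj.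
  exact: (holonomy_conj Gdeck s_gt0 s_smooth sQ s_inv hF rrho hrho).
move=> phi rhobar [imm [f0 lf0 lag] mini] [lam met] rep equiv.
have [f lf] := horizontal_exists lf0 lag.
exists (conf_factor h lam), (cubic_coef f); split.
- split; first exact (conv_function_on Gdeck hmetric imm rep equiv met lf).
  exact (conv_induced_metric hmetric imm met lf).
- split; last exact (conv_induced_cubic lf).
  exact (conv_cubic_on Gdeck hmetric imm mini rep equiv met lf).
- exact (conv_gauss hmetric imm mini met lf).
- have [F [rho [hF r m _]]] := conv_monodromy Gdeck hmetric imm mini rep equiv met lf.
  by exists rho; split=> //; exists F.
exact (conv_holonomy Gdeck hmetric imm mini rep equiv met lf).
Qed.
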